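(* Let $X=\Sigma_{\boldsymbol a}$ be an $\boldsymbol a$-adic solenoid, and assume that $X$ contains no elements of order $2$. Let $\alpha$ be a topological automorphism of the group $X$, and put $K=\mathrm{Ker}(I+\alpha)$. Let $\xi_1$ and $\xi_2$ be independent random variables with values in $X$ and with distributions $\mu_1$ and $\mu_2$ whose characteristic functions do not vanish. Assume that the conditional distribution of the linear form $L_2=\xi_1+\alpha\xi_2$ given $L_1=\xi_1+\xi_2$ is symmetric. Then there exist Gaussian distributions $\gamma_1,\gamma_2\in\Gamma(X)$ and a distribution $\omega\in \mathrm{M}^1(K)$ such that $\mu_j=\gamma_j*\omega$, $j=1,2$ (the same $\omega$ for both $j$). Moreover, if $\alpha>0$, then $\mu_j=E_{x_j}*\omega$ with some $x_j\in X$, $j=1,2$.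
   Context: **$\boldsymbol a$-adic solenoid.** Let $\boldsymbol a=(a_0,a_1,\dots)$ with all $a_j\in\mathbb Z$, $a_j>1$. Let $\Delta_{\boldsymbol a}$ be the compact group of $\boldsymbol a$-adic integers (sequences $(x_0,x_1,\dots)$, $x_j\in\{0,\dots,a_j-1\}$, added with carry; equivalently $\varprojlim \mathbb Z/(a_0a_1\cdots a_n)\mathbb Z$), and $\mathbf u=(1,0,0,\dots)\in\Delta_{\boldsymbol a}$. Put $B=\{(n,n\mathbf u): n\in\mathbb Z\}\subset \mathbb R\times\Delta_{\boldsymbol a}$. The $\boldsymbol a$-adic solenoid is $\Sigma_{\boldsymbol a}=(\mathbb R\times\Delta_{\boldsymbol a})/B$; it is a compact connected second countable Abelian group. Its character group $Y$ is isomorphic to the discrete group $H_{\boldsymbol a}=\{\frac{m}{a_0a_1\cdots a_n}: n=0,1,\dots;\ m\in\mathbb Z\}$, and $Y$ is identified with $H_{\boldsymbol a}\subset\mathbb R$. **Automorphisms.** $I$ is the identity automorphism. For an integer $n$, $f_n$ is the endomorphism $x\mapsto nx$. Every topological automorphism $\alpha$ of $X=\Sigma_{\boldsymbol a}$ has the form $\alpha=f_pf_q^{-1}$ with coprime integers $p,q$ such that $f_p,f_q$ are automorphisms of $X$; $\alpha$ is identified with the rational number $p/q$ (its adjoint on $Y=H_{\boldsymbol a}$ is multiplication by $p/q$). Thus $\alpha>0$ means $p/q>0$. **Distributions.** $\mathrm M^1(X)$ is the set of Borel probability measures (distributions) on $X$, $*$ is convolution, and for a Borel subgroup $K$, $\mathrm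 M^1(K)$ is the set of distributions on $X$ concentrated on $K$. The characteristic function of $\mu$ is $\hat\mu(y)=\int_X (x,y)\,d\mu(x)$, $y\in Y$, where $(x,y)$ is the value of the character $y$ at $x$; it does not vanish if $\hat\mu(y)\neq0$ for all $y\in Y$. $E_x$ is the degenerate distribution concentrated at $x$. **Gaussian distributions.** $\gamma\in \mathrm M^1(X)$ is Gaussian if $\hat\gamma(y)=(x,y)\exp\{-\varphi(y)\}$ for some $x\in X$ and some continuous non-negative function $\varphi$ on $Y$ with $\varphi(u+v)+\varphi(u-v)=2[\varphi(u)+\varphi(v)]$ for all $u,v\in Y$. For $X=\Sigma_{\boldsymbol a}$ this means $\hat\gamma(y)=(x,y)\exp\{-\sigma y^2\}$, $y\in H_{\boldsymbol a}$, with $x\in X$, $\sigma\ge0$. Degenerate distributions are Gaussian. $\Gamma(X)$ is the set of Gaussian distributions on $X$. **Symmetry.** The conditional distribution of $L_2$ given $L_1$ is symmetric means that the random vectors $(L_1,L_2)$ and $(L_1,-L_2)$ are identically distributed. *)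

(* Defs.v *)
From HB Require Import structures.
From mathcomp Require Import all_boot all_order all_algebra.
From mathcomp Require Import generic_quotient ring_quotient complex.
From mathcomp Require Import all_classical all_reals all_analysis.

Set Implicit Arguments.
Unset Strict Implicit.
Unset Printing Implicit Defensive.

Import Order.TTheory GRing.Theory Num.Theory.
Import numFieldNormedType.Exports.

Local Open Scope classical_set_scope.
Local Open Scope ring_scope.

(* The argument a_gt1 does not occur in the carrier: it is there so that the
   group structure below is canonically attached to the type. *)
Definition adic (a : nat -> nat) (a_gt1 : forall j, (1 < a j)%N) : Type :=
  prod_topology (fun j => discrete_topology 'I_(a j)).

HB.instance Definition _ (a : nat -> nat) (a_gt1 : forall j, (1 < a j)%N) :=
  Topological.copy (adic a_gt1)
    (prod_topology (fun j => discrete_topology 'I_(a j))).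

Section AdicGroup.
Variables (a : nat -> nat) (a_gt1 : forall j, (1 < a j)%N).
Local Notation D := (adic a_gt1).
Implicit Types x y z : D.

Let a_gt0 j : (0 < a j)%N. Proof. exact: ltnW. Qed.

Definition digit x j : nat := nat_of_ord (x j : 'I_(a j)).

(* adic_carry x y j is the carry entering position j. *)
Fixpoint adic_carry x y (j : nat) : nat :=
  if j is i.+1 then (digit x i + digit y i + adic_carry x y i) %/ a i else 0.

Definition of_digits (s : nat -> nat) : D :=
  fun j => Ordinal (ltn_pmod (s j) (a_gt0 j)).

Definition adic_add x y : D :=
  of_digits (fun j => digit x j + digit y j + adic_carry x y j)%N.

Definition adic_zero : D := of_digits (fun _ => 0%N).

Definition adic_unit : D := of_digits (fun j => nat_of_bool (j == 0%N)).

(* The digitwise complement a_j - 1 - x_j represents -1 - x. *)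
Definition adic_opp x : D :=
  adic_add (of_digits (fun j => (a j).-1 - digit x j)%N) adic_unit.

Definition radix n : nat := (\prod_(i < n) a i)%N.
Definition trunc_val x n : nat := (\sum_(i < n) digit x i * radix i)%N.

Lemma digit_of_digits s j : digit (of_digits s) j = (s j %% a j)%N.
Proof. by []. Qed.

Lemma radixS n : radix n.+1 = (radix n * a n)%N.
Proof. by rewrite /radix big_ord_recr. Qed.

Lemma radix_gt0 n : (0 < radix n)%N.
Proof. by rewrite /radix; elim/big_ind: _ => // p q p0 q0; rewrite muln_gt0 p0. Qed.

Lemma trunc_valS x n : trunc_val x n.+1 = (trunc_val x n + digit x n * radix n)%N.
Proof. by rewrite /trunc_val big_ord_recr. Qed.

Lemma digit_lt x j : (digit x j < a j)%N.
Proof. exact: ltn_ord. Qed.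

Lemma trunc_val_lt x n : (trunc_val x n < radix n)%N.
Proof.
elim: n => [|n IHn]; first by rewrite /trunc_val /radix !big_ord0.
rewrite trunc_valS radixS (@leq_trans (radix n + digit x n * radix n)) //.
  by rewrite ltn_add2r.
by rewrite -mulSn mulnC leq_mul2l digit_lt orbT.
Qed.

Lemma trunc_val_inj x y : trunc_val x =1 trunc_val y -> x = y.
Proof.
move=> exy; apply: functional_extensionality_dep => j; apply: val_inj.
have := exy j.+1; rewrite !trunc_valS exy => /addnI/eqP.
by rewrite eqn_mul2r eqn0Ngt radix_gt0 => /eqP.
Qed.

Lemma trunc_val_carry x y n :
  (trunc_val (adic_add x y) n + adic_carry x y n * radix n
   = trunc_val x n + trunc_val y n)%N.
Proof.
elim: n => [|n IHn]; first by rewrite /trunc_val !big_ord0.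
rewrite !trunc_valS addnACA -IHn radixS digit_of_digits /=.
set c := adic_carry x y n.
rewrite -mulnDl -[RHS]addnA -mulnDl [(c + _)%N]addnC.
rewrite [in RHS](divn_eq (digit x n + digit y n + c) (a n)) mulnDl.
by rewrite -addnA [(radix n * _)%N]mulnC mulnA [(_ %% _ * _ + _)%N]addnC.
Qed.

Lemma trunc_valD x y n :
  trunc_val (adic_add x y) n = ((trunc_val x n + trunc_val y n) %% radix n)%N.
Proof. by rewrite -trunc_val_carry addnC modnMDl modn_small ?trunc_val_lt. Qed.

Lemma trunc_val0 n : trunc_val adic_zero n = 0%N.
Proof. by rewrite /trunc_val big1 // => i _; rewrite digit_of_digits mod0n. Qed.

Lemma trunc_val1 n : trunc_val adic_unit n.+1 = 1%N.
Proof.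
rewrite /trunc_val big_ord_recl big1 => [|i _].
  by rewrite digit_of_digits modn_small // /radix big_ord0.
by rewrite digit_of_digits mod0n.
Qed.

Lemma trunc_val_compl x n :
  (trunc_val (of_digits (fun j => (a j).-1 - digit x j)) n + trunc_val x n
   = (radix n).-1)%N.
Proof.
elim: n => [|n IHn]; first by rewrite /trunc_val /radix !big_ord0.
rewrite !trunc_valS addnACA IHn -mulnDl digit_of_digits modn_small; last first.
  by rewrite (leq_ltn_trans (leq_subr _ _)) // prednK.
rewrite subnK; last by rewrite -ltnS prednK // digit_lt.
apply: succn_inj; rewrite -addSn !prednK ?radix_gt0 // radixS.
by rewrite -mulSn prednK // mulnC.
Qed.

Lemma adic_addA : associative adic_add.
Proof.
move=> x y z; apply: trunc_val_inj => n; rewrite !trunc_valD.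
by rewrite modnDml modnDmr addnA.
Qed.

Lemma adic_addC : commutative adic_add.
Proof. by move=> x y; apply: trunc_val_inj => n; rewrite !trunc_valD addnC. Qed.

Lemma adic_add0 : left_id adic_zero adic_add.
Proof.
move=> x; apply: trunc_val_inj => n.
by rewrite trunc_valD trunc_val0 modn_small ?trunc_val_lt.
Qed.

Lemma adic_addN : left_inverse adic_zero adic_opp adic_add.
Proof.
move=> x; apply: trunc_val_inj => -[|n]; first by rewrite /trunc_val !big_ord0.
rewrite /adic_opp adic_addC adic_addA [adic_add x _]adic_addC.
rewrite trunc_valD trunc_val0 trunc_val1 trunc_valD trunc_val_compl modnDml.
by rewrite addn1 prednK ?radix_gt0 // modnn.
Qed.

HB.instance Definition _ :=
  GRing.isZmodule.Build D adic_addA adic_addC adic_add0 adic_addN.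

End AdicGroup.

Section AdicTopology.
Variables (a : nat -> nat) (a_gt1 : forall j, (1 < a j)%N).
Local Notation D := (adic a_gt1).

Lemma near_digit (x : D) j : \forall y \near x, digit y j = digit x j.
Proof.
have /(_ _ (discrete_set1 (x j : discrete_topology 'I_(a j)))) :=
  @proj_continuous _ (fun j => discrete_topology 'I_(a j)) j x.
move=> xj; apply: (@filterS _ (nbhs x) _ _ _ _ xj) => y /= yj.
by rewrite /digit; congr nat_of_ord.
Qed.

Lemma near_of_digits (T : topologicalType) (f : T -> nat -> nat) (t : T) :
  (forall j, \forall u \near t, f u j = f t j) ->
  (of_digits a_gt1 (f u) : D) @[u --> t] --> (of_digits a_gt1 (f t) : D).
Proof.
move=> near_f; apply/cvg_sup => j A [B [[C oC <-] Cx] sBA].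
apply: filterS (near_f j) => u fuj; apply: sBA => /=.
by move: Cx; rewrite /= /of_digits fuj.
Qed.

Lemma near_carry (x y : D) j :
  \forall u \near (x, y), adic_carry u.1 u.2 j = adic_carry x y j.
Proof.
have near1 i : \forall u \near (x, y), digit u.1 i = digit x i.
  exact: (@cvg_fst _ _ (nbhs x) (nbhs y)) (near_digit x i).
have near2 i : \forall u \near (x, y), digit u.2 i = digit y i.
  exact: (@cvg_snd _ _ (nbhs x) (nbhs y)) (near_digit y i).
elim: j => [|j IHj]; first exact: filterE.
by apply: filterS3 (near1 j) (near2 j) IHj => u /= -> -> ->.
Qed.

Lemma adic_add_continuous : continuous (fun u : D * D => u.1 + u.2).
Proof.
move=> [x y]; rewrite /continuous_at.
apply: (@near_of_digits _
  (fun u : D * D => fun j => (digit u.1 j + digit u.2 j + adic_carry u.1 u.2 j)%N))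
  => j.
have near1 : \forall u \near (x, y), digit u.1 j = digit x j.
  exact: (@cvg_fst _ _ (nbhs x) (nbhs y)) (near_digit x j).
have near2 : \forall u \near (x, y), digit u.2 j = digit y j.
  exact: (@cvg_snd _ _ (nbhs x) (nbhs y)) (near_digit y j).
by apply: filterS3 near1 near2 (near_carry x y j) => u /= -> -> ->.
Qed.

HB.instance Definition _ :=
  PreTopologicalNmodule_isTopologicalNmodule.Build D adic_add_continuous.

Lemma adic_opp_continuous : continuous (-%R : D -> D).
Proof.
move=> x.
apply: (@continuous_comp D (D * D)%type D
  (fun y => (of_digits a_gt1 (fun j => (a j).-1 - digit y j)%N : D,
             adic_unit a_gt1 : D)) (fun u => u.1 + u.2)); last first.
  exact: adic_add_continuous.
apply: (@cvg_pair _ _ _ (nbhs x) (nbhs _) (nbhs _)); last exact: cvg_cst.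
apply: (@near_of_digits _ (fun y : D => fun j => ((a j).-1 - digit y j)%N)) => j.
by apply: filterS (near_digit x j) => y ->.
Qed.

HB.instance Definition _ :=
  TopologicalNmodule_isTopologicalZmodule.Build D adic_opp_continuous.

End AdicTopology.

Section Solenoid.
Variables (R : realType) (a : nat -> nat) (a_gt1 : forall j, (1 < a j)%N).
Local Notation G := (R * adic a_gt1)%type.

(* The subgroup B of the pairs (n, n u), n ranging over the integers. *)
Definition winding : {pred G} :=
  fun p => `[< exists n : int, p = (n%:~R, adic_unit a_gt1 *~ n) >].

Lemma winding_zmod_closed : zmod_closed winding.
Proof.
split; first by apply/asboolP; exists 0; rewrite !mulr0z.
move=> _ _ /asboolP[m ->] /asboolP[n ->]; apply/asboolP; exists (m - n).
by rewrite !mulrzBr.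
Qed.

HB.instance Definition _ :=
  GRing.isZmodClosed.Build G winding winding_zmod_closed.

Lemma cover_sub_continuous : continuous (fun u : G * G => u.1 - u.2).
Proof.
have cR : continuous (fun u : G * G => u.1.1 - u.2.1).
  move=> [[s x] [t y]].
  apply: (@continuous_comp (G * G)%type (R * R)%type R
    (fun u => (u.1.1, u.2.1)) (fun v => v.1 - v.2)); last exact: sub_continuous.
  apply: (@cvg_pair _ _ _ (nbhs ((s, x), (t, y))) (nbhs s) (nbhs t)).
    exact: (cvg_comp _ _ cvg_fst cvg_fst).
  exact: (cvg_comp _ _ cvg_snd cvg_fst).
have cD : continuous (fun u : G * G => u.1.2 - u.2.2).
  move=> [[s x] [t y]].
  apply: (@continuous_comp (G * G)%type (adic a_gt1 * adic a_gt1)%type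
    (adic a_gt1) (fun u => (u.1.2, u.2.2)) (fun v => v.1 - v.2));
    last exact: sub_continuous.
  apply: (@cvg_pair _ _ _ (nbhs ((s, x), (t, y))) (nbhs x) (nbhs y)).
    exact: (cvg_comp _ _ cvg_fst cvg_snd).
  exact: (cvg_comp _ _ cvg_snd cvg_snd).
move=> u.
apply: (@cvg_pair _ _ _ (nbhs u) (nbhs (u.1.1 - u.2.1)) (nbhs (u.1.2 - u.2.2))).
  exact: cR.
exact: cD.
Qed.

Definition solenoid : Type := quotient_topology (Quotient.quot winding).

HB.instance Definition _ := Topological.copy solenoid
  (quotient_topology (Quotient.quot winding)).
HB.instance Definition _ := GRing.isZmodule.Build solenoid
  (@Quotient.addqA G winding) (@Quotient.addqC G winding)
  (@Quotient.add0q G winding) (@Quotient.addNq G winding).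


Definition solenoid_proj (p : G) : solenoid := (\pi_(Quotient.quot winding) p)%qT.

Lemma solenoid_projD : {morph solenoid_proj : p q / p + q}.
Proof. by move=> p q; exact: (@Quotient.pi_add G winding p q). Qed.

Lemma solenoid_projN : {morph solenoid_proj : p / - p}.
Proof. by move=> p; exact: (@Quotient.pi_opp G winding p). Qed.

Lemma solenoid_projB : {morph solenoid_proj : p q / p - q}.
Proof. by move=> p q; rewrite solenoid_projD solenoid_projN. Qed.

Lemma solenoid_proj_eq p q :
  solenoid_proj p = solenoid_proj q <-> p - q \in winding.
Proof.
have E := @Quotient.idealrBE G winding p q.
by split=> [e|]; [rewrite E; apply/eqP | rewrite E => /eqP].
Qed.

Lemma solenoid_proj_surj x : exists p, solenoid_proj p = x.
Proof. by exists (repr (x : Quotient.quot winding)); exact: reprK. Qed.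

Lemma solenoid_proj_nbhs (p : G) (A : set G) :
  nbhs p A -> nbhs (solenoid_proj p) (solenoid_proj @` A).
Proof.
rewrite nbhsE => -[U [oU Up] UA].
have : nbhs (solenoid_proj p) (solenoid_proj @` U).
  apply: open_nbhs_nbhs; split; last by exists p.
  suff : open (solenoid_proj @^-1` (solenoid_proj @` U)) by [].
  rewrite openE => r [q Uq /solenoid_proj_eq qr]; rewrite /interior.
  have cq : continuous (fun z : G => q - (r - z)).
    have cr : continuous (fun z : G => r - z).
      move=> z; apply: (@continuous_comp G (G * G)%type G (fun w => (r, w))
        (fun u => u.1 - u.2)); last exact: cover_sub_continuous.
      by apply: (@cvg_pair _ _ _ (nbhs z) (nbhs r) (nbhs z));
        [exact: cvg_cst | exact: cvg_id].
    move=> z; apply: (@continuous_comp G (G * G)%type G (fun w => (q, r - w))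
      (fun u => u.1 - u.2)); last exact: cover_sub_continuous.
    by apply: (@cvg_pair _ _ _ (nbhs z) (nbhs q) (nbhs (r - z)));
      [exact: cvg_cst | exact: cr].
  have : nbhs r ((fun z : G => q - (r - z)) @^-1` U).
    by apply: cq; rewrite subrr subr0; apply: open_nbhs_nbhs.
  apply: (@filterS _ (nbhs r)) => z Uz; exists (q - (r - z)) => //.
  by apply/solenoid_proj_eq; rewrite opprB addrA (addrAC (q + z)) addrK.
by apply: filterS; exact: image_subset.
Qed.

Lemma solenoid_sub_continuous :
  continuous (fun u : solenoid * solenoid => u.1 - u.2).
Proof.
move=> [x y]; have [p <-] := solenoid_proj_surj x.
have [q <-] := solenoid_proj_surj y => /= A; rewrite -solenoid_projB => nA.
have : nbhs (p - q) (solenoid_proj @^-1` A).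
  exact: (@pi_continuous _ (Quotient.quot winding) (p - q) A nA).
move=> /(cover_sub_continuous (x := (p, q)))[[U V] /= [nU nV] UV].
exists (solenoid_proj @` U, solenoid_proj @` V) => /=.
  by split; exact: solenoid_proj_nbhs.
move=> [_ _] [/= [s Us <-] [t Vt <-]].
by rewrite /= -solenoid_projB; exact: (UV (s, t)).
Qed.

HB.instance Definition _ :=
  PreTopologicalNmodule_isTopologicalZmodule.Build solenoid
    solenoid_sub_continuous.

HB.instance Definition _ := isPointed.Build solenoid 0.

(* Borel sigma-algebra *)
HB.instance Definition _ := Measurable.copy solenoid
  (g_sigma_algebraType (@open solenoid)).

End Solenoid.

Section Characters.
Variables (R : realType) (X : topologicalZmodType).

Record character := Character {
  char_fun :> X -> R[i];
  char_norm : forall x, `|char_fun x| = 1;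
  charD : forall x y, char_fun (x + y) = char_fun x * char_fun y;
  char_continuous : continuous (char_fun : X -> R[i]^o)
}.

HB.instance Definition _ := gen_eqMixin character.
HB.instance Definition _ := gen_choiceMixin character.

Lemma char_ext (u v : character) : u =1 v -> u = v.
Proof.
case: u v => [f nf Df cf] [g ng Dg cg] /= /funext fg; subst g.
by congr Character; exact: Prop_irrelevance.
Qed.

Lemma char_neq0 (u : character) x : u x != 0.
Proof. by rewrite -normr_gt0 char_norm. Qed.

Fact char_zero_norm (x : X) : `|1 : R[i]| = 1. Proof. exact: normr1. Qed.

Fact char_zeroD (x y : X) : (1 : R[i]) = 1 * 1. Proof. by rewrite mulr1. Qed.

Fact char_zero_continuous : continuous ((fun=> 1) : X -> R[i]^o).
Proof. by move=> x; exact: cvg_cst. Qed.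

Definition char_zero : character :=
  Character char_zero_norm char_zeroD char_zero_continuous.

Fact char_opp_norm (u : character) x : `|(u x)^-1| = 1.
Proof. by rewrite normfV char_norm invr1. Qed.

Fact char_oppD (u : character) x y : (u (x + y))^-1 = (u x)^-1 * (u y)^-1.
Proof. by rewrite charD invfM. Qed.

Fact char_opp_continuous (u : character) :
  continuous ((fun x => (u x)^-1) : X -> R[i]^o).
Proof.
by move=> x; apply: cvgV; [exact: char_neq0 | exact: char_continuous].
Qed.

Definition char_opp (u : character) : character :=
  Character (char_opp_norm u) (char_oppD u) (char_opp_continuous (u := u)).

Fact char_add_norm (u v : character) x : `|u x * v x| = 1.
Proof. by rewrite normrM !char_norm mulr1. Qed.

Fact char_addD (u v : character) x y :
  u (x + y) * v (x + y) = u x * v x * (u y * v y).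
Proof. by rewrite !charD mulrACA. Qed.

Fact char_add_continuous (u v : character) :
  continuous ((fun x => u x * v x) : X -> R[i]^o).
Proof. by move=> x; apply: cvgM; exact: char_continuous. Qed.

Definition char_add (u v : character) : character :=
  Character (char_add_norm u v) (char_addD u v)
    (char_add_continuous (u := u) (v := v)).

Lemma char_addA : associative char_add.
Proof. by move=> u v w; apply: char_ext => x; exact: mulrA. Qed.

Lemma char_addC : commutative char_add.
Proof. by move=> u v; apply: char_ext => x; exact: mulrC. Qed.

Lemma char_add0 : left_id char_zero char_add.
Proof. by move=> u; apply: char_ext => x; exact: mul1r. Qed.

Lemma char_addN : left_inverse char_zero char_opp char_add.
Proof.
move=> u; apply: char_ext => x; apply: mulVf.
by rewrite -normr_gt0 char_norm.
Qed.

HB.instance Definition _ :=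
  GRing.isZmodule.Build character char_addA char_addC char_add0 char_addN.

(* The dual of a locally compact group carries the compact-open topology; it is
   discrete when X is compact. *)
HB.instance Definition _ := Topological.copy character
  (initial_topology (char_fun : character -> {compact-open, X -> R[i]^o})).

End Characters.

Definition topological_automorphism (X : topologicalZmodType) (f : X -> X) :=
  zmod_morphism f /\
  exists g : X -> X, [/\ cancel f g, cancel g f, continuous f & continuous g].

Definition mulz_endo (X : zmodType) (n : int) (x : X) : X := x *~ n.

(* f = f_p f_q^-1 with p and q coprime, i.e. f is identified with p / q; the pair
   (p, q) is unique up to sign when X is a solenoid. *)
Definition automorphism_ratio (X : topologicalZmodType) (f : X -> X) (p q : int) :=
  [/\ coprimez p q,
      topological_automorphism (@mulz_endo X p),
      topological_automorphism (@mulz_endo X q) &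
      f \o @mulz_endo X q =1 @mulz_endo X p].

Definition automorphism_gt0 (X : topologicalZmodType) (f : X -> X) :=
  exists p q : int, automorphism_ratio f p q /\ (0 : rat) < p%:~R / q%:~R.

Section RandomVariables.
Context {d d' d'' : measure_display} {Om : measurableType d}.
Context {S : measurableType d'} {T : measurableType d''} {R : realType}.
Variable P : probability Om R.

Definition independent_RV (xi : Om -> S) (eta : Om -> T) : Prop :=
  forall A B, measurable A -> measurable B ->
    P (xi @^-1` A `&` eta @^-1` B) = (P (xi @^-1` A) * P (eta @^-1` B))%E.

Definition identically_distributed (Z W : Om -> T) : Prop :=
  forall C, measurable C -> pushforward P Z C = pushforward P W C.

End RandomVariables.

Section Distributions.
Variables (R : realType) (a : nat -> nat) (a_gt1 : forall j, (1 < a j)%N).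
Local Notation X := (solenoid R a_gt1).

Definition char_function (mu : probability X R) (y : character R X) : R[i] :=
  (Rintegral mu setT (fun x => complex.Re (y x)) +i*
   Rintegral mu setT (fun x => complex.Im (y x)))%C.

Definition gaussian (mu : probability X R) : Prop :=
  exists (x : X) (phi : character R X -> R),
    [/\ continuous phi,
        forall y, 0 <= phi y,
        forall u v, phi (u + v) + phi (u - v) = 2 * (phi u + phi v) &
        forall y, char_function mu y = y x * (expR (- phi y))%:C%C].

Definition convolution (mu nu : probability X R) : set X -> \bar R :=
  pushforward (mu \x nu)%E (fun p : X * X => p.1 + p.2).

(* The product sigma-algebra on X * X is the Borel one, X being second
   countable. *)
Definition symmetric_conditional d (Om : measurableType d)
    (P : probability Om R) (L1 L2 : Om -> X) : Prop :=
  identically_distributed P (fun w => (L1 w, L2 w)) (fun w => (L1 w, - L2 w)).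

End Distributions.

(* Main.v *)
(* Write Y for the dual group, identified with a group of rationals by restricting
   a character to the one-parameter subgroup of X, and al for the adjoint of alpha.
   The symmetry of L2 given L1 says that the characteristic functions f, g satisfy
   f (u + v) g (u + al v) = f (u - v) g (u - al v).  As X has no element of order 2,
   Y is divisible by 2, and eliminating g shows that the mixed difference of log f
   in the directions (id + al) k and (id - al) m is biadditive; it is bilinear
   because Y has rank one.  Removing from f and g Gaussian factors
   exp (- s_j y^2) with s1 + al s2 = 0 therefore leaves functions which, up to
   characters of Y, equal one common function l that is invariant under the range
   L of id + al.  Each such character is evaluation at a point of X by duality
   (compactness of X).

   It remains to see that l is a characteristic function.  If s2 = 0, it is that of
   a translate of mu2.  Otherwise al <> -1, so Y / L is finite cyclic; every coset
   of L contains elements close to 0 in the reals, where the Gaussian factor is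
   almost 1, so l is positive definite on Y / L and finite Fourier inversion yields
   omega.  Since l = 1 on L, omega is concentrated on Ker (I + alpha).  If al > 0,
   the relation s1 + al s2 = 0 forces s1 = s2 = 0. *)
Require Import Defs.
From HB Require Import structures.
From mathcomp Require Import all_boot all_order all_algebra.
From mathcomp Require Import generic_quotient ring_quotient complex.
From mathcomp Require Import all_classical all_reals all_analysis.
From mathcomp Require Import measurable_realfun.
From mathcomp Require Import ring lra zify.

Set Implicit Arguments.
Unset Strict Implicit.
Unset Printing Implicit Defensive.

Import Order.TTheory GRing.Theory Num.Theory.
Import numFieldNormedType.Exports.

Local Open Scope classical_set_scope.
Local Open Scope ring_scope.

(** * The Heyde functional equation *)

(** Continuity carries no information on the discrete group [Y], yet the decisive steps are limit
    arguments. Divisibility by 2 replaces it: with p = id + al and q = id - al it gives y = p z + q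
    z, and it makes the range of any nonzero endomorphism accumulate at 0 in the reals, so each of
    its cosets has members where a Gaussian factor is as close to 1 as desired. On the range of p q,
    contained in those of p and q, the moduli |f| and |g| are exactly Gaussian when al is not 1 or
    -1. This yields s1, s2 >= 0 from |f|, |g| <= 1, and s1 + al s2 = 0 from one instance of the
    equation. Krein's inequality |f (u + h) - f u f h|^2 <= 1 - |f h|^2 at small h then upgrades
    unitarity of the twisted g on the range of p to multiplicativity. All identities stay
    multiplicative: the only logarithm is that of the mixed difference, once it is known to be
    positive. The exponents come from a division by 1 - al^2, so al = 1 and al = -1 are solved
    apart. The resulting factorizations are identities of characteristic functions; they pass to
    measures by a uniqueness theorem, proved on sets cut out by finitely many half-plane conditions
    on characters. *)

Section ComplexFacts.
Variable R : realType.
Implicit Types z w : R[i].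

Definition cexpR (x : R) : R[i] := (expR x)%:C%C.

Lemma cexpRD (x y : R) : cexpR (x + y) = cexpR x * cexpR y.
Proof. by rewrite /cexpR expRD rmorphM. Qed.

Lemma cexpR0 : cexpR 0 = 1.
Proof. by rewrite /cexpR expR0. Qed.

Lemma cexpR_gt0 x : 0 < cexpR x.
Proof. by rewrite /cexpR ltcR expR_gt0. Qed.

Lemma cexpR_neq0 x : cexpR x != 0.
Proof. by rewrite gt_eqF // cexpR_gt0. Qed.

Lemma norm_cexpR x : `|cexpR x| = cexpR x.
Proof. by rewrite gtr0_norm // cexpR_gt0. Qed.

Lemma conj_cexpR x : (cexpR x)^* = cexpR x.
Proof. by apply: CrealP; rewrite gtr0_real // cexpR_gt0. Qed.

Lemma cexpR_le1 x : (cexpR x <= 1) = (x <= 0).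
Proof. by rewrite -cexpR0 /cexpR lecR ler_expR. Qed.

Lemma cexpR_inj : injective cexpR.
Proof. by move=> x y /complexI/expR_inj. Qed.

End ComplexFacts.

Section HeydeCube.
Variables (R : realType) (Y : zmodType) (r : {additive Y -> rat}).
Hypothesis r_inj : injective r.
Variables (al : {additive Y -> Y}) (a0 : rat).
Hypothesis r_al : forall y, r (al y) = a0 * r y.
Hypothesis half : forall y : Y, exists z, y = z + z.
Local Notation C := R[i].
Local Notation p y := (y + al y).
Local Notation q y := (y - al y).
Local Notation rr y := (ratr (r y) : R).
Implicit Types (f g : Y -> C) (u v y : Y).

Ltac yring := apply: r_inj; rewrite ?(raddfD, raddfB, raddfN, r_al, raddf0) /=; ring.

Lemma pq_decomp y : exists k m, y = p k + q m.
Proof. by have [z ->] := half y; exists z, z; yring. Qed.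

(** In a group of rank one any two elements are commensurable: cross-multiplying the fractions [r u]
    and [r v] gives integers with [u *~ a = v *~ b], and [phi] respects this relation. It is what
    turns additivity into linearity. *)
Lemma additive_proportional (phi : {additive Y -> R}) u v : rr u * phi v = rr v * phi u.
Proof.
pose a := numq (r v) * denq (r u); pose b := numq (r u) * denq (r v).
have e : u *~ a = v *~ b.
  apply: r_inj; rewrite !raddfMz /= -[LHS]mulrzl -[RHS]mulrzl /a /b !intrM.
  by rewrite !numqE; ring.
have := congr1 phi e.
rewrite !raddfMz /= -[LHS]mulrzl -[RHS]mulrzl /a /b !intrM => E.
rewrite /ratr /=.
have d1 : (denq (r u))%:~R != 0 :> R by rewrite intr_eq0 denq_eq0.
have d2 : (denq (r v))%:~R != 0 :> R by rewrite intr_eq0 denq_eq0.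
apply: (mulfI d1); apply: (mulfI d2).
rewrite -[LHS]/(_ * (_ * (_ / _ * _))) -[RHS]/(_ * (_ * (_ / _ * _))).
transitivity ((numq (r u))%:~R * (denq (r v))%:~R * phi v); first by field.
by rewrite -E; field.
Qed.

Definition heyde f g :=
  forall u v, f (u + v) * g (u + al v) = f (u - v) * g (u - al v).

(* The equation writes f at a vertex of the cube as a product of three factors,
   each independent of one of the three directions, so the alternating product
   of f over the vertices is 1. *)
Lemma heyde_cube f g : (forall y, g y != 0) -> heyde f g -> forall s h k m,
  f s * f (s + p k + h) * f (s + p k + q m) * f (s + h + q m) =
  f (s + p k + h + q m) * f (s + p k) * f (s + h) * f (s + q m).
Proof.
move=> g0 E s h k m; have [l ->] := half h.
have fE u v : f (u + v) = f (u - v) * g (u - al v) / g (u + al v).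
  by rewrite -E mulfK.
(* [U + V] is the vertex of the cube, while [U - V] is free of [b], [U - al V] is free of [a] and
   [U + al V] is free of [c]. Splitting [h] as [l + l] is what removes [l] from [U - V]. *)
pose U (a b c : bool) := s + al k *+ a + l *+ b - al m *+ c.
pose V (a b c : bool) := k *+ a + l *+ b + m *+ c.
have F (a b c : bool) : f (s + p k *+ a + (l + l) *+ b + q m *+ c) =
  f (s - q k *+ a - p m *+ c) * g (s + q l *+ b - (al m + al m) *+ c) /
  g (s + (al k + al k) *+ a + p l *+ b).
  transitivity (f (U a b c + V a b c)); first by congr f; rewrite /U /V; case: a; case: b; case: c; rewrite /= ?(mulr1n, mulr0n, addr0, subr0, raddf0); yring.
  rewrite fE; congr (f _ * g _ / g _);
    rewrite /U /V; case: a; case: b; case: c; rewrite /= ?(mulr1n, mulr0n, addr0, subr0, raddf0) ?raddf0; yring.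
have := F true true true; have := F true true false; have := F true false true.
have := F false true true; have := F true false false.
have := F false true false; have := F false false true.
have := F false false false.
rewrite /= ?(mulr1n, mulr0n, addr0, subr0) => -> -> -> -> -> -> -> ->.
by field; rewrite !g0.
Qed.

End HeydeCube.

Section MixedDifference.
Variables (R : realType) (Y : zmodType) (r : {additive Y -> rat}).
Hypothesis r_inj : injective r.
Variables (al : {additive Y -> Y}) (a0 : rat).
Hypothesis r_al : forall y, r (al y) = a0 * r y.
Hypothesis half : forall y : Y, exists z, y = z + z.
Local Notation C := R[i].
Local Notation p y := (y + al y).
Local Notation q y := (y - al y).
Local Notation rr y := (ratr (r y) : R).
Implicit Types (f g : Y -> C) (u v y : Y).
Ltac yring := apply: r_inj; rewrite ?(raddfD, raddfB, raddfN, r_al, raddf0) /=; ring.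

(* The last clause is Krein's inequality for positive definite functions. *)
Definition char_like f := [/\ f 0 = 1, forall y, f (- y) = (f y)^*,
  forall y, f y != 0 &
  forall u h, `|f (u + h) - f u * f h| ^+ 2 <= 1 - `|f h| ^+ 2].

Lemma char_like_le1 f : char_like f -> forall y, `|f y| <= 1.
Proof.
move=> [_ _ _ K] y; have := K 0 y; move/(le_trans (exprn_ge0 _ (normr_ge0 _))).
by rewrite subr_ge0 expr_le1.
Qed.

(** [B k m] is the multiplicative mixed difference at 0; the cube identity makes it the same at
    every [u], and the base points [p k'] and [q m'] give additivity in each variable. It is real
    because [B (- k) (- m)] is both its conjugate and itself, and positive because halving [k] makes
    it the square of a nonzero real. Only then is its logarithm taken. *)
Lemma mixed_difference f g : char_like f -> (forall y, g y != 0) ->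
  heyde al f g -> exists kappa : R, forall u k m,
  f (u + p k + q m) * f u =
  f (u + p k) * f (u + q m) * cexpR (kappa * rr k * rr m).
Proof.
move=> [f0 fN fn0 _] g0 E; have cb := heyde_cube r_inj r_al half g0 E.
pose B k m := f (p k + q m) / (f (p k) * f (q m)).
have BE u k m : f (u + p k + q m) * f u = f (u + p k) * f (u + q m) * B k m.
  have := cb 0 u k m; rewrite !add0r f0 mul1r [p k + u]addrC => e.
  rewrite /B mulrA; apply: (canRL (mulfK _)); first by rewrite mulf_neq0 ?fn0.
  transitivity (f (u + p k + q m) * f (p k) * f u * f (q m)); first by ring.
  by rewrite -e; ring.
have BDl k k' m : B (k + k') m = B k m * B k' m.
  have := BE (p k') k m.
  have -> : p k' + p k = p (k + k') by yring.
  rewrite {2}/B => e; apply: (mulfI (fn0 (p (k + k')))).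
  apply: (mulIf (fn0 (q m))); apply: (mulIf (fn0 (p k'))).
  transitivity (f (p (k + k') + q m) * f (p k')).
    by rewrite /B; field; rewrite !fn0.
  by rewrite e /B; field; rewrite !fn0.
have BDr k m m' : B k (m + m') = B k m * B k m'.
  have := BE (q m') k m.
  have -> : q m' + p k + q m = p k + q (m + m') by yring.
  have -> : q m' + q m = q (m + m') by yring.
  have -> : q m' + p k = p k + q m' by yring.
  move=> e; apply: (mulfI (fn0 (q (m + m')))).
  apply: (mulIf (fn0 (q m'))); apply: (mulIf (fn0 (p k))).
  transitivity (f (p k + q (m + m')) * f (q m')).
    by rewrite /B; field; rewrite !fn0.
  by rewrite e /B; field; rewrite !fn0.
have Bn0 k m : B k m != 0 by rewrite mulf_neq0 ?invr_eq0 ?mulf_neq0 ?fn0.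
have B0l m : B 0 m = 1.
  by rewrite /B raddf0 addr0 add0r f0 mul1r divff ?fn0.
have B0r k : B k 0 = 1.
  by rewrite /B raddf0 subr0 addr0 f0 mulr1 divff ?fn0.
have BN k m : B (- k) (- m) = B k m.
  have e1 : B (- k) (- m) * B k (- m) = 1 by rewrite -BDl addNr B0l.
  have e2 : B k (- m) * B k m = 1 by rewrite -BDr addNr B0r.
  by apply: (mulIf (Bn0 k (- m))); rewrite e1 mulrC e2.
have BC k m : (B k m)^* = B k m.
  rewrite -[RHS]BN /B.
  have -> : p (- k) + q (- m) = - (p k + q m) by yring.
  have -> : p (- k) = - p k by yring.
  have -> : q (- m) = - q m by yring.
  by rewrite !fN fmorph_div rmorphM.
have B_gt0 k m : 0 < B k m.
  have [z ->] := half k; rewrite BDl -expr2 real_exprn_even_gt0 ?Bn0 ?orbT //; exact/CrealP.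
pose b k m := ln (complex.Re (B k m)).
have Bb k m : B k m = cexpR (b k m).
  have := B_gt0 k m; rewrite ltcE => /andP[/eqP /= Im0 Re0].
  by rewrite /cexpR /b lnK ?posrE //; case: (B k m) Im0 => x y /= ->.
have bDl k k' m : b (k + k') m = b k m + b k' m.
  by apply: cexpR_inj; rewrite cexpRD -!Bb BDl.
have bDr k m m' : b k (m + m') = b k m + b k m'.
  by apply: cexpR_inj; rewrite cexpRD -!Bb BDr.
suff [kappa bE] : exists kappa, forall k m, b k m = kappa * rr k * rr m.
  by exists kappa => u k m; rewrite BE Bb bE.
(* If [r] vanishes identically, injectivity makes [Y] trivial and [kappa] may be 0. *)
have [[y0 y00]|Y0] := pselect (exists y0, r y0 != 0); last first.
  exists 0 => k m; rewrite !mul0r.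
  have -> : k = 0.
    apply: r_inj; rewrite raddf0; apply/eqP/negPn/negP => kn0.
    by apply: Y0; exists k.
  by apply: (addrI (b 0 m)); rewrite -bDl !addr0.
have zml m : zmod_morphism (b ^~ m).
  move=> x y; apply: (addIr (b y m)).
  by rewrite -bDl !subrK.
have zmr k : zmod_morphism (b k).
  move=> x y; apply: (addIr (b k y)).
  by rewrite -bDr !subrK.
pose bl m : {additive Y -> R} := HB.pack (b ^~ m) (GRing.isZmodMorphism.Build _ _ _ (zml m)).
pose br k : {additive Y -> R} := HB.pack (b k) (GRing.isZmodMorphism.Build _ _ _ (zmr k)).
have r0n0 : rr y0 != 0 by rewrite fmorph_eq0.
exists (b y0 y0 / rr y0 ^+ 2) => k m.
have e1 : rr k * b y0 m = rr y0 * b k m := additive_proportional r_inj (bl m) k y0.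
have e2 : rr m * b y0 y0 = rr y0 * b y0 m := additive_proportional r_inj (br y0) m y0.
apply: (mulfI r0n0); apply: (mulfI r0n0); rewrite -e1 mulrCA -e2.
by field.
Qed.

End MixedDifference.

Section GaussTwist.
Variables (R : realType) (Y : zmodType) (r : {additive Y -> rat}).
Hypothesis r_inj : injective r.
Hypothesis half : forall y : Y, exists z, y = z + z.
Local Notation C := R[i].
Local Notation rr y := (ratr (r y) : R).
Implicit Types (f g : Y -> C) (u v y : Y).

Lemma ratr_additiveD x y : rr (x + y) = rr x + rr y.
Proof. by rewrite raddfD rmorphD. Qed.

Lemma ratr_additiveN y : rr (- y) = - rr y.
Proof. by rewrite raddfN rmorphN. Qed.

Lemma ratr_additiveB x y : rr (x - y) = rr x - rr y.
Proof. by rewrite ratr_additiveD ratr_additiveN. Qed.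

(** Division by the Gaussian factor exp (- s y^2); [s] has the sign convention of the factor that is
    removed. *)
Definition gauss_twist (s : R) f y := f y * cexpR (s * rr y ^+ 2).

Lemma gauss_twist_neq0 s f : (forall y, f y != 0) ->
  forall y, gauss_twist s f y != 0.
Proof. by move=> f0 y; rewrite mulf_neq0 ?f0 ?cexpR_neq0. Qed.

Lemma gauss_twist0 s f : f 0 = 1 -> gauss_twist s f 0 = 1.
Proof.
move=> f0; rewrite /gauss_twist f0 raddf0 rmorph0 expr0n /= mulr0.
by rewrite cexpR0 mulr1.
Qed.

Lemma gauss_twistN s f : (forall y, f (- y) = (f y)^*) ->
  forall y, gauss_twist s f (- y) = (gauss_twist s f y)^*.
Proof.
move=> fN y; rewrite /gauss_twist fN rmorphM /= conj_cexpR.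
by rewrite raddfN rmorphN sqrrN.
Qed.

Lemma norm_gauss_twist s f y :
  `|gauss_twist s f y| = `|f y| * cexpR (s * rr y ^+ 2).
Proof. by rewrite normrM norm_cexpR. Qed.

Lemma gauss_twist_id f : gauss_twist 0 f =1 f.
Proof. by move=> y; rewrite /gauss_twist mul0r cexpR0 mulr1. Qed.

Section Laws.
Variables (al : {additive Y -> Y}) (a0 : rat).
Hypothesis r_al : forall y, r (al y) = a0 * r y.
Local Notation p y := (y + al y).
Local Notation q y := (y - al y).
Ltac yring := apply: r_inj; rewrite ?(raddfD, raddfB, raddfN, r_al, raddf0) /=; ring.
Local Notation a := (ratr a0 : R).

Lemma ratr_additive_al y : rr (al y) = a * rr y.
Proof. by rewrite r_al rmorphM. Qed.

(** The mixed difference of s y^2 in the directions [p k] and [q m] is 2 s (1 - a^2) k m, which the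
    condition on [s] makes opposite to the exponent with [kappa]. *)
Lemma gauss_twist_law (kappa s : R) f :
  (forall u k m, f (u + p k + q m) * f u =
    f (u + p k) * f (u + q m) * cexpR (kappa * rr k * rr m)) ->
  kappa + s * (1 - a ^+ 2) *+ 2 = 0 ->
  forall u k m, gauss_twist s f (u + p k + q m) * gauss_twist s f u =
    gauss_twist s f (u + p k) * gauss_twist s f (u + q m).
Proof.
move=> law ks u k m; rewrite /gauss_twist mulrACA law -cexpRD.
rewrite -[LHS]mulrA -cexpRD [RHS]mulrACA -cexpRD; congr (_ * cexpR _).
rewrite !(ratr_additiveD, ratr_additiveN, ratr_additive_al); set U := rr u; set K := rr k; set M := rr m.
apply: (addIr (- (K * M) * (kappa + s * (1 - a ^+ 2) *+ 2))).
by rewrite {2}ks; ring.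
Qed.

Variable f1 : Y -> C.
Hypothesis f10 : f1 0 = 1.
Hypothesis f1N : forall y, f1 (- y) = (f1 y)^*.
Hypothesis law : forall u k m,
  f1 (u + p k + q m) * f1 u = f1 (u + p k) * f1 (u + q m).

Lemma product_law_split k m : f1 (p k + q m) = f1 (p k) * f1 (q m).
Proof. by have := law 0 k m; rewrite !add0r f10 mulr1. Qed.

(** Since [p (q z) = q (p z)], such an element lies in both ranges: with y = p k + q m it is first
    absorbed into the [p] summand, then split off from it as a [q] summand. *)
Lemma product_law_core y z : f1 (y + p (q z)) = f1 y * f1 (p (q z)).
Proof.
have [k [m ->]] := pq_decomp r_inj r_al half y.
have -> : p k + q m + p (q z) = p (k + q z) + q m by yring.
rewrite product_law_split.
have -> : p (k + q z) = p k + q (p z) by yring.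
have -> : p (q z) = q (p z) by yring.
by rewrite !product_law_split mulrAC.
Qed.

(** The squared modulus is f1 (c) f1 (- c), which the product law on the core evaluates to f1
    (0). *)
Lemma norm_product_law_core z : `|f1 (p (q z))| = 1.
Proof.
apply/eqP; rewrite -(@pexpr_eq1 _ _ 2) ?normr_ge0 // normCK -f1N.
rewrite mulrC -product_law_core addNr f10 //.
Qed.

Lemma norm_product_law_coreD y z : `|f1 (y + p (q z))| = `|f1 y|.
Proof. by rewrite product_law_core normrM norm_product_law_core mulr1. Qed.

End Laws.

End GaussTwist.

Section DenseImage.
Variables (R : realType) (Y : zmodType) (r : {additive Y -> rat}).
Hypothesis r_inj : injective r.
Hypothesis half : forall y : Y, exists z, y = z + z.
Local Notation C := R[i].
Local Notation rr y := (ratr (r y) : R).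
Implicit Types (f g : Y -> C) (u v y : Y).
Variables (al : {additive Y -> Y}) (a0 : rat).
Hypothesis r_al : forall y, r (al y) = a0 * r y.
Local Notation p y := (y + al y).
Local Notation q y := (y - al y).
Ltac yring := apply: r_inj; rewrite ?(raddfD, raddfB, raddfN, r_al, raddf0) /=; ring.
Local Notation a := (ratr a0 : R).
Local Notation gauss_twist := (gauss_twist r).

Lemma half_iter (y : Y) n : exists z, y = z *+ 2 ^ n.
Proof.
elim: n => [|n [z zE]]; first by exists y.
have [w wE] := half z; exists w.
by rewrite expnS mulrnA zE wE mulr2n.
Qed.

(* The elements T h / 2^n, which exist by divisibility by 2, have arbitrarily
   small image in the reals. *)
Lemma dense_image (T : {additive Y -> Y}) (h : Y) (e : R) :
  r (T h) != 0 -> 0 < e -> forall y, exists x, `|rr (y + T x)| < e.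
Proof.
move=> h0 e0 y.
pose n := Num.truncn (`|rr (T h)| / e).
have hn : `|rr (T h)| / e < (2 ^ n)%:R.
  apply: lt_le_trans (_ : n.+1%:R <= _).
    by have /andP[] := truncn_itv (divr_ge0 (normr_ge0 (rr (T h))) (ltW e0)).
  by rewrite ler_nat ltn_expl.
have [z zE] := half_iter h n.
have rz : rr (T h) = rr (T z) *+ 2 ^ n.
  by rewrite {1}zE !raddfMn.
have z0 : rr (T z) != 0.
  apply: contraNneq h0 => z0; have /eqP : rr (T h) = 0 by rewrite rz z0 mul0rn.
  by rewrite fmorph_eq0.
have ze : `|rr (T z)| < e.
  by move: hn; rewrite ltr_pdivrMr // rz normrMn -[X in X < _]mulr_natl ltr_pM2l.
(* The multiples of [T z] form a grid of mesh below [e]; subtracting the right one leaves a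
   remainder smaller than the mesh. *)
exists (z *~ (- Num.floor (rr y / rr (T z)))).
set j := Num.floor (rr y / rr (T z)).
have e1 : rr (T (z *~ - j)) = rr (T z) *~ - j by rewrite !raddfMz.
have -> : rr (y + T (z *~ - j)) = (rr y / rr (T z) - j%:~R) * rr (T z).
  by rewrite ratr_additiveD e1 [RHS]mulrBl divfK // mulrzl mulrNz.
rewrite normrM; apply: le_lt_trans ze; rewrite ler_piMl //.
have /andP[f1 f2] := floor_itv (rr y / rr (T z)).
rewrite ger0_norm ?subr_ge0 // lerBlDl; apply: ltW.
by rewrite intrD in f2.
Qed.

End DenseImage.

Section SmallLimits.
Variable R : realType.

Lemma continuous_limit_le0 (H : R -> R) : {for 0, continuous H} ->
  (forall e, 0 < e -> exists2 t, `|t| < e & H t <= 0) -> H 0 <= 0.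
Proof.
move=> Hc Hs; rewrite leNgt; apply/negP => H0.
have : \forall t \near 0, 0 < H t.
  exact: (Hc (fun x => 0 < x) (lt_nbhsr H0)).
move=> /nbhs_ballP[e /= e0 He].
have [t te] := Hs e e0; rewrite leNgt => /negP; apply; apply: He.
by rewrite /ball /= sub0r normrN.
Qed.

Lemma continuous_expR_sqr (s b : R) : continuous (fun t => expR (s * (b + t) ^+ 2)).
Proof.
move=> t; apply: continuous_comp; last exact: continuous_expR.
apply: continuousM; first exact: cst_continuous.
apply: (continuous_comp (f := fun t => b + t) (g := fun x => x ^+ 2)).
  by apply: continuousD; [exact: cst_continuous | exact: cvg_id].
exact: exprn_continuous.
Qed.

Lemma le1_of_small_gauss (z : R[i]) (s : R) :
  (forall e, 0 < e -> exists2 t, `|t| < e & `|z| <= cexpR (s * t ^+ 2)) ->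
  `|z| <= 1.
Proof.
move=> hz; have [x zx] : exists x : R, `|z| = x%:C%C.
  by exists (Normc.normc z).
suff : x - expR (s * (0 + 0) ^+ 2) <= 0.
  by rewrite addr0 expr0n /= mulr0 expR0 subr_le0 zx -lecR.
apply: (@continuous_limit_le0 (fun t => x - expR (s * (0 + t) ^+ 2))).
  by apply: continuousB; [exact: cst_continuous | exact: continuous_expR_sqr].
move=> e /hz[t te]; rewrite zx lecR => xt; exists t => //.
by rewrite add0r subr_le0.
Qed.

(** Limit form of Krein's inequality for a twisted function: exp (s t^2)^-2 stands for |g h|^2 when
    the twist of g is unitary at an h of real value t, so the right-hand side vanishes as t tends to
    0, and the correction [cexpR (c * t)] tends to 1. [H] rewrites the squared modulus through real
    and imaginary parts. *)
Lemma eq_of_small_gauss (A B : R[i]) (s b c : R) :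
  (forall e, 0 < e -> exists2 t, `|t| < e &
     `|A - B * cexpR (c * t)| ^+ 2 <=
     cexpR (s * (b + t) ^+ 2) ^+ 2 * (1 - cexpR (s * t ^+ 2) ^- 2)) ->
  A = B.
Proof.
move=> hAB.
pose H t := (complex.Re A - complex.Re B * expR (c * t)) ^+ 2 +
  (complex.Im A - complex.Im B * expR (c * t)) ^+ 2 -
  expR (s * (b + t) ^+ 2) ^+ 2 * (1 - expR (s * (0 + t) ^+ 2) ^- 2).
have cE : continuous (fun t => expR (c * t)).
  move=> t; apply: continuous_comp; last exact: continuous_expR.
  by apply: continuousM; [exact: cst_continuous | exact: cvg_id].
have c2 (f : R -> R) : continuous f -> continuous (fun t => f t ^+ 2).
  by move=> cf t; apply: (continuous_comp (f := f) (g := fun x => x ^+ 2)); [exact: cf | exact: exprn_continuous].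
have cL (x y : R) : continuous (fun t => (x - y * expR (c * t)) ^+ 2).
  apply: (c2 (fun t => x - y * expR (c * t))) => t.
  apply: (@cvgB _ R); first exact: cvg_cst.
  by apply: cvgM; [exact: cvg_cst | exact: cE].
have cH : continuous H.
  move=> t; apply: (@cvgB _ R); first by apply: (@cvgD _ R); exact: cL.
  apply: cvgM; first by apply: (c2 (fun t => expR (s * (b + t) ^+ 2))); exact: continuous_expR_sqr.
  apply: (@cvgB _ R); first exact: cvg_cst.
  apply: cvgV; first by rewrite gt_eqF // exprn_gt0 // expR_gt0.
  by apply: (c2 (fun t => expR (s * (0 + t) ^+ 2))); exact: continuous_expR_sqr.
have : H 0 <= 0.
  apply: continuous_limit_le0; first exact: cH.
  move=> e /hAB[t te h]; exists t => //; rewrite /H subr_le0 -lecR add0r.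
  apply: le_trans (le_trans h _).
    rewrite -add_Re2_Im2 lecR le_eqVlt; apply/orP; left; apply/eqP.
    case: (A) => x y; case: (B) => x' y' /=.
    by rewrite !mulr0 subr0 add0r.
  by rewrite /cexpR -!rmorphXn -fmorphV -rmorphB -rmorphM lexx.
rewrite /H !addr0 !expr0n /= !mulr0 expR0 !mulr1 expr1n invr1 subrr mulr0 subr0.
move=> h0; apply/eqP; rewrite eq_complex.
have : (complex.Re A - complex.Re B) ^+ 2 + (complex.Im A - complex.Im B) ^+ 2 == 0.
  by rewrite eq_le h0 addr_ge0 // sqr_ge0.
by rewrite paddr_eq0 ?sqr_ge0 // !sqrf_eq0 !subr_eq0.
Qed.

End SmallLimits.

Section HeydeSolution.
Variables (R : realType) (Y : zmodType) (r : {additive Y -> rat}).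
Hypothesis r_inj : injective r.
Hypothesis half : forall y : Y, exists z, y = z + z.
Local Notation C := R[i].
Local Notation rr y := (ratr (r y) : R).
Implicit Types (f g : Y -> C) (u v y : Y).
Variables (al be : {additive Y -> Y}) (a0 : rat).
Hypothesis r_al : forall y, r (al y) = a0 * r y.
Hypothesis alK : cancel be al.
Variable y0 : Y.
Hypothesis ry0 : r y0 != 0.
Local Notation p y := (y + al y).
Local Notation q y := (y - al y).
Ltac yring := apply: r_inj; rewrite ?(raddfD, raddfB, raddfN, r_al, raddf0) /=; ring.
Local Notation a := (ratr a0 : R).
Local Notation gauss_twist := (gauss_twist r).
Variables f g : Y -> C.
Hypotheses (fc : char_like f) (gc : char_like g) (fg : heyde al f g).

(* After the Gaussian factors exp (- s1 y^2), exp (- s2 y^2) are divided out, g is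
   a unitary character on the range of id + al and quasi-periodic with respect
   to it, and f is determined by g. *)
Definition heyde_solution s1 s2 := [/\ 0 <= s1, 0 <= s2, s1 + a * s2 = 0 &
  [/\ forall k, `|gauss_twist s2 g (p k)| = 1,
      forall y k, gauss_twist s2 g (y + p k) =
                  gauss_twist s2 g y * gauss_twist s2 g (p k) &
      forall y, gauss_twist s1 f y =
                gauss_twist s2 g y * gauss_twist s2 g (- p y)]].

Let f0 : f 0 = 1. Proof. by case: fc. Qed.
Let fN y : f (- y) = (f y)^*. Proof. by case: fc => _ /(_ y). Qed.
Let fn0 y : f y != 0. Proof. by case: fc => _ _ /(_ y). Qed.
Let g0 : g 0 = 1. Proof. by case: gc. Qed.
Let gN y : g (- y) = (g y)^*. Proof. by case: gc => _ /(_ y). Qed.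
Let gn0 y : g y != 0. Proof. by case: gc => _ _ /(_ y). Qed.

(** With al = id, taking u = v gives f g = 1. Both moduli are at most 1, hence equal to 1, and
    Krein's inequality with |g h| = 1 makes g a character. *)
Lemma heyde_solution_one : a0 = 1 -> heyde_solution 0 0.
Proof.
move=> a1; have alE y : al y = y by apply: r_inj; rewrite r_al a1 mul1r.
have fg1 y : f y * g y = 1.
  have [z ->] := half y.
  by have := fg z z; rewrite alE subrr f0 g0 mulr1.
have g1 y : `|g y| = 1.
  apply/eqP; rewrite eq_le char_like_le1 //=.
  have := congr1 (@Num.norm _ _) (fg1 y); rewrite normrM normr1 => <-.
  by rewrite ler_piMl // char_like_le1.
have gD u h : g (u + h) = g u * g h.
  case: gc => _ _ _ /(_ u h); rewrite g1 expr1n subrr => h0.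
  apply/eqP; rewrite -subr_eq0 -normr_eq0 -sqrf_eq0.
  by rewrite eq_le h0 exprn_ge0.
split=> //; first by rewrite mulr0 addr0.
split=> [k|y k|y]; rewrite !gauss_twist_id // alE.
have gg : g y * (g y)^* = 1 by rewrite -normCK g1 expr1n.
apply: (mulIf (gn0 y)); rewrite fg1 opprD !gD gN.
by transitivity (g y * (g y)^* * (g y * (g y)^*)); [rewrite gg mulr1 | ring].
Qed.

(** Here id + al = 0, so the conditions on its range are trivial and only f = g is left, which is
    the equation at u = v. *)
Lemma heyde_solution_opp1 : a0 = -1 -> heyde_solution 0 0.
Proof.
move=> a1; have alE y : al y = - y.
  by apply: r_inj; rewrite r_al a1 mulN1r raddfN.
split=> //; first by rewrite mulr0 addr0.
split=> [k|y k|y]; rewrite !gauss_twist_id // alE subrr ?oppr0 ?addr0 ?g0 ?mulr1 ?normr1 //.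
have [z ->] := half y.
by have := fg z z; rewrite alE subrr opprK f0 g0 mulr1 mul1r.
Qed.

Section Generic.
Hypotheses (a1 : a0 != 1) (aN1 : a0 != -1).

(** The divisor in the choice of both exponents; it vanishes exactly for a = 1 and a = -1. *)
Let D : R := (1 - a ^+ 2) *+ 2.

Let D0 : D != 0.
Proof.
rewrite mulrn_eq0 /= subr_eq0 eq_sym -rmorphXn /= -(rmorph1 (@ratr R)).
by rewrite (inj_eq (fmorph_inj _)) -(expr1n _ 2) eqf_sqr negb_or a1 aN1.
Qed.

Lemma core_neq0 y : r y != 0 -> r (p (q y)) != 0.
Proof.
move=> y_n0; have -> : r (p (q y)) = (1 - a0) * (1 + a0) * r y.
  by rewrite ?(raddfD, raddfB, raddfN, r_al) /=; ring.
have h1 : 1 - a0 != 0 by rewrite subr_eq0 eq_sym.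
have h2 : 1 + a0 != 0 by rewrite addrC addr_eq0.
by rewrite !mulf_neq0.
Qed.

(** Substituting v = be w exchanges the roles of f and g and replaces al by its inverse [be], so one
    result on mixed differences serves both functions. *)
Lemma heyde_product_laws : exists s1 s2,
  (forall u k m, gauss_twist s1 f (u + p k + q m) * gauss_twist s1 f u =
    gauss_twist s1 f (u + p k) * gauss_twist s1 f (u + q m)) /\
  (forall u k m, gauss_twist s2 g (u + p k + q m) * gauss_twist s2 g u =
    gauss_twist s2 g (u + p k) * gauss_twist s2 g (u + q m)).
Proof.
have [k1 law1] := mixed_difference r_inj r_al half fc gn0 fg.
have gf : heyde be g f.
  move=> u w; have := fg u (be w); rewrite alK mulrC => ->.
  by rewrite mulrC.
have a00 : a0 != 0.
  apply: contraNneq ry0 => a00; have := r_al (be y0).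
  by rewrite alK a00 mul0r => ->.
have r_be y : r (be y) = a0^-1 * r y.
  by rewrite -[in RHS](alK y) r_al mulKf.
have [k2 law2] := mixed_difference r_inj r_be half gc fn0 gf.
have beK y : be (al y) = y by apply: r_inj; rewrite r_be r_al mulKf.
(* The directions [al k] and [- al m] convert the ranges of id + be and id - be into [p k] and
   [q m]; they multiply the constant by - a^2. *)
have law2' u k m : g (u + p k + q m) * g u = g (u + p k) * g (u + q m) *
    cexpR (- (k2 * a ^+ 2) * rr k * rr m).
  have := law2 u (al k) (- al m); rewrite raddfN !beK.
  have -> : al k + k = p k by yring.
  have -> : - al m - - m = q m by yring.
  rewrite (ratr_additive_al _ r_al) ratr_additiveN (ratr_additive_al _ r_al) => ->.
  by congr (_ * cexpR _); ring.
exists (- k1 / D), (k2 * a ^+ 2 / D); split.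
- apply: (gauss_twist_law r_al law1); rewrite -mulrnAr -/D.
  by rewrite divfK // subrr.
- apply: (gauss_twist_law r_al law2'); rewrite -mulrnAr -/D.
  by rewrite divfK // addNr.
Qed.

Lemma heyde_solution_generic : exists s1 s2, heyde_solution s1 s2.
Proof.
have [s1 [s2 [law1 law2]]] := heyde_product_laws; exists s1, s2.
set f1 := gauss_twist s1 f in law1 *; set g1 := gauss_twist s2 g in law2 *.
have f10 : f1 0 = 1 by exact: gauss_twist0.
have g10 : g1 0 = 1 by exact: gauss_twist0.
have f1N y : f1 (- y) = (f1 y)^* by exact: gauss_twistN.
have g1N y : g1 (- y) = (g1 y)^* by exact: gauss_twistN.
have f1n0 y : f1 y != 0 by exact: gauss_twist_neq0.
have g1n0 y : g1 y != 0 by exact: gauss_twist_neq0.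
have f1pq := product_law_split f10 law1.
have g1pq := product_law_split g10 law2.
have f1M := product_law_core r_inj half r_al f10 law1.
have g1M := product_law_core r_inj half r_al g10 law2.
have f1M1 := norm_product_law_core r_inj half r_al f10 f1N law1.
have g1M1 := norm_product_law_core r_inj half r_al g10 g1N law2.
have f1MD := norm_product_law_coreD r_inj half r_al f10 f1N law1.
have g1MD := norm_product_law_coreD r_inj half r_al g10 g1N law2.
pose h0 := p (q y0).
have rh0 : rr h0 != 0 by rewrite fmorph_eq0 core_neq0.
have norm_core (s : R) (F : Y -> C) z : `|gauss_twist s F (p (q z))| = 1 ->
    `|F (p (q z))| = cexpR (- s * rr (p (q z)) ^+ 2).
  rewrite norm_gauss_twist => e; apply: (mulIf (cexpR_neq0 (s * rr (p (q z)) ^+ 2))).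
  by rewrite e -cexpRD mulNr addNr cexpR0.
(* On the core |F| = exp (- s r^2), and this is at most 1. *)
have s_ge0 (s : R) (F : Y -> C) : char_like F ->
    `|gauss_twist s F h0| = 1 -> 0 <= s.
  move=> Fc /norm_core e; have := char_like_le1 Fc h0; rewrite e cexpR_le1.
  by rewrite mulNr oppr_le0 pmulr_lge0 // lt_def sqr_ge0 sqrf_eq0 rh0.
have s1_ge0 : 0 <= s1 by apply: s_ge0 fc _; exact: f1M1.
have s2_ge0 : 0 <= s2 by apply: s_ge0 gc _; exact: g1M1.
(* Moduli in the equation at u = v = h0 give 4 s1 + (1 + a)^2 s2 = (1 - a)^2 s2. *)
have ss : s1 + a * s2 = 0.
  have := congr1 (@Num.norm _ _) (fg h0 h0); rewrite !normrM subrr f0 normr1 mul1r.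
  have -> : h0 + h0 = p (q (y0 + y0)) by rewrite /h0; yring.
  have -> : p h0 = p (q (p y0)) by rewrite /h0; yring.
  have -> : q h0 = p (q (q y0)) by rewrite /h0; yring.
  rewrite (norm_core s1 f _ (f1M1 _)) !(norm_core s2 g _ (g1M1 _)) -cexpRD => /cexpR_inj.
  have -> : rr (p (q (y0 + y0))) = rr h0 *+ 2.
    by rewrite -[RHS]rmorphMn -raddfMn mulr2n; congr (ratr (r _)); rewrite /h0; yring.
  have -> : rr (p (q (p y0))) = (1 + a) * rr h0.
    by rewrite mulrDl mul1r -(ratr_additive_al _ r_al) -ratr_additiveD; congr (ratr (r _)); rewrite /h0; yring.
  have -> : rr (p (q (q y0))) = (1 - a) * rr h0.
    by rewrite mulrBl mul1r -(ratr_additive_al _ r_al) -ratr_additiveB; congr (ratr (r _)); rewrite /h0; yring.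
  move=> e; have rh2 : rr h0 ^+ 2 *+ 4 != 0 by rewrite mulrn_eq0 sqrf_eq0.
  apply: (mulIf rh2); move/eqP: e; rewrite -subr_eq0 => /eqP e.
  by rewrite mul0r -[RHS]oppr0 -[X in _ = - X]e; ring.
(* The Gaussian exponents of the two sides differ by 4 (s1 + a s2) u v = 0. *)
have E1 : heyde al f1 g1.
  move=> u v; rewrite /f1 /g1 /gauss_twist mulrACA fg -cexpRD.
  rewrite [RHS]mulrACA -cexpRD; congr (_ * cexpR _).
  rewrite !(ratr_additiveD, ratr_additiveN, ratr_additive_al _ r_al); set U := rr u; set V := rr v.
  apply: (addIr (- (s1 + a * s2) * (U * V) *+ 4)).
  by rewrite {2}ss; ring.
split=> //.
have dense y (e : R) : 0 < e -> exists x, `|rr (y + p (q x))| < e.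
  move=> e0.
  have zm : zmod_morphism (fun x => p (q x)) by move=> x z; yring.
  pose T : {additive Y -> Y} := HB.pack (fun x => p (q x)) (GRing.isZmodMorphism.Build _ _ _ zm).
  by apply: (dense_image half (T := T) (h := y0)) => //; exact: core_neq0.
(* The modulus of the twist is constant on cosets of the core, and each coset comes arbitrarily
   close to 0, where the twist hardly differs from [F]. *)
have le1 (s : R) (F : Y -> C) : char_like F ->
  (forall y z, `|gauss_twist s F (y + p (q z))| = `|gauss_twist s F y|) ->
  forall y, `|gauss_twist s F y| <= 1.
  move=> Fc Fp y; apply: (le1_of_small_gauss (s := s)) => e e0.
  have [x xe] := dense y e e0; exists (rr (y + p (q x))) => //.
  rewrite -(Fp y x) norm_gauss_twist ler_piMl ?(ltW (cexpR_gt0 _)) //.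
  exact: char_like_le1.
have f1le := le1 s1 f fc f1MD; have g1le := le1 s2 g gc g1MD.
(* The equation at u = v = p w with k = w + w. Its right-hand side is unitary, so with |f1|, |g1| <=
   1 both factors on the left are unitary. *)
have f1g1L k : f1 (p k) * g1 (p k) = g1 (p (q k)).
  have [w wE] := half k.
  have := E1 (p w) (p w); rewrite subrr f10 mul1r.
  have -> : p w + p w = p k by rewrite wE; yring.
  have -> : p w + al (p w) = p k + p (q (- w)) by rewrite wE; yring.
  have -> : p w - al (p w) = p (q w) by yring.
  rewrite g1M mulrA => e.
  have -> : p (q k) = p (q w) + p (q w) by rewrite wE; yring.
  rewrite g1M -{1}e -[RHS]mulrA -g1M.
  have -> : p (q (- w)) + p (q w) = 0 by yring.
  by rewrite g10 mulr1.
have f1g1N m : f1 (q m) = g1 (q m) * g1 (- p (q m)).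
  have [w wE] := half m.
  have := E1 (q w) (q w); rewrite subrr f10 mul1r.
  have -> : q w + q w = q m by rewrite wE; yring.
  have -> : q w - al (q w) = q m + p (q (- w)) by rewrite wE; yring.
  rewrite g1M => e; apply: (mulIf (g1n0 (p (q w)))); rewrite e -[RHS]mulrA.
  apply: (congr1 (fun z => g1 (q m) * z)). have -> : - p (q m) = p (q (- m)) by yring.
  by rewrite -g1M; apply: (congr1 g1); rewrite wE; yring.
have g1L1 k : `|g1 (p k)| = 1.
  apply/eqP; rewrite eq_le g1le /=.
  have := congr1 (@Num.norm _ _) (f1g1L k); rewrite normrM g1M1 => <-.
  by rewrite ler_piMl.
(* Krein's inequality with h a representative of [p k] modulo the core, of small real value t:
   unitarity of [g1] there means |g h| = exp (- s2 t^2), so the error tends to 0. The constant 2 s2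
   r (p y) is the cross term of s2 (r (p y) + t)^2. *)
have g1LD y k : g1 (p y + p k) = g1 (p y) * g1 (p k).
  apply: (eq_of_small_gauss (s := s2) (b := rr (p y)) (c := s2 * rr (p y) *+ 2)) => e e0.
  have [x xe] := dense (p k) e e0; set t := rr (p k + p (q x)) in xe *.
  exists t => //.
  have -> : `|g1 (p y + p k) - g1 (p y) * g1 (p k) * cexpR (s2 * rr (p y) *+ 2 * t)| =
     `|(g (p y + (p k + p (q x))) - g (p y) * g (p k + p (q x))) *
       cexpR (s2 * (rr (p y) + t) ^+ 2)|.
    have eA := g1M (p k) x.
    have eB : g1 (p y + (p k + p (q x))) = g1 (p y + p k) * g1 (p (q x)).
      by rewrite addrA; exact: g1M.
    rewrite -[LHS]mulr1 -(g1M1 x) -normrM; congr `|_|.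
    transitivity (g1 (p y + (p k + p (q x))) -
      g1 (p y) * g1 (p k + p (q x)) * cexpR (s2 * rr (p y) *+ 2 * t)).
      by rewrite eA eB; ring.
    have g1E z : g1 z = g z * cexpR (s2 * rr z ^+ 2) by [].
    rewrite !g1E ratr_additiveD -/t [RHS]mulrBl; congr (_ - _).
    transitivity (g (p y) * g (p k + p (q x)) * (cexpR (s2 * rr (p y) ^+ 2) * cexpR (s2 * t ^+ 2) * cexpR (s2 * rr (p y) *+ 2 * t))); first by ring.
    by rewrite -!cexpRD; congr (_ * cexpR _); ring.
  rewrite normrM norm_cexpR exprMn [X in _ <= X]mulrC.
  apply: ler_wpM2r; first by rewrite exprn_ge0 // ltW ?cexpR_gt0.
  case: gc => _ _ _ /(_ (p y) (p k + p (q x)))/le_trans; apply.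
  have -> : `|g (p k + p (q x))| = (cexpR (s2 * t ^+ 2))^-1.
    apply: (mulIf (cexpR_neq0 (s2 * t ^+ 2))); rewrite mulVf ?cexpR_neq0 //.
    by rewrite -norm_gauss_twist g1MD g1L1.
  by rewrite exprVn.
split=> [k|y k|s]; rewrite -?/f1 -?/g1 //.
  have [b [m ->]] := pq_decomp r_inj r_al half y.
  have -> : p b + q m + p k = p (b + k) + q m by yring.
  rewrite !g1pq; have -> : p (b + k) = p b + p k by yring.
  by rewrite g1LD mulrAC.
have [b [m ->]] := pq_decomp r_inj r_al half s.
rewrite f1pq g1pq f1g1N.
have -> : - p (p b + q m) = - p (p b) + p (q (- m)) by yring.
rewrite g1M.
have -> : p (q (- m)) = - p (q m) by yring.
suff -> : f1 (p b) = g1 (p b) * g1 (- p (p b)) by rewrite mulrACA.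
apply: (mulIf (g1n0 (p b))); rewrite f1g1L.
have -> : - p (p b) = p (- p b) by yring.
rewrite -g1LD.
have -> : p b + p (- p b) = p (b - p b) by yring.
by rewrite -g1LD; apply: (congr1 g1); yring.
Qed.

End Generic.

Theorem heyde_equation : exists s1 s2, heyde_solution s1 s2.
Proof.
have [e1|a1] := eqVneq a0 1; first by exists 0, 0; exact: heyde_solution_one.
have [e1|aN1] := eqVneq a0 (-1); last exact: heyde_solution_generic.
by exists 0, 0; exact: heyde_solution_opp1.
Qed.

End HeydeSolution.

(** * Characters of the solenoid *)

Section ComplexTopology.
Variable R : realType.
Implicit Types z w : R[i].
Local Notation Re := (@complex.Re R).
Local Notation Im := (@complex.Im R).

Lemma mulCE (a b c d : R) :
  (a +i* b)%C * (c +i* d)%C = ((a * c - b * d) +i* (a * d + b * c))%C.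
Proof. by []. Qed.

Lemma ReD z w : Re (z + w) = Re z + Re w.
Proof. by case: z w => [? ?] []. Qed.

Lemma ReB z w : Re (z - w) = Re z - Re w.
Proof. by case: z w => [? ?] []. Qed.

Lemma ImB z w : Im (z - w) = Im z - Im w.
Proof. by case: z w => [? ?] []. Qed.

Lemma normC_max (z : R[i]) : `|z| <= (`|Re z| + `|Im z|)%:C%C.
Proof.
rewrite [z in X in X <= _]complexE; apply: le_trans (ler_normD _ _) _.
rewrite normrM.
have -> : `|'i%C : R[i]| = 1.
  by rewrite normc_def /= expr0n /= add0r expr1n sqrtr1.
by rewrite mul1r !normc_def /= expr0n /= !addr0 !sqrtr_sqr -rmorphD lexx.
Qed.

Lemma Re_le_norm z : (`|Re z|)%:C%C <= `|z|.
Proof. exact: normc_ge_Re. Qed.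

Lemma Im_le_norm z : (`|Im z|)%:C%C <= `|z|.
Proof.
rewrite normc_def lecR -sqrtr_sqr ler_wsqrtr // lerDr ?sqr_ge0 //.
Qed.

Lemma cvg_complex (T : Type) (F : set_system T) {FF : Filter F} (f g : T -> R) (a b : R) :
  f @ F --> a -> g @ F --> b ->
  (fun t => (f t +i* g t)%C : R[i]^o) @ F --> ((a +i* b)%C : R[i]^o).
Proof.
move=> /cvgrPdist_lt fa /cvgrPdist_lt gb; apply/cvgrPdist_lt => -[e e'].
rewrite ltcE /= => /andP[/eqP -> e0].
have e20 : 0 < e / 2 by rewrite divr_gt0.
apply: filterS2 (fa _ e20) (gb _ e20) => t ft gt.
apply: le_lt_trans (normC_max _) _; rewrite ltcR ReB ImB /=.
by rewrite [ltRHS](splitr e) ltrD.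
Qed.

Lemma Re_cvg (T : Type) (F : set_system T) {FF : Filter F} (f : T -> R[i]) (l : R[i]) :
  (f : T -> R[i]^o) @ F --> (l : R[i]^o) -> (fun t => Re (f t)) @ F --> Re l.
Proof.
move=> /cvgrPdist_lt fl; apply/cvgrPdist_lt => e e0.
have ec : (0 : R[i]) < e%:C%C by rewrite ltcR.
apply: filterS (fl _ ec) => t ft; rewrite -ReB -ltcR.
exact: le_lt_trans (Re_le_norm _) ft.
Qed.

Lemma Im_cvg (T : Type) (F : set_system T) {FF : Filter F} (f : T -> R[i]) (l : R[i]) :
  (f : T -> R[i]^o) @ F --> (l : R[i]^o) -> (fun t => Im (f t)) @ F --> Im l.
Proof.
move=> /cvgrPdist_lt fl; apply/cvgrPdist_lt => e e0.
have ec : (0 : R[i]) < e%:C%C by rewrite ltcR.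
apply: filterS (fl _ ec) => t ft; rewrite -ImB -ltcR.
exact: le_lt_trans (Im_le_norm _) ft.
Qed.

End ComplexTopology.

(** * The circle group and continuous homomorphisms of the line into it *)

Section Circle.
Variable R : realType.
Implicit Types (z w : R[i]) (s t : R).
Local Notation Re := (@complex.Re R).
Local Notation Im := (@complex.Im R).

(** The covering t |-> exp (2 pi i t), normalized to period 1. *)
Definition circ t : R[i] := (cos (pi * t *+ 2) +i* sin (pi * t *+ 2))%C.

Lemma circD s t : circ (s + t) = circ s * circ t.
Proof.
rewrite /circ mulrDr mulrnDl; move: (_ *+ 2) (_ *+ 2) => x y.
by rewrite cosD sinD mulCE [X in (_ +i* X)%C]addrC.
Qed.

Lemma circ0 : circ 0 = 1.
Proof. by apply/eqP; rewrite /circ mulr0 mul0rn cos0 sin0 eq_complex /= !eqxx. Qed.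

Lemma circ1 : circ 1 = 1.
Proof. by apply/eqP; rewrite /circ mulr1 cos2pi sin2pi eq_complex /= !eqxx. Qed.

Lemma norm_circ t : `|circ t| = 1.
Proof. by rewrite normc_def /= cos2Dsin2 sqrtr1. Qed.

Lemma circ_neq0 t : circ t != 0.
Proof. by rewrite -normr_gt0 norm_circ. Qed.

Lemma circN t : circ (- t) = (circ t)^-1.
Proof.
by apply: (mulfI (circ_neq0 t)); rewrite -circD subrr circ0 divff ?circ_neq0.
Qed.

Lemma circMn t n : circ (t *+ n) = circ t ^+ n.
Proof.
by elim: n => [|n IHn]; rewrite ?mulr0n ?circ0 // mulrS circD IHn exprS.
Qed.

Lemma circMz t (n : int) : circ (t *~ n) = circ t ^ n.
Proof.
case: n => n; first by rewrite -pmulrn circMn.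
by rewrite NegzE mulrNz circN -pmulrn circMn exprnN.
Qed.

Lemma circ_int (n : int) : circ n%:~R = 1.
Proof. by rewrite circMz circ1 exp1rz. Qed.

Lemma continuous_circ : continuous (circ : R -> R[i]^o).
Proof.
move=> t; apply: cvg_complex.
  apply: (continuous_comp (f := fun t => pi * t *+ 2) (g := cos)).
    by apply: cvgMn; apply: cvgM; [exact: cvg_cst | exact: cvg_id].
  exact: continuous_cos.
apply: (continuous_comp (f := fun t => pi * t *+ 2) (g := sin)).
  by apply: cvgMn; apply: cvgM; [exact: cvg_cst | exact: cvg_id].
exact: continuous_sin.
Qed.

(** A fractional part f > 0 would give sin (pi f) > 0, hence cos (2 pi f) = 1 - 2 sin^2 (pi f) <
    1. *)
Lemma circ_eq1 t : circ t = 1 -> exists n : int, t = n%:~R.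
Proof.
move=> t1; exists (Num.floor t); set n := Num.floor t.
have /andP[n1 n2] := floor_itv t; rewrite -/n in n1 n2.
pose f := t - n%:~R.
have f1 : circ f = 1 by rewrite circD t1 mul1r circN circ_int invr1.
have f0 : 0 <= f by rewrite subr_ge0.
have flt1 : f < 1 by rewrite /f ltrBlDl -[1]/(1%:~R) -intrD.
apply/eqP; rewrite -subr_eq0 eq_le f0 andbT leNgt; apply/negP => f_gt0.
have s0 : 0 < sin (pi * f).
  by apply: sin_gt0_pi; rewrite mulr_gt0 ?pi_gt0 //= gtr_pMr ?pi_gt0.
case: f1; rewrite cos_mulr2n cos2sin2 => /eqP.
rewrite -subr_eq0 => /eqP h _.
have : sin (pi * f) ^+ 2 = 0 by apply: (mulIf (_ : 2 != 0 :> R)) => //; rewrite mul0r -[RHS]oppr0 -[X in _ = - X]h; ring.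
by move/eqP; rewrite sqrf_eq0 gt_eqF.
Qed.

Lemma circ_arg z : `|z| = 1 -> exists t, [/\ z = circ t, - 2^-1 <= t & t <= 2^-1].
Proof.
case: z => x y; rewrite normc_def /= => -[] /(congr1 (fun u => u ^+ 2)).
rewrite sqr_sqrtr ?addr_ge0 ?sqr_ge0 // expr1n => xy1.
have x1 : -1 <= x <= 1.
  by have y2 := sqr_ge0 y; apply/andP; split; nra.
pose t := acos x / (pi *+ 2).
have pi0 := pi_gt0 R; have pin0 : pi != 0 :> R by rewrite gt_eqF.
have tE : pi * t *+ 2 = acos x.
  by rewrite /t; move: pin0; generalize (pi : R) => P P0; field.
have t0 : 0 <= t by rewrite divr_ge0 ?acos_ge0 // mulrn_wge0 ?pi_ge0.
have t1 : t <= 2^-1.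
  rewrite -(ler_pM2l pi0) -(ler_pMn2r (isT : 0 < 2)%N) tE.
  have -> : pi * 2^-1 *+ 2 = pi :> R by generalize (pi : R) => P; field.
  exact: acos_lepi.
have sE : sin (acos x) = `|y| by rewrite sin_acos // -xy1 addrAC subrr add0r sqrtr_sqr.
have cE : cos (acos x) = x by rewrite acosK // in_itv.
have [y0|y0] := leP 0 y.
  exists t; split=> //; last by rewrite (le_trans _ t0) // oppr_le0 invr_ge0.
  by rewrite /circ tE cE sE ger0_norm.
exists (- t); split; last 2 first.
- by rewrite lerN2.
- by rewrite (le_trans _ (_ : 0 <= _)) // ?oppr_le0 ?invr_ge0.
by rewrite /circ mulrN mulNrn tE cosN sinN cE sE ltr0_norm // opprK.
Qed.

Lemma Re_circ_gt0 t : - 4^-1 < t < 4^-1 -> 0 < Re (circ t).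
Proof.
move=> /andP[t1 t2] /=; apply: cos_gt0_pihalf.
have pi0 := pi_gt0 R.
have e : pi * 4^-1 *+ 2 = pi / 2 :> R by generalize (pi : R) => P; field.
by rewrite -{1}e -e -mulNrn -mulrN !ltr_pMn2r // !ltr_pM2l // t1.
Qed.

Lemma Re_circ_le0 t : 4^-1 <= t <= 2^-1 -> Re (circ t) <= 0.
Proof.
move=> /andP[t1 t2] /=.
have -> : pi * t *+ 2 = (pi * t *+ 2 - pi / 2) + pi / 2 by rewrite subrK.
rewrite cosDpihalf oppr_le0; apply: sin_ge0_pi.
have pi0 := pi_gt0 R.
move: (pi : R) pi0 => P P0; rewrite subr_ge0 lerBlDr; apply/andP; split; nra.
Qed.

Lemma circ_arg_Re z : `|z| = 1 -> 0 < Re z ->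
  exists t, [/\ z = circ t, - 4^-1 < t & t < 4^-1].
Proof.
move=> /circ_arg[t [-> t1 t2]] Rez; exists t.
split=> //; rewrite ltNge; apply/negP => h.
  have : Re (circ (- t)) <= 0.
    by apply: Re_circ_le0; rewrite lerNr h /= lerNl.
  by rewrite leNgt /= mulrN mulNrn cosN -/(Re (circ t)) Rez.
by have := Re_circ_le0 (introT andP (conj h t2)); rewrite leNgt Rez.
Qed.

Lemma circ_half : circ (2^-1) = -1.
Proof.
rewrite /circ; have -> : pi * 2^-1 *+ 2 = pi :> R by generalize (pi : R) => P; field.
by apply/eqP; rewrite cospi sinpi eq_complex /= oppr0 !eqxx.
Qed.

(* Doubling the angle at least doubles 1 - Re w, so the powers of w <> 1 leave
   the right half-plane. *)
Lemma no_small_subgroup w : `|w| = 1 -> (forall m : nat, 0 < Re (w ^+ m)) ->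
  w = 1.
Proof.
move=> w1 wm.
have ReIm v : `|v| = 1 -> Re v ^+ 2 + Im v ^+ 2 = 1.
  move=> v1; apply: (@complexI R); rewrite add_Re2_Im2 v1 expr1n //.
have grow k : (1 - Re w) *+ 2 ^ k <= 1 - Re (w ^+ (2 ^ k)).
  elim: k => [|k IHk]; first by rewrite expn0 expr1 mulr1n.
  rewrite expnSr mulrnA exprM; set v := w ^+ (2 ^ k) in IHk *.
  have v1 : `|v| = 1 by rewrite normrX w1 expr1n.
  have := wm (2 ^ k)%N; rewrite -/v; have := ReIm v v1.
  rewrite expr2; case: (v) IHk => x y /= IHk; set D := (1 - Re w) *+ 2 ^ k in IHk *.
  move=> xy x0; have x1 : x <= 1 by rewrite -[leRHS]sqrtr1 -xy (le_trans (ler_norm x)) // -sqrtr_sqr ler_wsqrtr // lerDl sqr_ge0.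
  by rewrite mulr2n; nra.
have d0 : 0 <= 1 - Re w.
  have := Re_le_norm w; rewrite w1 -[1]/(1%:C)%C lecR subr_ge0.
  exact: le_trans (ler_norm _).
have d00 : 1 - Re w = 0.
  apply/eqP; rewrite eq_le d0 andbT leNgt; apply/negP => dp.
  pose k := Num.truncn (1 - Re w)^-1.
  have : (1 - Re w)^-1 < (2 ^ k)%:R.
    apply: lt_le_trans (_ : k.+1%:R <= _).
      have ip : 0 <= (1 - Re w)^-1 by rewrite invr_ge0.
      by have /andP[] := truncn_itv ip.
    by rewrite ler_nat ltn_expl.
  rewrite invf_plt ?posrE ?ltr0n ?expn_gt0 // ltNge => /negP; apply.
  rewrite -[leRHS]mul1r ler_pdivlMr ?ltr0n ?expn_gt0 // mulr_natr.
  apply: le_trans (grow k) _; have := wm (2 ^ k)%N; lra.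
have Rw : Re w = 1 by apply/eqP; rewrite eq_sym -subr_eq0 d00.
have := ReIm w w1; rewrite Rw expr1n => /eqP; rewrite -subr_eq0 addrAC subrr add0r sqrf_eq0 => /eqP Iw.
by case: w Rw Iw {w1 wm grow d0 d00} => x y /= -> ->.
Qed.

End Circle.

(** Each point has a neighbourhood and a rank beyond which [F n] meets it only inside [A];
    compactness makes the rank uniform. It serves to find an open subgroup on which a character is
    trivial, to intersect nested closed sets, and to build a countable base. *)
Lemma compact_decreasing (T : topologicalType) (F : nat -> set T) (A : set T) :
  compact [set: T] -> (forall n, closed (F n)) ->
  (forall n, F n.+1 `<=` F n) -> open A -> (forall x, (forall n, F n x) -> A x) ->
  exists n, F n `<=` A.
Proof.
move=> /compact_near_coveringP cT cF dF oA FA.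
have dF' m n : (m <= n)%N -> F n `<=` F m.
  move=> /subnK <-; elim: (n - m)%N => [|k IHk] //.
  by apply: subset_trans IHk; exact: dF.
have := cT nat \oo (fun n x => F n x -> A x) _.
have H : forall x, [set: T] x -> \forall x' \near x & n \near \oo, F n x' -> A x'.
  move=> x _; have [Ax|nAx] := pselect (A x).
    exists (A, setT) => //=; first by split; [exact: open_nbhs_nbhs | exact: filterT].
    by move=> [x' n] /= [].
  have [N FN] : exists N, ~ F N x by apply/existsNP => Fx; apply: nAx; exact: FA.
  exists (~` F N, [set n | (N <= n)%N]) => /=.
    split; last by exists N.
    by apply: open_nbhs_nbhs; split=> //; exact: closed_openC.
  by move=> [x' n] /= [nF Nn] /(dF' _ _ Nn).
move=> /(_ _ H) [N _ HN]; exists N => x Fx.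
by apply: (HN N) => //=.
Qed.

Section CircleHom.
Variable R : realType.
Local Notation Re := (@complex.Re R).
Variable c : R -> R[i].
Hypothesis c_norm : forall t, `|c t| = 1.
Hypothesis cD : forall s t, c (s + t) = c s * c t.

Lemma circle_hom0 : c 0 = 1.
Proof.
have n0 : c 0 != 0 by rewrite -normr_gt0 c_norm.
by apply: (mulfI n0); rewrite -cD addr0 mulr1.
Qed.

Lemma circle_homN t : c (- t) = (c t)^-1.
Proof.
have n0 : c t != 0 by rewrite -normr_gt0 c_norm.
by apply: (mulfI n0); rewrite -cD subrr circle_hom0 divff.
Qed.

Lemma circle_homMn t n : c (t *+ n) = c t ^+ n.
Proof.
by elim: n => [|n IHn]; rewrite ?mulr0n ?circle_hom0 // mulrS cD IHn exprS.
Qed.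

Lemma circle_homMz t (n : int) : c (t *~ n) = c t ^ n.
Proof.
case: n => n; first by rewrite -pmulrn circle_homMn.
by rewrite NegzE mulrNz circle_homN -pmulrn circle_homMn exprnN.
Qed.

Hypothesis c_cont : continuous (c : R -> R[i]^o).

Lemma circle_hom_near_pos : exists2 e : R, 0 < e & forall t, `|t| < e -> 0 < Re (c t).
Proof.
have c0 : (fun t => Re (c t)) @ (0 : R) --> Re (c 0) by apply: Re_cvg; exact: c_cont.
have : \forall t \near (0 : R), 0 < Re (c t).
  by apply: (c0 (fun x => 0 < x)); apply: lt_nbhsr; rewrite circle_hom0.
move=> /nbhs_ballP[e /= e0 He]; exists e => // t te; apply: He.
by rewrite /ball /= sub0r normrN.
Qed.

(** A period d shorter than the radius on which Re c > 0 spreads this positivity to the whole line,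
    and the circle has no nontrivial subgroup in the right half-plane. *)
Lemma circle_hom_trivial :
  (forall e : R, 0 < e -> exists d, [/\ 0 < d, d < e & c d = 1]) ->
  forall t, c t = 1.
Proof.
have [e e0 He] := circle_hom_near_pos => /(_ e e0)[d [d0 de d1]].
have pos t : 0 < Re (c t).
  pose n := Num.floor (t / d).
  have -> : c t = c (t - d *~ n) by rewrite cD circle_homN circle_homMz d1 exp1rz invr1 mulr1.
  have /andP[n1 n2] := floor_itv (t / d); rewrite -/n in n1 n2.
  have h1 : 0 <= t - d *~ n by rewrite subr_ge0 -mulrzl -ler_pdivlMr.
  apply: He; rewrite ger0_norm //; apply: lt_trans de.
  rewrite ltrBlDl; move: n2; rewrite intrD ltr_pdivrMr // mulrDl mul1r.
  by rewrite mulrzl.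
by move=> t; apply: no_small_subgroup => // m; rewrite -circle_homMn.
Qed.

End CircleHom.

(** The frequency is read off at one small dyadic fraction [dl] of N, where the argument [th] of c
    lies in (-1/4, 1/4). The quotient of c by t |-> circ (th / dl t) is 1 at all [dl / 2 ^ i], hence
    trivial; the period N makes the frequency times N an integer. *)
Lemma circle_hom_periodic (R : realType) (c : R -> R[i]) (N : R) :
  (forall t, `|c t| = 1) -> (forall s t, c (s + t) = c s * c t) ->
  continuous (c : R -> R[i]^o) -> 0 < N -> c N = 1 ->
  exists k : int, forall t, c t = circ (k%:~R / N * t).
Proof.
move=> c1 cD cc N0 cN.
have [e e0 He] := circle_hom_near_pos c1 cD cc.
pose j := Num.truncn (N / e).
have [dl [dl0 dle dlN]] : exists dl, [/\ 0 < dl, dl < e & dl *+ 2 ^ j = N].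
  exists (N / (2 ^ j)%:R).
  have j0 : 0 < (2 ^ j)%:R :> R by rewrite ltr0n expn_gt0.
  split; first by rewrite divr_gt0.
    rewrite ltr_pdivrMr // mulrC -ltr_pdivrMr //.
    apply: lt_le_trans (_ : j.+1%:R <= _); last by rewrite ler_nat ltn_expl.
    have ip : 0 <= N / e by rewrite divr_ge0 // ltW.
    by have /andP[] := truncn_itv ip.
  by rewrite -[LHS]mulr_natr divfK // gt_eqF.
have [th [cth th1 th2]] : exists t, [/\ c dl = circ t, - 4^-1 < t & t < 4^-1].
  by apply: circ_arg_Re => //; apply: He; rewrite gtr0_norm.
pose c' t := c t * circ (- (th / dl * t)).
have c'1 t : `|c' t| = 1 by rewrite normrM c1 norm_circ mul1r.
have c'D s t : c' (s + t) = c' s * c' t.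
  by rewrite /c' cD mulrDr opprD circD mulrACA.
have c'c : continuous (c' : R -> R[i]^o).
  have cE : continuous ((fun t => circ (- (th / dl * t))) : R -> R[i]^o).
    move=> t; apply: (@continuous_comp R R R[i]^o (fun t => - (th / dl * t)) (@circ R) t).
      by apply: cvgN; apply: cvgM; [exact: cvg_cst | exact: cvg_id].
    exact: continuous_circ.
  by move=> t; apply: cvgM; [exact: cc | exact: cE].
(* At each halving the value is a square root of 1; -1 is excluded since [c s] and
   [circ (th / dl * s)] both have positive real part. *)
have small i : c' (dl / (2 ^ i)%:R) = 1.
  elim: i => [|i IHi].
    by rewrite expn0 divr1 /c' cth mulfVK ?gt_eqF // -circD subrr circ0.
  set s := dl / (2 ^ i.+1)%:R.
  have s0 : 0 < s by rewrite divr_gt0 // ltr0n expn_gt0.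
  have sdl : s <= dl.
    by rewrite ler_pdivrMr ?ltr0n ?expn_gt0 // ler_peMr ?(ltW dl0) // ler1n expn_gt0.
  have ss : s + s = dl / (2 ^ i)%:R.
    rewrite /s expnS natrM; field.
    by rewrite pnatr_eq0 -lt0n expn_gt0.
  have : c' s ^+ 2 == 1 by rewrite expr2 -c'D ss IHi.
  rewrite sqrf_eq1 => /orP[/eqP //|/eqP h].
  have : 0 < complex.Re (c s) by apply: He; rewrite gtr0_norm // (le_lt_trans sdl).
  have -> : c s = - circ (th / dl * s).
    have := congr1 (fun z => z * circ (th / dl * s)) h.
    by rewrite /= /c' -mulrA -circD addNr circ0 mulr1 mulN1r.
  have : 0 < complex.Re (circ (th / dl * s)).
    apply: Re_circ_gt0; rewrite -ltr_norml normrM normf_div.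
    rewrite (gtr0_norm dl0) (gtr0_norm s0) -mulrA.
    apply: (@le_lt_trans _ _ `|th|); last by rewrite ltr_norml th1.
    by rewrite ler_piMr // mulrC ler_pdivrMr // mul1r.
  by case: (circ _) => x y /=; rewrite oppr_gt0 => h1 h2; have := lt_trans h1 h2; rewrite ltxx.
have cE t : c t = circ (th / dl * t).
  have : c' t = 1.
    apply: circle_hom_trivial => // e' e'0.
    pose i := Num.truncn (dl / e').
    exists (dl / (2 ^ i)%:R); split=> //; first by rewrite divr_gt0 ?ltr0n ?expn_gt0.
    rewrite ltr_pdivrMr ?ltr0n ?expn_gt0 // mulrC -ltr_pdivrMr //.
    apply: lt_le_trans (_ : i.+1%:R <= _); last by rewrite ler_nat ltn_expl.
    have ip : 0 <= dl / e' by rewrite divr_ge0 // ltW.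
    by have /andP[] := truncn_itv ip.
  by move/(congr1 (fun z => z * circ (th / dl * t))); rewrite /c' -mulrA -circD addNr circ0 mulr1 mul1r.
have [k kE] : exists k : int, th / dl * N = k%:~R by apply: circ_eq1; rewrite -cE.
by exists k => t; rewrite cE -kE mulfK ?gt_eqF.
Qed.

(** * Compactness of the solenoid and its basic characters *)

Section BasicCharacters.
Variables (R : realType) (a : nat -> nat) (a_gt1 : forall j, (1 < a j)%N).
Local Notation D := (adic a_gt1).
Local Notation G := (R * D)%type.
Local Notation X := (solenoid R a_gt1).
Local Notation Re := (@complex.Re R).
Local Notation proj := (@solenoid_proj R a a_gt1).

Lemma adic_compact : compact [set: D].
Proof.
have fin j : compact [set: discrete_topology 'I_(a j)].
  by apply: finite_compact; exact: (@finite_finset 'I_(a j) setT).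
have := @tychonoff nat (fun j => discrete_topology 'I_(a j)) (fun j => setT) fin.
rewrite (_ : [set f | _] = setT) //.
by apply/seteqP; split.
Qed.

Lemma proj_continuous : continuous (proj : G -> X).
Proof.
by apply/continuousP => A oA; exact: oA.
Qed.

Lemma adic_unit_mulrn_val n m :
  trunc_val (adic_unit a_gt1 *+ m) n = (m %% radix a n)%N.
Proof.
elim: m => [|m IHm]; first by rewrite mulr0n trunc_val0 mod0n.
rewrite mulrS [trunc_val _ _]trunc_valD IHm modnDmr.
case: n {IHm} => [|n]; last by rewrite trunc_val1 add1n.
by rewrite /radix big_ord0 !modn1.
Qed.

Lemma proj_winding (x : D) (t : R) (m : nat) :
  proj (t, x) = proj (t + m%:R, x + adic_unit a_gt1 *+ m).
Proof.
apply/solenoid_proj_eq; apply/asboolP; exists (- m%:Z).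
rewrite -[(t, x) - _]/((t - (t + m%:R), x - (x + adic_unit a_gt1 *+ m)) : G).
by rewrite !opprD !addNKr !mulrNz.
Qed.

(* Every point of X is represented in [0, 1] x D: *)
Lemma solenoid_compact : compact [set: X].
Proof.
have -> : [set: X] = proj @` (`[0, 1] `*` [set: D]).
  apply/seteqP; split=> // x _; have [[t z] <-] := solenoid_proj_surj x.
  pose n := Num.floor t; have /andP[n1 n2] := floor_itv t; rewrite -/n in n1 n2.
  exists (t - n%:~R, z - adic_unit a_gt1 *~ n).
    split=> //=; rewrite in_itv /= subr_ge0 n1 /= lerBlDl.
    by rewrite ltW // -[1]/(1%:~R) -intrD.
  apply/solenoid_proj_eq; apply/asboolP; exists (- n).
  rewrite -[_ - _]/((t - n%:~R - t, z - adic_unit a_gt1 *~ n - z) : G).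
  rewrite addrAC subrr sub0r [z - _ - z]addrAC subrr sub0r.
  by rewrite !mulrNz.
apply: continuous_compact.
  apply: continuous_subspaceT; exact: proj_continuous.
by apply: compact_setX; [exact: segment_compact | exact: adic_compact].
Qed.

(** The pull-back to R x D of the character 1 / (a_0 ... a_(n-1)) of H_a. An integer m of the
    winding subgroup enters through m minus its residue, a multiple of the radix, so the character
    descends to the quotient. *)
Definition cover_char n (p : G) : R[i] :=
  circ ((p.1 - (trunc_val p.2 n)%:R) / (radix a n)%:R).

Lemma radix_neq0 n : (radix a n)%:R != 0 :> R.
Proof. by rewrite pnatr_eq0 -lt0n radix_gt0. Qed.

Lemma cover_charD n p q : cover_char n (p + q) = cover_char n p * cover_char n q.
Proof.
case: p q => [s x] [t y]; rewrite /cover_char -[((s, x) + (t, y)).1]/(s + t).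
rewrite -[((s, x) + (t, y)).2]/(adic_add x y) /=.
(* The quotient is the carry out of the first n digits; it shifts the argument of [circ] by an
   integer. *)
have e : (trunc_val x n + trunc_val y n)%:R =
   ((trunc_val x n + trunc_val y n) %/ radix a n)%:R * (radix a n)%:R +
   (trunc_val (adic_add x y) n)%:R :> R.
  by rewrite trunc_valD -natrM -natrD -divn_eq.
rewrite natrD in e; rewrite -circD; set q := ((_ + _) %/ _)%N in e.
have -> : (s - (trunc_val x n)%:R) / (radix a n)%:R + (t - (trunc_val y n)%:R) / (radix a n)%:R
   = (s + t - (trunc_val (adic_add x y) n)%:R) / (radix a n)%:R - q%:R.
  have N0 := radix_neq0 n; move: e N0; set N := (radix a n)%:R; move=> e N0.
  have -> : (trunc_val x n)%:R = q%:R * N + (trunc_val (adic_add x y) n)%:R - (trunc_val y n)%:R :> R.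
    by rewrite -e addrK.
  by field.
by rewrite [RHS]circD circN (circ_int R (Posz q)) invr1 mulr1.
Qed.

Lemma cover_char_winding n p : p \in @winding R a a_gt1 -> cover_char n p = 1.
Proof.
have c0 : cover_char n 0 = 1.
  by rewrite /cover_char /= trunc_val0 subr0 mul0r circ0.
have c1 : forall m : nat, cover_char n (m%:R, adic_unit a_gt1 *+ m) = 1.
  move=> m; rewrite /cover_char /= adic_unit_mulrn_val.
  rewrite {1}(divn_eq m (radix a n)) natrD addrK natrM mulfK ?radix_neq0 //.
  exact: (circ_int R (Posz _)).
move=> /asboolP[[m|m] ->]; first by rewrite -!pmulrn; exact: c1.
apply: (mulIf (circ_neq0 (((m.+1%:R - (trunc_val (adic_unit a_gt1 *+ m.+1) n)%:R) / (radix a n)%:R)))).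
rewrite -[circ _]/(cover_char n (m.+1%:R, adic_unit a_gt1 *+ m.+1)) -cover_charD c1 mulr1 -c0.
congr cover_char; rewrite NegzE !mulrNz -!pmulrn.
by rewrite -[LHS]/((- _ + _, - _ + _)) !addNr.
Qed.

Lemma cover_char_continuous n : continuous (cover_char n : G -> R[i]^o).
Proof.
move=> [t z].
have tr : \forall u \near (t, z), trunc_val u.2 n = trunc_val z n.
  suff h : \forall u \near z, trunc_val u n = trunc_val z n.
    exact: (@cvg_snd _ _ (nbhs t) (nbhs z)) h.
  elim: n => [|n IHn]; first by apply: filterE => u; rewrite /trunc_val !big_ord0.
  by apply: filterS2 IHn (near_digit z n) => u; rewrite !trunc_valS => -> ->.
pose g (u : G) := circ ((u.1 - (trunc_val z n)%:R) / (radix a n)%:R).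
have cg : (g : G -> R[i]^o) @ (t, z) --> (g (t, z) : R[i]^o).
  apply: (@continuous_comp G R R[i]^o
    (fun u => (u.1 - (trunc_val z n)%:R) / (radix a n)%:R) (@circ R) (t, z)); last first.
    exact: continuous_circ.
  apply: cvgM; last exact: cvg_cst.
  apply: (@cvgB _ R); last exact: cvg_cst.
  exact: (@cvg_fst _ _ (nbhs t) (nbhs z)).
apply: cvg_trans cg; apply: near_eq_cvg.
by apply: filterS tr => u; rewrite /g /cover_char => ->.
Qed.

Definition solenoid_char_fun n (x : X) : R[i] := cover_char n (repr x).

Lemma solenoid_char_funE n p : solenoid_char_fun n (proj p) = cover_char n p.
Proof.
rewrite /solenoid_char_fun.
have /solenoid_proj_eq w : proj (repr (proj p)) = proj p by exact: reprK.
by rewrite -[in LHS](subrK p (repr (proj p))) cover_charD cover_char_winding // mul1r.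
Qed.

Fact solenoid_char_norm n x : `|solenoid_char_fun n x| = 1.
Proof. exact: norm_circ. Qed.

Fact solenoid_charD n x y :
  solenoid_char_fun n (x + y) = solenoid_char_fun n x * solenoid_char_fun n y.
Proof.
have [p <-] := solenoid_proj_surj x; have [q <-] := solenoid_proj_surj y.
by rewrite -solenoid_projD !solenoid_char_funE cover_charD.
Qed.

Fact solenoid_char_continuous n : continuous (solenoid_char_fun n : X -> R[i]^o).
Proof.
apply/(@quotient_continuous _ (Quotient.quot (@winding R a a_gt1))).
have -> : solenoid_char_fun n \o (\pi_(Quotient.quot (@winding R a a_gt1)))%qT =
    cover_char n by apply/funext => p; exact: solenoid_char_funE.
exact: cover_char_continuous.
Qed.

Definition solenoid_char n : character R X :=
  Character (solenoid_char_norm n) (solenoid_charD n)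
    (@solenoid_char_continuous n).

Lemma solenoid_charE n t (z : D) : solenoid_char n (proj (t, z)) =
  circ ((t - (trunc_val z n)%:R) / (radix a n)%:R).
Proof. exact: solenoid_char_funE. Qed.

End BasicCharacters.

Section CharacterValues.
Variables (R : realType) (X : topologicalZmodType).
Implicit Types (y : character R X) (x : X).

Lemma char_at0 y : y 0 = 1.
Proof.
have n0 := char_neq0 y 0.
by apply: (mulfI n0); rewrite -charD addr0 mulr1.
Qed.

Lemma char_atN y x : y (- x) = (y x)^-1.
Proof.
have n0 := char_neq0 y x.
by apply: (mulfI n0); rewrite -charD subrr char_at0 divff.
Qed.

Lemma char_atB y x x' : y (x - x') = y x / y x'.
Proof. by rewrite charD char_atN. Qed.

Lemma char_atMn y x n : y (x *+ n) = y x ^+ n.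
Proof.
by elim: n => [|n IHn]; rewrite ?mulr0n ?char_at0 // mulrS charD IHn exprS.
Qed.

Lemma char0E x : (0 : character R X) x = 1. Proof. by []. Qed.

Lemma charDE y y' x : (y + y') x = y x * y' x. Proof. by []. Qed.

Lemma charNE y x : (- y) x = (y x)^-1. Proof. by []. Qed.

Lemma charMnE y n x : (y *+ n) x = y x ^+ n.
Proof.
by elim: n => [|n IHn]; rewrite ?mulr0n // mulrS charDE IHn exprS.
Qed.

Lemma charMzE y (k : int) x : (y *~ k) x = y x ^ k.
Proof.
case: k => k; first by rewrite -pmulrn charMnE.
by rewrite NegzE mulrNz charNE -pmulrn charMnE exprnN.
Qed.

Lemma char_conj y x : (y x)^-1 = (y x)^*.
Proof.
apply: (mulfI (char_neq0 y x)); rewrite divff ?char_neq0 //.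
by rewrite -normCK char_norm expr1n.
Qed.

End CharacterValues.

(** * Determination of the dual group *)

Section SolenoidDual.
Variables (R : realType) (a : nat -> nat) (a_gt1 : forall j, (1 < a j)%N).
Local Notation D := (adic a_gt1).
Local Notation G := (R * D)%type.
Local Notation X := (solenoid R a_gt1).
Local Notation Y := (character R X).
Local Notation Re := (@complex.Re R).
Local Notation proj := (@solenoid_proj R a a_gt1).
Local Notation psi := (@solenoid_char R a a_gt1).

Lemma solenoid_proj0 : proj (0, 0) = 0.
Proof.
by rewrite -[(0, 0)]/(0 : G) -[X in proj X](subrr (0 : G)) solenoid_projB subrr.
Qed.

Lemma solenoid_char_mul n : psi n = psi n.+1 *+ a n.
Proof.
apply: char_ext => x; have [[t z] <-] := solenoid_proj_surj x.
rewrite charMnE !solenoid_charE -circMn radixS trunc_valS natrD !natrM.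
have N0 : (radix a n)%:R != 0 :> R by exact: radix_neq0.
have a0 : (a n)%:R != 0 :> R by rewrite pnatr_eq0 -lt0n ltnW.
set T := trunc_val z n; set d := digit z n.
have -> : (t - (T%:R + d%:R * (radix a n)%:R)) / ((radix a n)%:R * (a n)%:R) *+ a n
  = (t - T%:R) / (radix a n)%:R - d%:R.
  rewrite -[LHS]mulr_natr; move: N0 a0.
  by move: (radix a n)%:R (a n)%:R => N A N0 A0; field; rewrite N0 A0.
by rewrite circD circN (circ_int R (Posz d)) invr1 mulr1.
Qed.

Lemma solenoid_char_mul_le m n : (m <= n)%N -> exists A, psi m = psi n *+ A.
Proof.
move=> /subnK <-; elim: (n - m)%N => [|k [A IHk]]; first by exists 1%N.
by exists (a (k + m) * A)%N; rewrite mulrnA -solenoid_char_mul.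
Qed.

Lemma near_trunc_val (z : D) n :
  \forall u \near z, trunc_val u n = trunc_val z n.
Proof.
elim: n => [|n IHn]; first by apply: filterE => u; rewrite /trunc_val !big_ord0.
by apply: filterS2 IHn (near_digit z n) => u; rewrite !trunc_valS => -> ->.
Qed.

Lemma trunc_val_sub0 (x z : D) n :
  trunc_val x n = trunc_val z n -> trunc_val (x - z) n = 0%N.
Proof.
move=> xz; have := trunc_valD (x - z) z n.
rewrite -[adic_add _ _]/(x - z + z) subrK xz => /esym/eqP.
rewrite -[X in _ == X](modn_small (trunc_val_lt z n)) -[X in _ == (X %% _)%N]add0n eqn_modDr.
by rewrite mod0n modn_small ?trunc_val_lt // => /eqP.
Qed.

(** [psi 0] forces the real coordinate to be an integer, which the winding subgroup moves to 0; then
    [psi n] forces the residue of the adic coordinate, smaller than the radix, to be divisible by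
    it. *)
Lemma solenoid_char_sep x : (forall n, psi n x = 1) -> x = 0.
Proof.
have [[t z] <-] := solenoid_proj_surj x => h.
have [m tm] : exists m : int, t = m%:~R.
  have := h 0%N; rewrite solenoid_charE /trunc_val /radix !big_ord0 subr0 divr1.
  exact: circ_eq1.
have -> : proj (t, z) = proj (0, z - adic_unit a_gt1 *~ m).
  apply/solenoid_proj_eq; apply/asboolP; exists m.
  rewrite -[LHS]/((t - 0, z - (z - adic_unit a_gt1 *~ m)) : G) subr0 tm.
  by rewrite opprB addrCA subrr addr0.
have {}h n : trunc_val (z - adic_unit a_gt1 *~ m) n = 0%N.
  have := h n; have -> : proj (t, z) = proj (0, z - adic_unit a_gt1 *~ m).
    apply/solenoid_proj_eq; apply/asboolP; exists m.
    rewrite -[LHS]/((t - 0, z - (z - adic_unit a_gt1 *~ m)) : G) subr0 tm.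
    by rewrite opprB addrCA subrr addr0.
  rewrite solenoid_charE; set w := z - _; rewrite sub0r => /circ_eq1[k].
  move/(congr1 (fun u => u * (radix a n)%:R)); rewrite divfK ?radix_neq0 //.
  have lt := trunc_val_lt w n; move=> /eqP.
  case: k => k.
    rewrite -[(Posz k)%:~R]/(k%:R) -natrM eqr_oppLR => /eqP e.
    have : (trunc_val w n)%:R + (k * radix a n)%:R = 0 :> R by rewrite e addNr.
    by rewrite -natrD => /eqP; rewrite pnatr_eq0 addn_eq0 => /andP[/eqP].
  rewrite NegzE mulrNz mulNr eqr_opp -[(Posz k.+1)%:~R]/(k.+1%:R) -natrM eqr_nat => /eqP e.
  by move: lt; rewrite e mulSn -ltn_subRL subnn.
have -> : z - adic_unit a_gt1 *~ m = 0; last exact: solenoid_proj0.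
by apply: trunc_val_inj => n; rewrite h trunc_val0.
Qed.

Lemma adic_proj_continuous : continuous (fun z : D => proj (0, z)).
Proof.
move=> z; apply: (@continuous_comp D G X (fun z => (0, z)) proj z); last exact: proj_continuous.
by apply: (@cvg_pair _ _ _ (nbhs z) (nbhs 0) (nbhs z)); [exact: cvg_cst | exact: cvg_id].
Qed.

Lemma real_proj_continuous : continuous (fun t : R => proj (t, 0)).
Proof.
move=> z; apply: (@continuous_comp R G X (fun z => (z, 0)) proj z); last exact: proj_continuous.
by apply: (@cvg_pair _ _ _ (nbhs z) (nbhs z) (nbhs 0)); [exact: cvg_id | exact: cvg_cst].
Qed.

(** The subgroups [F n] shrink to 0, so by compactness one of them is mapped into the right
    half-plane, where the only subgroup of the circle is trivial. *)
Lemma char_open_subgroup (y : Y) :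
  exists n, forall z : D, trunc_val z n = 0%N -> y (proj (0, z)) = 1.
Proof.
pose F n := [set z : D | trunc_val z n = 0%N].
pose A := [set z : D | 0 < Re (y (proj (0, z)))].
have cy : continuous (fun z : D => y (proj (0, z)) : R[i]^o).
  move=> z; apply: (@continuous_comp D X R[i]^o (fun z => proj (0, z)) y z).
    exact: adic_proj_continuous.
  exact: char_continuous.
have [n FA] : exists n, F n `<=` A.
  apply: compact_decreasing; first exact: adic_compact.
  - move=> n z Fz; have [u [/= Fu uz]] := Fz _ (near_trunc_val z n).
    by rewrite /F /= -uz.
  - by move=> n z; rewrite /F /= trunc_valS => /eqP; rewrite addn_eq0 => /andP[/eqP].
  - rewrite openE => z Az; rewrite /interior.
    exact: (@Re_cvg R D (nbhs z) _ _ _ (cy z) (fun x => 0 < x) (lt_nbhsr Az)).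
  - move=> z Fz; have -> : z = 0 by apply: trunc_val_inj => n; rewrite Fz trunc_val0.
    by rewrite /A /= solenoid_proj0 char_at0.
have FM z m : F n z -> F n (z *+ m).
  rewrite /F /= => z0; elim: m => [|m IHm]; first by rewrite mulr0n trunc_val0.
  by rewrite mulrS [trunc_val _ _]trunc_valD z0 IHm mod0n.
exists n => z Fz; apply: no_small_subgroup; first exact: char_norm.
move=> m; have := FA _ (FM z m Fz); rewrite /A /=.
have -> : proj (0, z *+ m) = proj (0, z) *+ m; last by rewrite char_atMn.
elim: m => [|m IHm]; first by rewrite !mulr0n solenoid_proj0.
rewrite !mulrS -IHm -solenoid_projD.
by rewrite -[(0, z) + _]/((0 + 0, z + z *+ m) : G) addr0.
Qed.

(** If [y] is trivial on the adic integers with n vanishing digits, its restriction to the line has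
    period [radix a n], because that real number represents the same point of X as such an adic
    integer. Every point is the sum of one on the line and one in this subgroup, so the frequency on
    the line determines [y]. *)
Lemma solenoid_dual (y : Y) : exists n (k : int), y = psi n *~ k.
Proof.
have [n yn] := char_open_subgroup y; exists n.
pose c t := y (proj (t, 0)).
have projD0 s t : proj (s + t, 0) = proj (s, 0) + proj (t, 0).
  by rewrite -solenoid_projD -[(s, 0) + _]/((s + t, 0 + 0) : G) addr0.
have N0 : 0 < (radix a n)%:R :> R by rewrite ltr0n radix_gt0.
have [k kE] : exists k : int, forall t, c t = circ (k%:~R / (radix a n)%:R * t).
  apply: circle_hom_periodic => //.
  - by move=> t; exact: char_norm.
  - by move=> s t; rewrite /c projD0 charD.
  - move=> t; apply: (@continuous_comp R X R[i]^o (fun t => proj (t, 0)) y t).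
      exact: real_proj_continuous.
    exact: char_continuous.
  - rewrite /c; have := @proj_winding R a a_gt1 (- (adic_unit a_gt1 *+ radix a n)) 0 (radix a n).
    rewrite add0r addNr => <-; apply: yn.
    rewrite -sub0r; apply: trunc_val_sub0.
    by rewrite adic_unit_mulrn_val modnn trunc_val0.
exists k; apply: char_ext => x; have [[t z] <-] := solenoid_proj_surj x.
rewrite charMzE solenoid_charE -circMz; set T := trunc_val z n.
have -> : proj (t, z) = proj (t - T%:R, 0) + proj (0, z - adic_unit a_gt1 *+ T).
  rewrite (proj_winding 0 (t - T%:R) T) -solenoid_projD add0r subrK.
  rewrite -[(t, _) + _]/((t + 0, adic_unit a_gt1 *+ T + (z - adic_unit a_gt1 *+ T)) : G).
  by rewrite addr0 addrC subrK.
rewrite charD -/(c _) kE yn ?mulr1.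
  by congr circ; rewrite -mulrzl; ring.
apply: trunc_val_sub0.
by rewrite adic_unit_mulrn_val modn_small // trunc_val_lt.
Qed.

End SolenoidDual.

Lemma circ_scale_inj (R : realType) (x y : R) :
  (forall t, circ (x * t) = circ (y * t)) -> x = y.
Proof.
move=> h; apply/eqP; rewrite -subr_eq0; apply/negPn/negP => xy0.
(* At this t the two values differ by the factor [circ (2^-1)] = -1. *)
have := h ((x - y)^-1 * 2^-1) => /(congr1 (fun z => z * circ (- (y * ((x - y)^-1 * 2^-1))))).
rewrite -!circD subrr circ0 -mulrBl mulVKf // circ_half => /eqP.
by rewrite eq_sym -addr_eq0 -mulr2n -mulr_natr mul1r pnatr_eq0.
Qed.

Lemma ratr_frac (R : realType) (k : int) (n : nat) :
  ratr (k%:~R / n%:R) = k%:~R / n%:R :> R.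
Proof. by rewrite rmorphM /= fmorphV /= ratr_int ratr_nat. Qed.

(** * Discreteness of the dual of a compact group *)

Section CompactDual.
Variables (R : realType) (X : topologicalZmodType).
Hypothesis cX : compact [set: X].
Local Notation Y := (character R X).

(** A character within uniform distance 1 of [y] has a quotient by [y] with positive real part
    everywhere, hence trivial. This supplies the continuity clause of [gaussian]. *)
Lemma character_discrete (y : Y) : \forall u \near y, u = y.
Proof.
pose CO := {compact-open, X -> R[i]^o}.
have cF : (@char_fun R X : Y -> CO) @ y --> (@char_fun R X y : CO).
  exact: (@initial_continuous Y CO (@char_fun R X : Y -> CO) y).
have H : {compact-open, nbhs (@char_fun R X y : CO) --> (@char_fun R X y : X -> R[i]^o)}.
  exact: cvg_id.
have FF : Filter (nbhs (@char_fun R X y : CO)) by exact: nbhs_filter.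
have := (@compact_open_fam_compactP X (R[i]^o) (@char_fun R X y) _ (@char_continuous _ _ y) FF).1 H.
move=> /fam_cvgP /(_ _ cX) UH.
have ent : entourage [set xy : R[i]^o * R[i]^o | ball xy.1 1 xy.2].
  exact: (@entourage_ball _ (R[i]^o) (PosNum ltr01)).
have nb : nbhs (@char_fun R X y : {uniform` [set: X] -> R[i]^o})
    [set h | forall x, [set: X] x -> ball (y x : R[i]^o) 1 (h x)].
  by apply/uniform_nbhs; exists [set xy | ball xy.1 1 xy.2]; split=> // h hE x _; exact: (hE x I).
have := cF _ (UH _ nb) => near_u.
apply: (@filterS _ (nbhs y) _ _ _ _ near_u) => u /= hu.
apply/eqP; rewrite -subr_eq0; apply/eqP; apply: char_ext => x; rewrite char0E.
apply: no_small_subgroup; first exact: char_norm.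
move=> m; rewrite -char_atMn charDE charNE.
have := hu (x *+ m) I; rewrite /ball /= => h.
have yn := char_neq0 y (x *+ m).
have h1 : `|1 - u (x *+ m) / y (x *+ m)| < 1.
  have -> : 1 - u (x *+ m) / y (x *+ m) = (y (x *+ m) - u (x *+ m)) / y (x *+ m).
    by rewrite mulrBl divff.
  by rewrite normrM normfV char_norm invr1 mulr1.
have := le_lt_trans (Re_le_norm _) h1; rewrite -[1 in X in _ < X]/(1%:C)%C ltcR ReB /=.
by rewrite ltr_norml => /andP[_]; rewrite ltrBlDr ltrDl.
Qed.

Lemma character_continuous (T : topologicalType) (phi : Y -> T) : continuous phi.
Proof.
move=> y A nA; have := character_discrete y.
by apply: filterS => u uy; rewrite /= uy; exact: (nbhs_singleton nA).
Qed.

End CompactDual.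

(** * The dual as a group of rationals, halving, and evaluation at points *)

Section CharacterRatio.
Variables (R : realType) (a : nat -> nat) (a_gt1 : forall j, (1 < a j)%N).
Local Notation X := (solenoid R a_gt1).
Local Notation Y := (character R X).
Local Notation proj := (@solenoid_proj R a a_gt1).
Local Notation psi := (@solenoid_char R a a_gt1).

(* The rational q identifies the character y with an element of H_a: y restricted
   to the one-parameter subgroup is t |-> exp (2 pi i q t). *)
Definition is_ratio (y : Y) (q : rat) :=
  forall t : R, y (proj (t, 0)) = circ (ratr q * t).

Lemma solenoid_char_ratio n (k : int) : is_ratio (psi n *~ k) (k%:~R / (radix a n)%:R).
Proof.
move=> t; rewrite charMzE solenoid_charE trunc_val0 subr0 -circMz.
by rewrite ratr_frac -mulrzl mulrAC mulrA.
Qed.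

Lemma is_ratio_exists y : exists q, is_ratio y q.
Proof.
have [n [k ->]] := solenoid_dual y.
by exists (k%:~R / (radix a n)%:R); exact: solenoid_char_ratio.
Qed.

Lemma is_ratio_uniq y q q' : is_ratio y q -> is_ratio y q' -> q = q'.
Proof.
move=> yq yq'; apply: (fmorph_inj (@ratr R)); apply: circ_scale_inj => t.
by rewrite -yq -yq'.
Qed.

Definition char_ratio (y : Y) : rat := sval (cid (is_ratio_exists y)).

Lemma char_ratioP y : is_ratio y (char_ratio y).
Proof. exact: (svalP (cid (is_ratio_exists y))). Qed.

Lemma char_ratioE n k : char_ratio (psi n *~ k) = k%:~R / (radix a n)%:R.
Proof. exact: is_ratio_uniq (char_ratioP _) (solenoid_char_ratio n k). Qed.

Fact char_ratio_zmod_morphism : zmod_morphism char_ratio.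
Proof.
move=> u v; apply: is_ratio_uniq (char_ratioP _) _ => t.
by rewrite charDE charNE !char_ratioP rmorphB /= mulrBl circD circN.
Qed.

HB.instance Definition _ := GRing.isZmodMorphism.Build Y rat char_ratio char_ratio_zmod_morphism.

Lemma char_ratio_inj : injective char_ratio.
Proof.
apply: raddf_inj => y; have [n [k ->]] := solenoid_dual y.
rewrite [LHS]char_ratioE => /eqP; rewrite mulf_eq0 invr_eq0 pnatr_eq0.
by rewrite eqn0Ngt radix_gt0 //= orbF intr_eq0 => /eqP ->; rewrite mulr0z.
Qed.

Lemma solenoid_nested (F : nat -> set X) :
  (forall n, closed (F n)) -> (forall n, F n.+1 `<=` F n) ->
  (forall n, exists x, F n x) -> exists x, forall n, F n x.
Proof.
move=> cF dF F0; apply: contrapT => nF.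
have [n Fn0] : exists n, F n `<=` set0.
  apply: (compact_decreasing (@solenoid_compact R a a_gt1) cF dF).
    exact: open0.
  by move=> x Fx; apply: nF; exists x.
by have [x /Fn0] := F0 n.
Qed.

Lemma closed_char_eq (y : Y) (c : R[i]) : closed [set x | y x = c].
Proof.
have cc : closed [set c : R[i]^o].
  exact: (@accessible_closed_set1 (R[i]^o) (hausdorff_accessible (@norm_hausdorff _ _)) c).
exact: (@closed_comp X (R[i]^o) y [set c] (fun x _ => @char_continuous _ _ y x) cc).
Qed.

Lemma solenoid_char_surj n (w : R[i]) (k : int) : `|w| = 1 -> k != 0 ->
  exists x, (psi n *~ k) x = w.
Proof.
move=> /circ_arg[t [-> _ _]] k0; exists (proj (t * (radix a n)%:R / k%:~R, 0)).
rewrite solenoid_char_ratio ratr_frac; congr circ.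
have kr : k%:~R != 0 :> R by rewrite intr_eq0.
by have := radix_neq0 R a_gt1 n => N0; field; rewrite kr N0.
Qed.

Section Halving.
Hypothesis no_order2 : ~ exists x : X, x <> 0 /\ x *+ 2 = 0.

(** If all a_j were odd from N on, the conditions psi (N + n) x = -1 would be compatible, since
    (-1)^(a_j) = -1, and compactness would give such an x. It is nonzero, while 2 x is killed by all
    basic characters. *)
Lemma even_cofinal N : exists2 j, (N <= j)%N & ~~ odd (a j).
Proof.
apply: contrapT => h.
have od j : (N <= j)%N -> odd (a j).
  by move=> Nj; apply: contrapT => /negP oj; apply: h; exists j.
have [x xP] : exists x, forall n, psi (N + n) x = -1.
  apply: (@solenoid_nested (fun n => [set x | psi (N + n) x = -1])).
  - by move=> n; exact: closed_char_eq.
  - move=> n x; rewrite /mkset addnS => e; rewrite solenoid_char_mul charMnE e.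
    by rewrite -signr_odd od ?leq_addr // expr1.
  - move=> n; have [|//|x] := @solenoid_char_surj (N + n) (-1) 1; first by rewrite normrN1.
    by rewrite mulr1z => ?; exists x.
apply: no_order2; exists x; split.
  move=> x0; have := xP 0%N; rewrite x0 char_at0 => /eqP.
  by rewrite -addr_eq0 -mulr2n -mulr_natr mul1r pnatr_eq0.
apply: solenoid_char_sep => n; rewrite char_atMn.
have [A ->] := solenoid_char_mul_le R a_gt1 (leq_addl N n : (n <= N + n)%N).
by rewrite charMnE xP exprAC sqrrN !expr1n.
Qed.

(** A multiple of [psi n] is a multiple of [psi j] for a later even a_j, and [psi j] = a_j
    [psi j.+1] is then visibly a double. *)
Lemma character_half (y : Y) : exists z, y = z + z.
Proof.
have [n [k ->]] := solenoid_dual y.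
have [j nj ej] := even_cofinal n.
have [A ->] := solenoid_char_mul_le R a_gt1 nj.
exists (psi j.+1 *+ ((a j)./2 * A) *~ k).
rewrite solenoid_char_mul -mulrzDl -mulrnDr -mulrnA; congr (_ *+ _ *~ _).
by rewrite -{1}(odd_double_half (a j)) (negbTE ej) add0n -mulnDl addnn.
Qed.

End Halving.

(** Duality: a character of a subgroup S of Y is evaluation at a point. The points that are correct
    on the part of S generated by [psi n] form closed sets decreasing in n; each is nonempty because
    that part is cyclic and a nonzero multiple of [psi n] takes every unitary value. Compactness
    gives a common point. *)
Lemma character_extension (S : Y -> Prop) (chi : Y -> R[i]) :
  S 0 -> (forall u v, S u -> S v -> S (u - v)) ->
  (forall u, S u -> `|chi u| = 1) ->
  (forall u v, S u -> S v -> chi (u + v) = chi u * chi v) ->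
  exists x : X, forall u, S u -> u x = chi u.
Proof.
move=> S0 SB chi1 chiD.
have SN u : S u -> S (- u) by move=> Su; rewrite -sub0r; exact: SB.
have SD u v : S u -> S v -> S (u + v).
  by move=> Su Sv; rewrite -[v]opprK; apply: SB => //; exact: SN.
have chi0 : chi 0 = 1.
  have n0 : chi 0 != 0 by rewrite -normr_gt0 chi1.
  by apply: (mulfI n0); rewrite -chiD // addr0 mulr1.
have SMn u m : S u -> S (u *+ m).
  by move=> Su; elim: m => [|m IHm]; rewrite ?mulr0n // mulrS; exact: SD.
have SM u (m : int) : S u -> S (u *~ m).
  case: m => m Su; first by rewrite -pmulrn; exact: SMn.
  by rewrite NegzE mulrNz -pmulrn; apply: SN; exact: SMn.
have chiN u : S u -> chi (- u) = (chi u)^-1.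
  move=> Su; have n0 : chi u != 0 by rewrite -normr_gt0 chi1.
  by apply: (mulfI n0); rewrite -chiD ?subrr ?chi0 ?divff //; exact: SN.
have chiMn u m : S u -> chi (u *+ m) = chi u ^+ m.
  move=> Su; elim: m => [|m IHm]; first by rewrite mulr0n chi0.
  by rewrite mulrS exprS chiD // ?IHm //; exact: SMn.
have chiM u (m : int) : S u -> chi (u *~ m) = chi u ^ m.
  case: m => m Su; first by rewrite -pmulrn chiMn.
  by rewrite NegzE mulrNz -pmulrn chiN ?chiMn // ?exprnN //; exact: SMn.
pose F n := [set x | forall k : int, S (psi n *~ k) -> (psi n *~ k) x = chi (psi n *~ k)].
have [x xF] : exists x, forall n, F n x.
  apply: solenoid_nested.
  - move=> n; have -> : F n = \bigcap_(k in [set k | S (psi n *~ k)]) [set x | (psi n *~ k) x = chi (psi n *~ k)].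
      by apply/seteqP; split.
    by apply: closed_bigI => k _; exact: closed_char_eq.
  - move=> n x Fx k; rewrite solenoid_char_mul pmulrn -mulrzA; exact: Fx.
  - move=> n.
    (* Either S meets the multiples of [psi n] only in 0 and any point serves, or the least positive
       multiple [d] in S generates them by Euclidean division. *)
    have [[d0 [d0_gt0 Sd0]]|none] := pselect (exists d, (0 < d)%N /\ S (psi n *+ d)); last first.
      exists 0 => k Sk; rewrite char_at0; have [->|k0] := eqVneq k 0; first by rewrite mulr0z chi0.
      exfalso; apply: none; exists `|k|%N; split; first by rewrite absz_gt0.
      rewrite pmulrn; have [k_ge0|k_lt0] := leP 0 k; first by rewrite gez0_abs.
      by rewrite ltz0_abs // mulrNz; exact: SN.
    have ex : exists d, (0 < d)%N && `[< S (psi n *+ d) >].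
      by exists d0; rewrite d0_gt0; apply/asboolP.
    case: (ex_minnP ex) => d /andP[d_gt0 /asboolP Sd] dmin.
    have [x xd] : exists x, (psi n *~ d) x = chi (psi n *~ d).
      by apply: solenoid_char_surj; [apply: chi1; rewrite -pmulrn | rewrite -lt0n].
    exists x => k Sk.
    have kd : k = (k %/ d)%Z * d.
      have := divz_eq k d; set r := (k %% d)%Z => kE.
      suff r0 : r = 0 by rewrite {1}kE r0 addr0.
      have r_ge0 : 0 <= r by apply: modz_ge0; rewrite -lt0n.
      have r_lt : r < d by apply: ltz_pmod.
      have Sr : S (psi n *~ r).
        have -> : r = k - (k %/ d)%Z * d by apply/eqP; rewrite eq_sym subr_eq addrC; apply/eqP.
        rewrite mulrzBr; apply: SB => //; rewrite mulrC mulrzA; apply: SM.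
        by rewrite -pmulrn.
      case: r r_ge0 r_lt Sr {kE} => // r _ r_lt Sr.
      have [->//|r_gt0] := posnP r.
      have := dmin r; rewrite r_gt0 /=.
      have -> : `[< S (psi n *+ r) >] by apply/asboolP; rewrite pmulrn.
      by move=> /(_ isT); rewrite leqNgt -ltz_nat r_lt.
    have Sd' : S (psi n *~ d) by rewrite -pmulrn.
    by rewrite kd [(k %/ d)%Z * _]mulrC mulrzA charMzE xd (chiM (psi n *~ d)).
exists x => u Su; have [n [k uE]] := solenoid_dual u.
by rewrite uE; apply: xF; rewrite -uE.
Qed.

End CharacterRatio.

(** * Measures on the solenoid and their characteristic functions *)

Section ComplexIntegral.
Context {d} {T : measurableType d} {R : realType}.
Local Notation Re := (@complex.Re R).
Local Notation Im := (@complex.Im R).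
Implicit Types (h k : T -> R[i]).

(** It has the same body as [char_function], so [char_function mu y] and [cintegral mu y] are
    convertible, and it also accepts measures not packed as probabilities. *)
Definition cintegral (mu : {measure set T -> \bar R}) h : R[i] :=
  (Rintegral mu setT (fun x => Re (h x)) +i*
   Rintegral mu setT (fun x => Im (h x)))%C.

Definition bounded_measurable h := [/\ measurable_fun setT (fun x => Re (h x)),
  measurable_fun setT (fun x => Im (h x)) &
  exists M : R, forall x, `|h x| <= M%:C%C].

Lemma bounded_measurableD h k : bounded_measurable h -> bounded_measurable k -> bounded_measurable (fun x => h x + k x).
Proof.
move=> [rh ih [M hM]] [rk ik [N kN]]; split.
- rewrite (_ : (fun x => _) = (fun x => Re (h x) + Re (k x))); last first.
    by apply/funext => x; rewrite ReD.
  exact: measurable_funD.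
- rewrite (_ : (fun x => _) = (fun x => Im (h x) + Im (k x))); last first.
    by apply/funext => x; case: (h x) (k x) => [? ?] [].
  exact: measurable_funD.
- exists (M + N) => x; apply: le_trans (ler_normD _ _) _.
  by rewrite rmorphD; exact: lerD.
Qed.

Lemma bounded_measurableM h k : bounded_measurable h -> bounded_measurable k -> bounded_measurable (fun x => h x * k x).
Proof.
move=> [rh ih [M hM]] [rk ik [N kN]]; split.
- rewrite (_ : (fun x => _) = (fun x => Re (h x) * Re (k x) - Im (h x) * Im (k x))); last first.
    by apply/funext => x; case: (h x) (k x) => [? ?] [].
  by apply: measurable_funB; exact: measurable_funM.
- rewrite (_ : (fun x => _) = (fun x => Re (h x) * Im (k x) + Im (h x) * Re (k x))); last first.
    by apply/funext => x; case: (h x) (k x) => [? ?] [].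
  by apply: measurable_funD; exact: measurable_funM.
- exists (M * N) => x; rewrite normrM rmorphM; exact: ler_pM.
Qed.

Lemma bounded_measurable_cst c : bounded_measurable (fun=> c).
Proof.
split; [exact: measurable_cst | exact: measurable_cst |].
by exists (Normc.normc c) => x.
Qed.

Lemma bounded_measurable_sum (I : Type) (s : seq I) (h : I -> T -> R[i]) :
  (forall i, bounded_measurable (h i)) -> bounded_measurable (fun x => \sum_(i <- s) h i x).
Proof.
move=> bh; elim: s => [|i s IHs].
  by under eq_fun do rewrite big_nil; exact: bounded_measurable_cst.
by under eq_fun do rewrite big_cons; exact: bounded_measurableD.
Qed.

Section Linear.
Variable mu : {measure set T -> \bar R}.
Hypothesis mu1 : mu setT = 1%E.

Lemma bounded_measurable_integrable (f : T -> R) (M : R) :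
  measurable_fun setT f -> (forall x, `|f x| <= M) ->
  mu.-integrable setT (EFin \o f).
Proof.
move=> mf fM; apply: measurable_bounded_integrable => //; first by rewrite mu1 ltry.
exists M; split; first exact: num_real.
by move=> N MN x _; exact: le_trans (fM x) (ltW MN).
Qed.

Lemma bounded_measurable_Re h : bounded_measurable h -> mu.-integrable setT (EFin \o (fun x => Re (h x))).
Proof.
move=> [rh _ [M hM]]; apply: (@bounded_measurable_integrable _ M) => // x.
by rewrite -lecR; exact: le_trans (Re_le_norm _) (hM x).
Qed.

Lemma bounded_measurable_Im h : bounded_measurable h -> mu.-integrable setT (EFin \o (fun x => Im (h x))).
Proof.
move=> [_ ih [M hM]]; apply: (@bounded_measurable_integrable _ M) => // x.
by rewrite -lecR; exact: le_trans (Im_le_norm _) (hM x).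
Qed.

Lemma eq_cintegral h k : h =1 k -> cintegral mu h = cintegral mu k.
Proof. by move=> /funext ->. Qed.

Lemma cintegralD h k : bounded_measurable h -> bounded_measurable k ->
  cintegral mu (fun x => h x + k x) = cintegral mu h + cintegral mu k.
Proof.
move=> bh bk; rewrite /cintegral; have [rh ih] := (bounded_measurable_Re bh, bounded_measurable_Im bh).
have [rk ik] := (bounded_measurable_Re bk, bounded_measurable_Im bk).
rewrite -[RHS]/((_ + _) +i* (_ + _))%C -!RintegralD //.
congr (_ +i* _)%C; apply: eq_Rintegral => x _; first by rewrite ReD.
by case: (h x) (k x) => [? ?] [].
Qed.

Lemma cintegralZ c h : bounded_measurable h -> cintegral mu (fun x => c * h x) = c * cintegral mu h.
Proof.
move=> bh; have [rh ih] := (bounded_measurable_Re bh, bounded_measurable_Im bh).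
have iZ (a : R) (f : T -> R) : mu.-integrable setT (EFin \o f) ->
    mu.-integrable setT (EFin \o (fun x => a * f x)).
  by move=> fi; exact: (@integrableZl _ _ _ mu setT measurableT a (EFin \o f)).
case: c => u v; rewrite /cintegral mulCE -!RintegralZl //.
rewrite -RintegralB ?iZ // -RintegralD ?iZ //.
by congr (_ +i* _)%C; apply: eq_Rintegral => x _; case: (h x) => ? ?.
Qed.

Lemma cintegral_cst c : cintegral mu (fun=> c) = c.
Proof. by rewrite /cintegral !Rintegral_cst // mu1 /= !mulr1; case: c. Qed.

Lemma cintegral_sum (I : Type) (s : seq I) (h : I -> T -> R[i]) :
  (forall i, bounded_measurable (h i)) ->
  cintegral mu (fun x => \sum_(i <- s) h i x) = \sum_(i <- s) cintegral mu (h i).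
Proof.
move=> bh; elim: s => [|i s IHs].
  by under eq_cintegral do rewrite big_nil; rewrite cintegral_cst big_nil.
under eq_cintegral do rewrite big_cons.
by rewrite cintegralD ?IHs ?big_cons //; exact: bounded_measurable_sum.
Qed.

Lemma cintegral_conj h : bounded_measurable h -> cintegral mu (fun x => (h x)^*) = (cintegral mu h)^*.
Proof.
move=> bh; have ih := bounded_measurable_Im bh.
transitivity ((Rintegral mu setT (fun x => Re (h x)) +i*
   (- Rintegral mu setT (fun x => Im (h x))))%C); last by [].
rewrite -[- _]mulN1r -RintegralZl //.
by congr (_ +i* _)%C; apply: eq_Rintegral => x _; case: (h x) => ? ? //=; rewrite mulN1r.
Qed.

Lemma cintegral_ge0 h : (forall x, 0 <= h x) -> 0 <= cintegral mu h.
Proof.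
move=> h0; rewrite lecE /=; apply/andP; split.
  rewrite (_ : (fun x => _) = cst 0) ?Rintegral_cst ?mul0r //.
  by apply/funext => x; have := h0 x; rewrite lecE => /andP[/eqP].
apply: Rintegral_ge0 => x _.
by have := h0 x; rewrite lecE => /andP[].
Qed.

End Linear.
Lemma cintegral_eq_ae (mu nu : {measure set T -> \bar R}) h :
  (forall A, measurable A -> mu A = nu A) -> cintegral mu h = cintegral nu h.
Proof.
by move=> e; rewrite /cintegral /Rintegral; congr (fine _ +i* fine _)%C;
  apply: eq_measure_integral => A mA _; exact: e.
Qed.

End ComplexIntegral.

Section ComplexTransfer.
Context {d d'} {T : measurableType d} {T' : measurableType d'} {R : realType}.
Local Notation Re := (@complex.Re R).
Local Notation Im := (@complex.Im R).
Variables (mu : probability T R) (phi : {mfun T >-> T'}).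

Lemma bounded_measurable_comp (h : T' -> R[i]) : bounded_measurable h -> bounded_measurable (fun x => h (phi x)).
Proof.
move=> [rh ih [M hM]]; split; last by exists M.
  exact: (measurableT_comp rh).
exact: (measurableT_comp ih).
Qed.

Lemma cintegral_distribution (h : T' -> R[i]) : bounded_measurable h ->
  cintegral (distribution mu phi) h = cintegral mu (fun x => h (phi x)).
Proof.
move=> bh; have [rh ih _] := bh.
have bhp := bounded_measurable_comp bh.
rewrite /cintegral /Rintegral; congr (fine _ +i* fine _)%C.
  rewrite integral_distribution //; first exact/measurable_EFinP.
  exact: (bounded_measurable_Re (probability_setT mu) bhp).
rewrite integral_distribution //; first exact/measurable_EFinP.
exact: (bounded_measurable_Im (probability_setT mu) bhp).
Qed.

End ComplexTransfer.

Section ComplexProduct.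
Context {d d'} {T : measurableType d} {T' : measurableType d'} {R : realType}.
Local Notation Re := (@complex.Re R).
Local Notation Im := (@complex.Im R).
Variables (mu : probability T R) (nu : probability T' R).

Lemma product_prob_setT : (mu \x nu)%E setT = 1%E.
Proof.
rewrite -setXTT product_measure1E // -[X in (X * _)%E]/(mu setT) -[X in (_ * X)%E]/(nu setT).
by rewrite !probability_setT mule1.
Qed.

Lemma cintegral_prod (h : T -> R[i]) (k : T' -> R[i]) : bounded_measurable h -> bounded_measurable k ->
  cintegral (mu \x nu)%E (fun p => h p.1 * k p.2) = cintegral mu h * cintegral nu k.
Proof.
move=> bh bk.
have prodR (f : T -> R) (g : T' -> R) (M N : R) : measurable_fun setT f -> measurable_fun setT g ->
   (forall x, `|f x| <= M) -> (forall x, `|g x| <= N) ->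
   (mu \x nu)%E.-integrable setT (EFin \o (fun p => f p.1 * g p.2)) /\
   Rintegral (mu \x nu)%E setT (fun p => f p.1 * g p.2) =
   Rintegral mu setT f * Rintegral nu setT g.
  move=> mf mg fM gN.
  have int : (mu \x nu)%E.-integrable setT (EFin \o (fun p => f p.1 * g p.2)).
    apply: (@bounded_measurable_integrable _ _ _ _ product_prob_setT _ (M * N)).
      apply: measurable_funM.
        exact: (measurableT_comp mf measurable_fst).
      exact: (measurableT_comp mg measurable_snd).
    by move=> p; rewrite normrM ler_pM.
  split=> //; rewrite {1}/Rintegral -integral12_prod_meas1 //=.
  have ig : nu.-integrable setT (EFin \o g).
    exact: (bounded_measurable_integrable (probability_setT nu) mg gN).
  have if_ : mu.-integrable setT (EFin \o f).
    exact: (bounded_measurable_integrable (probability_setT mu) mf fM).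
  under eq_integral => x _.
    rewrite /fubini_F /=.
    have -> : (\int[nu]_y (f x * g y)%:E = (f x * Rintegral nu setT g)%:E)%E.
      rewrite EFinM /Rintegral fineK ?integrable_fin_num //.
      by rewrite -integralZl //; apply: eq_integral => y _; rewrite EFinM.
    over.
  by rewrite -/(Rintegral mu setT _) RintegralZr.
have [rh ih [M hM]] := bh; have [rk ik [N kN]] := bk.
have rM x : `|Re (h x)| <= M by rewrite -lecR; exact: le_trans (Re_le_norm _) (hM x).
have iM x : `|Im (h x)| <= M by rewrite -lecR; exact: le_trans (Im_le_norm _) (hM x).
have rN x : `|Re (k x)| <= N by rewrite -lecR; exact: le_trans (Re_le_norm _) (kN x).
have iN x : `|Im (k x)| <= N by rewrite -lecR; exact: le_trans (Im_le_norm _) (kN x).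
have [i1 e1] := prodR _ _ _ _ rh rk rM rN.
have [i2 e2] := prodR _ _ _ _ ih ik iM iN.
have [i3 e3] := prodR _ _ _ _ rh ik rM iN.
have [i4 e4] := prodR _ _ _ _ ih rk iM rN.
rewrite [RHS]mulCE -e1 -e2 -e3 -e4 -RintegralB // -RintegralD //.
by congr (_ +i* _)%C; apply: eq_Rintegral => p _; case: (h p.1) (k p.2) => [? ?] [].
Qed.

End ComplexProduct.

(** * Polynomial approximation of the indicator of a half-line *)

Section Threshold.
Variable R : realType.

Lemma bernoulli_ge (x : R) n : -1 <= x -> 1 + x *+ n <= (1 + x) ^+ n.
Proof.
move=> x1; elim: n => [|n IHn]; first by rewrite mulr0n addr0 expr0.
have x0 : 0 <= 1 + x by lra.
rewrite exprS; apply: le_trans (ler_wpM2l x0 IHn).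
rewrite mulrS -mulr_natr; have : 0 <= x * x * n%:R by rewrite mulr_ge0 // -expr2 sqr_ge0.
by nra.
Qed.

(** For s = (1 + r) / 2 one has r <= s^2; Bernoulli's inequality for 1/s bounds n s^n, and the other
    factor s^n tends to 0. *)
Lemma cvg_nat_geometric (r : R) : 0 <= r < 1 -> (fun n => n%:R * r ^+ n) @ \oo --> (0 : R).
Proof.
move=> /andP[r0 r1]; pose s := (1 + r) / 2.
have s0 : 0 < s by rewrite /s; lra.
have s1 : s < 1 by rewrite /s; lra.
have rs : r <= s * s by rewrite /s; have := sqr_ge0 (1 - r); rewrite expr2; lra.
pose C := (s^-1 - 1)^-1.
have sV : 0 < s^-1 - 1 by rewrite subr_gt0 invf_gt1.
have nC n : n%:R * s ^+ n <= C.
  rewrite -[C]mul1r ler_pdivlMr // mulrAC mulrC.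
  have := @bernoulli_ge (s^-1 - 1) n _; rewrite addrCA subrr addr0 => /(_ _).
  have sn : 0 < s ^+ n by rewrite exprn_gt0.
  move=> h; have {}h : 1 + (s^-1 - 1) *+ n <= s^-1 ^+ n by apply: h; lra.
  apply: (@le_trans _ _ (s ^+ n * s^-1 ^+ n)); last by rewrite exprVn divff // gt_eqF.
  rewrite ler_pM2l //; apply: le_trans h; rewrite mulr_natl; lra.
apply: (@squeeze_cvgr _ _ _ _ (cst 0) (fun n => C * s ^+ n)).
- apply: nearW => n; rewrite mulr_ge0 ?exprn_ge0 ?ler0n //=.
  apply: (@le_trans _ _ (n%:R * (s ^+ n * s ^+ n))).
    by rewrite ler_wpM2l // -exprMn lerXn2r // nnegrE mulr_ge0 // ltW.
  by rewrite mulrA ler_wpM2r // exprn_ge0 // ltW.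
- exact: cvg_cst.
- by apply: (@cvg_geometric R C s); rewrite gtr0_norm.
Qed.

(* A polynomial that approximates the indicator function of s < 1/2 on [0, 1]. *)
Definition threshold_poly n (s : R) := (1 - s ^+ n) ^+ (n * 2 ^ n).

Lemma threshold_poly_itv n (s : R) : 0 <= s <= 1 -> 0 <= threshold_poly n s <= 1.
Proof.
move=> /andP[s0 s1]; have h : 0 <= 1 - s ^+ n by rewrite subr_ge0 exprn_ile1.
by rewrite exprn_ge0 // exprn_ile1 // gerBl exprn_ge0.
Qed.

(** The exponent n 2^n suits both sides: for s < 1/2 Bernoulli bounds the polynomial below by 1 - n
    (2 s)^n, and for s >= 1/2 one has (1 - 2^-n)^(2^n) <= 1/2, so the polynomial is at most 2^-n. *)
Lemma threshold_poly_cvg (s : R) : 0 <= s <= 1 ->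
  (fun n => threshold_poly n s) @ \oo --> (((s < 2^-1)%R)%:R : R).
Proof.
move=> s01; have /andP[s0 s1] := s01.
have [sh|hs] := ltP s 2^-1.
  apply: (@squeeze_cvgr _ _ _ _ (fun n => 1 - n%:R * (2 * s) ^+ n) (cst 1)).
  - apply: nearW => n; have /andP[_ ->] := threshold_poly_itv n s01.
    rewrite andbT; apply: le_trans (@bernoulli_ge (- s ^+ n) (n * 2 ^ n) _); last first.
      by rewrite lerN2 exprn_ile1.
    have -> : (- s ^+ n) *+ (n * 2 ^ n) = - (n%:R * (2 * s) ^+ n).
      by rewrite -[LHS]mulr_natr natrM natrX exprMn; ring.
    exact: lexx.
  - rewrite -[X in _ --> X]subr0; apply: (@cvgB _ R); first exact: cvg_cst.
    by apply: cvg_nat_geometric; lra.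
  - exact: cvg_cst.
apply: (@squeeze_cvgr _ _ _ _ (cst 0) (fun n => 2^-1 ^+ n)); last 2 first.
- exact: cvg_cst.
- by apply: cvg_expr; rewrite ger0_norm ?invr_ge0 // invf_lt1 // ltr1n.
apply: nearW => n; have /andP[-> _] := threshold_poly_itv n s01.
rewrite /= /threshold_poly mulnC exprM; have sn0 : 0 <= 1 - s ^+ n by rewrite subr_ge0 exprn_ile1.
apply: lerXn2r; rewrite ?nnegrE ?exprn_ge0 ?invr_ge0 //.
pose x : R := 2^-1 ^+ n.
have x0 : 0 < x by rewrite exprn_gt0 // invr_gt0.
have sx : 1 - s ^+ n <= 1 - x by rewrite lerB // lerXn2r // nnegrE invr_ge0.
have h : 1 - s ^+ n <= (1 + x)^-1.
  apply: le_trans sx _; rewrite -[leRHS]mul1r ler_pdivlMr; last by lra.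
  by have := sqr_ge0 x; rewrite expr2; lra.
apply: le_trans (_ : (1 + x)^-1 ^+ (2 ^ n) <= _).
  by apply: lerXn2r => //; rewrite nnegrE invr_ge0; lra.
rewrite exprVn lef_pV2 ?posrE ?exprn_gt0 //; last by lra.
apply: le_trans (@bernoulli_ge x (2 ^ n) _); last by lra.
have -> : x *+ 2 ^ n = 1 by rewrite -[LHS]mulr_natr natrX /x -exprMn mulVf // expr1n.
by lra.
Qed.

End Threshold.

(** * Generation of the Borel sets by half-planes of characters *)

Section BorelSolenoid.
Variables (R : realType) (a : nat -> nat) (a_gt1 : forall j, (1 < a j)%N).
Local Notation X := (solenoid R a_gt1).
Local Notation Y := (character R X).
Local Notation psi := (@solenoid_char R a a_gt1).
Local Notation Re := (@complex.Re R).
Local Notation Im := (@complex.Im R).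

(** Lists make the family a pi-system: intersection is concatenation, and the empty list gives the
    whole space. *)
Definition halfplanes (s : seq (R[i] * Y * R)) : set X :=
  [set x : X | all (fun i : R[i] * Y * R => i.2 < Re (i.1.1 * i.1.2 x)) s].

Definition halfplane_sets : set (set X) := range halfplanes.

Lemma halfplane_setI_closed : setI_closed halfplane_sets.
Proof.
move=> _ _ [s _ <-] [t _ <-]; exists (s ++ t) => //.
by apply/seteqP; split => x; rewrite /halfplanes /= all_cat => /andP.
Qed.

Lemma halfplane_sets_setT : halfplane_sets setT.
Proof. by exists [::] => //; apply/seteqP; split. Qed.

Lemma open_solenoid_measurable (A : set X) : open A -> measurable A.
Proof. exact: sub_sigma_algebra. Qed.

Lemma char_Re_continuous (y : Y) : continuous (fun x => Re (y x)).
Proof.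
move=> x; exact: (@Re_cvg R X (nbhs x) _ y (y x) (@char_continuous _ _ y x)).
Qed.

Lemma char_Im_continuous (y : Y) : continuous (fun x => Im (y x)).
Proof.
move=> x; exact: (@Im_cvg R X (nbhs x) _ y (y x) (@char_continuous _ _ y x)).
Qed.

Definition ratbox (p : rat * rat * rat * rat) : set R[i] :=
  [set z | [/\ ratr p.1.1.1 < Re z, Re z < ratr p.1.1.2,
     ratr p.1.2 < Im z & Im z < ratr p.2]].

Definition ratboxes (s : seq (rat * rat * rat * rat)) : set X :=
  \bigcap_(m in [set m | (m < size s)%N]) [set x | ratbox (nth (0, 0, 0, 0) s m) (psi m x)].

Definition near_box (z : R[i]) (e : R) : set R[i] :=
  [set w | `|Re w - Re z| <= e /\ `|Im w - Im z| <= e].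

Lemma ratbox_dense (z : R[i]) (e : R) : 0 < e ->
  exists p, ratbox p z /\ ratbox p `<=` near_box z e.
Proof.
move=> e0.
have between (x : R) : exists p q : rat, [/\ x - e < ratr p, ratr p < x, x < ratr q & ratr q < x + e].
  have l1 : x - e < x by rewrite gtrBl.
  have l2 : x < x + e by rewrite ltrDl.
  have [p] := rat_in_itvoo l1; have [q] := rat_in_itvoo l2.
  rewrite !in_itv /= => /andP[? ?] /andP[? ?].
  by exists p, q.
have [p1 [q1 [a1 a2 a3 a4]]] := between (Re z).
have [p2 [q2 [b1 b2 b3 b4]]] := between (Im z).
exists (p1, q1, p2, q2); split=> // w [/= c1 c2 c3 c4].
by split; rewrite ler_norml; apply/andP; split; lra.
Qed.

(** Finite lists of rational boxes being countable, this is second countability of X. The sets [F n]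
    of points close to x on the first basic characters are closed and decrease to x because the
    basic characters separate points; compactness puts one of them inside U. *)
Lemma solenoid_basis (U : set X) (x : X) : open U -> U x ->
  exists s, ratboxes s x /\ ratboxes s `<=` U.
Proof.
move=> oU Ux.
pose F n := [set x' | forall m, (m <= n)%N -> near_box (psi m x) n.+1%:R^-1 (psi m x')].
have closed_near (f : X -> R) (u e : R) : continuous f -> closed [set x' | `|f x' - u| <= e].
  move=> cf.
  have -> : [set x' | `|f x' - u| <= e] = f @^-1` `[u - e, u + e].
    by apply/seteqP; split => y /=; rewrite in_itv /= ler_distl.
  by apply: closed_comp => [y _|]; [exact: cf | exact: interval_closed].
have [n FU] : exists n, F n `<=` U.
  apply: (compact_decreasing (@solenoid_compact R a a_gt1)) => //.
  - move=> n; have -> : F n = \bigcap_(m in [set m | (m <= n)%N])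
        ([set x' | `|Re (psi m x') - Re (psi m x)| <= n.+1%:R^-1] `&`
         [set x' | `|Im (psi m x') - Im (psi m x)| <= n.+1%:R^-1]).
      by apply/seteqP; split.
    apply: closed_bigI => m _; apply: closedI; apply: closed_near.
      exact: char_Re_continuous.
    exact: char_Im_continuous.
  - move=> n y Fy m mn; have [h1 h2] := Fy m (leqW mn).
    have h : n.+2%:R^-1 <= n.+1%:R^-1 :> R by rewrite lef_pV2 ?posrE ?ltr0n // ler_nat.
    by split; [exact: le_trans h1 h | exact: le_trans h2 h].
  - move=> y Fy; suff -> : y = x by [].
    apply/eqP; rewrite -subr_eq0; apply/eqP; apply: solenoid_char_sep => m.
    rewrite char_atB; suff -> : psi m y = psi m x by rewrite divff ?char_neq0.
    have small (u : R) : (forall n, (m <= n)%N -> `|u| <= n.+1%:R^-1) -> u = 0.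
      move=> hu; apply/eqP; rewrite -normr_le0 leNgt; apply/negP => u0.
      pose n := maxn m (Num.truncn `|u|^-1).
      have := hu n (leq_maxl _ _); rewrite leNgt => /negP; apply.
      rewrite invf_plt ?posrE ?ltr0n //.
      have ip : 0 <= `|u|^-1 by rewrite invr_ge0.
      have /andP[_ h] := truncn_itv ip; apply: lt_le_trans h _.
      by rewrite ler_nat ltnS leq_maxr.
    have /eqP : Re (psi m y) - Re (psi m x) = 0.
      by apply: small => n mn; have [] := Fy n m mn.
    rewrite subr_eq0 => e1.
    have /eqP : Im (psi m y) - Im (psi m x) = 0.
      by apply: small => n mn; have [] := Fy n m mn.
    rewrite subr_eq0 => e2.
    by apply/eqP; rewrite eq_complex e1 e2.
have e0 : 0 < n.+1%:R^-1 :> R by rewrite invr_gt0.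
pose b m := sval (cid (ratbox_dense (psi m x) e0)).
have bP m : ratbox (b m) (psi m x) /\ ratbox (b m) `<=` near_box (psi m x) n.+1%:R^-1.
  exact: (svalP (cid (ratbox_dense (psi m x) e0))).
exists (mkseq b n.+1); split.
  by move=> m; rewrite /mkset size_mkseq => mn; rewrite nth_mkseq //; exact: (bP m).1.
move=> y yb; apply: FU => m mn; apply: (bP m).2.
by have := yb m; rewrite /mkset size_mkseq ltnS nth_mkseq //; apply.
Qed.

Lemma open_halfplanes s : open (halfplanes s).
Proof.
rewrite openE => x; rewrite /halfplanes /interior /=.
elim: s => [|[[w y] c] s IHs] /=; first by move=> _; apply: (@filterE _ (nbhs x)).
move=> /andP[cx sx].
have cy : (fun x => Re (w * y x)) @ x --> Re (w * y x).
  apply: (@Re_cvg R X (nbhs x) _ (fun x => w * y x)).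
  by apply: cvgM; [exact: cvg_cst | exact: char_continuous].
have := cy (fun u => c < u) (lt_nbhsr cx).
rewrite nbhs_simpl => near_c.
apply: (@filterS2 _ (nbhs x) _ _ _ _ _ near_c (IHs sx)) => z /= cz sz.
by apply/andP.
Qed.

Lemma measurable_solenoidE : @measurable _ X = <<s halfplane_sets >>.
Proof.
apply/seteqP; split; last first.
  apply: smallest_sub; first exact: smallest_sigma_algebra.
  by move=> _ [s _ <-]; apply: sub_sigma_algebra; exact: open_halfplanes.
apply: smallest_sub; first exact: smallest_sigma_algebra.
move=> U oU.
pose T' := g_sigma_algebraType halfplane_sets.
have half_meas w (y : Y) c : @measurable _ T' [set x | c < Re (w * y x)].
  apply: sub_sigma_algebra; exists [:: (w, y, c)] => //.
  by apply/seteqP; split => x; rewrite /halfplanes /= andbT.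
have box_meas s : @measurable _ T' (ratboxes s).
  apply: bigcap_measurableType => m _; move: (nth _ _ _) => [[[p1 q1] p2] q2].
  pose H w c : set T' := [set x | c < Re (w * psi m x)].
  have -> : [set x | ratbox (p1, q1, p2, q2) (psi m x)] =
    (* The factors 1, -1, -i and i turn the four bounds on real and imaginary part into half-planes
       c < Re (w z). *)
    (H 1 (ratr p1) `&` H (-1) (- ratr q1)) `&`
    (H (0 -i* 1)%C (ratr p2) `&` H (0 +i* 1)%C (- ratr q2)).
    have E z : ratbox (p1, q1, p2, q2) z <->
        (ratr p1 < Re (1 * z) /\ - ratr q1 < Re (- 1 * z)) /\
        (ratr p2 < Re ((0 -i* 1)%C * z) /\ - ratr q2 < Re ((0 +i* 1)%C * z)).
      case: z => u v; rewrite /ratbox mul1r mulN1r !mulCE /=.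
      rewrite !(mul1r, mul0r, mulNr, sub0r, opprK, ltrN2).
      by split=> [[? ? ? ?]|[[? ?] [? ?]]].
    by apply/seteqP; split=> x; [exact: (E _).1 | exact: (E _).2].
  by apply: measurableI; apply: measurableI; exact: half_meas.
suff : @measurable _ T' U by [].
have -> : U = \bigcup_(s : seq (rat * rat * rat * rat))
    (if `[< ratboxes s `<=` U >] then ratboxes s else set0).
  apply/seteqP; split=> [x Ux|x [s _]].
    have [s [sx sU]] := solenoid_basis oU Ux; exists s => //.
    by case: asboolP.
  by case: asboolP => // sU; exact: sU.
apply: countable_bigcupT_measurable => // s.
by case: ifP => _; [exact: box_meas | exact: measurable0].
Qed.

Lemma bounded_measurable_char (y : Y) : bounded_measurable (y : X -> R[i]).
Proof.
have cm (f : X -> R) : continuous f -> measurable_fun [set: X] f.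
  move=> cf; apply: (measurability _ (RGenOInfty.measurableE R)).
  move=> _ [_ [c ->] <-]; rewrite setTI; apply: open_solenoid_measurable.
  by apply: open_comp => [x _|]; [exact: cf | exact: interval_open].
split.
- by apply: cm; exact: char_Re_continuous.
- by apply: cm; exact: char_Im_continuous.
- by exists 1 => x; rewrite char_norm.
Qed.

(** As half-planes generate, measurability into X is tested on characters. This gives measurability
    of addition for the product sigma-algebra without comparing it with the Borel one. *)
Lemma measurable_to_solenoid d (T : measurableType d) (F : T -> X) :
  (forall y : Y, bounded_measurable (fun t => y (F t))) -> measurable_fun setT F.
Proof.
move=> bF; apply: (measurability halfplane_sets); first exact: measurable_solenoidE.
move=> _ [_ [s _ <-] <-]; rewrite setTI /halfplanes.
elim: s => [|[[w y] c] s IHs].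
  by rewrite (_ : _ @^-1` _ = setT); [exact: measurableT | apply/seteqP; split].
rewrite (_ : _ @^-1` _ = [set t | c < Re (w * y (F t))] `&`
   (F @^-1` [set x : X | all (fun i : R[i] * Y * R => i.2 < Re (i.1.1 * i.1.2 x)) s])).
  apply: measurableI => //.
  have [mR _ _] := bounded_measurableM (bounded_measurable_cst w) (bF y).
  rewrite (_ : [set t | _] = [set: T] `&` ((fun t => Re (w * y (F t))) @^-1` `]c, +oo[)).
    by apply: mR.
  by rewrite setTI; apply/seteqP; split=> t /=; rewrite in_itv /= andbT.
by apply/seteqP; split=> t /= /andP.
Qed.

End BorelSolenoid.

(** * The uniqueness theorem for characteristic functions *)

Section CharacteristicFunction.
Variables (R : realType) (a : nat -> nat) (a_gt1 : forall j, (1 < a j)%N).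
Local Notation X := (solenoid R a_gt1).
Local Notation Y := (character R X).
Local Notation Re := (@complex.Re R).

Definition trig_poly (h : X -> R[i]) :=
  exists s : seq (R[i] * Y), forall x, h x = \sum_(i <- s) i.1 * i.2 x.

Lemma trig_poly_cst c : trig_poly (fun=> c).
Proof. by exists [:: (c, 0)] => x; rewrite big_seq1 char0E mulr1. Qed.

Lemma trig_poly_char y : trig_poly (y : Y).
Proof. by exists [:: (1, y)] => x; rewrite big_seq1 mul1r. Qed.

Lemma trig_polyD h k : trig_poly h -> trig_poly k -> trig_poly (fun x => h x + k x).
Proof.
by move=> [s hs] [t kt]; exists (s ++ t) => x; rewrite big_cat /= hs kt.
Qed.

Lemma trig_polyM h k : trig_poly h -> trig_poly k -> trig_poly (fun x => h x * k x).
Proof.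
move=> [s hs] [t kt].
exists [seq (p.1.1 * p.2.1, p.1.2 + p.2.2) | p <- [seq (i, j) | i <- s, j <- t]] => x.
rewrite hs kt big_distrlr /= big_map big_allpairs; apply: eq_bigr => i _.
by apply: eq_bigr => j _ /=; rewrite mulrACA.
Qed.

Lemma trig_polyX h n : trig_poly h -> trig_poly (fun x => h x ^+ n).
Proof.
move=> th; elim: n => [|n IHn].
  by under eq_fun do rewrite expr0; exact: trig_poly_cst.
by under eq_fun do rewrite exprS; exact: trig_polyM.
Qed.

Lemma eq_trig_poly h k : h =1 k -> trig_poly h -> trig_poly k.
Proof. by move=> /funext ->. Qed.

Lemma bounded_measurable_trig_poly h : trig_poly h -> bounded_measurable h.
Proof.
move=> [s hs]; rewrite (_ : h = fun x => \sum_(i <- s) i.1 * i.2 x); last exact/funext.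
apply: bounded_measurable_sum => i; apply: bounded_measurableM; first exact: bounded_measurable_cst.
exact: bounded_measurable_char.
Qed.

Lemma cintegral_trig_poly (mu nu : probability X R) h :
  (forall y, char_function mu y = char_function nu y) -> trig_poly h ->
  cintegral mu h = cintegral nu h.
Proof.
move=> mn [s hs]; rewrite (_ : h = fun x => \sum_(i <- s) i.1 * i.2 x); last exact/funext.
have b (i : R[i] * Y) : bounded_measurable (fun x : X => i.1 * i.2 x).
  by apply: bounded_measurableM; [exact: bounded_measurable_cst | exact: bounded_measurable_char].
rewrite (cintegral_sum (probability_setT mu) s b) (cintegral_sum (probability_setT nu) s b).
apply: eq_bigr => i _; have bc := bounded_measurable_char i.2.
rewrite (cintegralZ (probability_setT mu) _ bc) (cintegralZ (probability_setT nu) _ bc).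
by congr (_ * _); exact: mn.
Qed.

(* The affine change of variable sends the half-plane c < Re (w y) to s < 1/2. *)
Definition halfplane_level (i : R[i] * Y * R) (x : X) : R :=
  2^-1 - (Re (i.1.1 * i.1.2 x) - i.2) / ((Normc.normc i.1.1 + `|i.2|) *+ 2 + 1).

Lemma halfplane_level_itv i x : 0 <= halfplane_level i x <= 1.
Proof.
case: i => [[w y] c]; rewrite /halfplane_level /=.
set K := Normc.normc w + `|c|; set u := Re _ - c.
have uK : `|u| <= K.
  apply: le_trans (ler_normB _ _) _; apply: lerD => //.
  rewrite -lecR; apply: le_trans (Re_le_norm _) _.
  by rewrite normrM char_norm mulr1.
have K0 : 0 <= K by apply: le_trans uK.
have D0 : 0 < K *+ 2 + 1 by rewrite ltr_wpDl // mulrn_wge0.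
move: uK; rewrite ler_norml => /andP[u1 u2].
have h1 : u / (K *+ 2 + 1) <= 2^-1 by rewrite ler_pdivrMr //; lra.
have h2 : - 2^-1 <= u / (K *+ 2 + 1) by rewrite ler_pdivlMr //; lra.
by apply/andP; split; lra.
Qed.

Lemma halfplane_level_lt i x :
  (halfplane_level i x < 2^-1) = (i.2 < Re (i.1.1 * i.1.2 x)).
Proof.
case: i => [[w y] c]; rewrite /halfplane_level /=.
rewrite gtrBl pmulr_lgt0 ?subr_gt0 // invr_gt0 ltr_wpDl // mulrn_wge0 // addr_ge0 //.
by case: w => ? ? /=; rewrite sqrtr_ge0.
Qed.

Lemma trig_poly_halfplane_level i : trig_poly (fun x => (halfplane_level i x)%:C%C).
Proof.
case: i => [[w y] c]; rewrite /halfplane_level /=.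
set D : R := _ + 1.
apply: (@eq_trig_poly (fun x => (2^-1 + c / D)%:C%C +
   (- (2^-1 / D)%:C%C) * (w * y x + w^* * (- y) x))).
  move=> x; rewrite charNE char_conj -rmorphM /=.
  set z := w * y x.
  have -> : z + z^* = (Re z *+ 2)%:C%C.
    by case: z => u v; rewrite -[LHS]/((u + u) +i* (v - v))%C subrr -mulr2n.
  rewrite mulNr -rmorphM -rmorphB /=; congr (_%:C)%C.
  have [->|D0] := eqVneq D 0; first by rewrite !invr0 !mulr0; lra.
  by field.
apply: trig_polyD; first exact: trig_poly_cst.
apply: trig_polyM; first exact: trig_poly_cst.
by apply: trig_polyD; apply: trig_polyM; (try exact: trig_poly_cst); exact: trig_poly_char.
Qed.

Definition halfplanes_poly s n (x : X) : R :=
  \prod_(i <- s) threshold_poly n (halfplane_level i x).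

Lemma trig_poly_halfplanes_poly s n :
  trig_poly (fun x => (halfplanes_poly s n x)%:C%C).
Proof.
rewrite /halfplanes_poly; elim: s => [|i s IHs].
  by under eq_fun do rewrite big_nil; exact: trig_poly_cst.
under eq_fun do rewrite big_cons rmorphM /=; apply: trig_polyM IHs.
apply: (@eq_trig_poly (fun x => (1 + (-1) * ((halfplane_level i x)%:C%C) ^+ n) ^+ (n * 2 ^ n))).
  move=> x; rewrite /threshold_poly; move: (halfplane_level i x) => u.
  by rewrite mulN1r -[1]/(1%:C)%C -rmorphXn -rmorphB -rmorphXn.
apply: trig_polyX; apply: trig_polyD; first exact: trig_poly_cst.
apply: trig_polyM; first exact: trig_poly_cst.
by apply: trig_polyX; exact: trig_poly_halfplane_level.
Qed.

Lemma halfplanes_poly_itv s n x : 0 <= halfplanes_poly s n x <= 1.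
Proof.
rewrite /halfplanes_poly; elim: s => [|i s IHs]; first by rewrite big_nil ler01 lexx.
rewrite big_cons; have /andP[h1 h2] := threshold_poly_itv n (halfplane_level_itv i x).
have /andP[h3 h4] := IHs.
by rewrite mulr_ge0 //= mulr_ile1.
Qed.

Lemma halfplanes_poly_cvg s x :
  (fun n => halfplanes_poly s n x) @ \oo --> (\1_(halfplanes s) x : R).
Proof.
rewrite /halfplanes_poly; elim: s => [|i s IHs].
  under eq_fun do rewrite big_nil.
  rewrite indicE mem_set //; exact: cvg_cst.
under eq_fun do rewrite big_cons.
have -> : \1_(halfplanes (i :: s)) x = (halfplane_level i x < 2^-1)%R%:R * \1_(halfplanes s) x :> R.
  rewrite !indicE halfplane_level_lt -natrM mulnb; congr (nat_of_bool _)%:R.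
  by apply/idP/andP => [/set_mem/= /andP[-> ?]|[h /set_mem ?]]; [split=> //|]; apply/mem_set => //=; apply/andP.
apply: cvgM IHs; apply: threshold_poly_cvg; exact: halfplane_level_itv.
Qed.

Lemma Rintegral_halfplanes_cvg (mu : probability X R) s :
  Re (cintegral mu (fun x => (halfplanes_poly s n x)%:C%C)) @[n --> \oo] -->
  fine (mu (halfplanes s)).
Proof.
have mH : measurable (halfplanes s : set X) by apply: open_solenoid_measurable; exact: open_halfplanes.
have mp n : measurable_fun setT (halfplanes_poly s n).
  by have [] := bounded_measurable_trig_poly (trig_poly_halfplanes_poly s n).
have [] := @dominated_convergence _ X R mu setT measurableT
  (fun n x => (halfplanes_poly s n x)%:E) (fun x => (\1_(halfplanes s) x)%:E) (cst 1%E).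
- by move=> n; exact/measurable_EFinP.
- by apply/measurable_EFinP; exact: measurable_indic.
- apply: aeW => x _; apply: cvg_EFin; first exact: nearW.
  exact: halfplanes_poly_cvg.
- exact: finite_measure_integrable_cst.
- apply: aeW => x n _; have /andP[h1 h2] := halfplanes_poly_itv s n x.
  by rewrite /= lee_fin ger0_norm.
move=> _ _; rewrite integral_indic // setIT.
have finE : mu (halfplanes s) = (fine (mu (halfplanes s)))%:E by rewrite fineK ?fin_num_measure.
rewrite [X in _ --> X -> _]finE => h; apply: cvg_trans (fine_cvg h).
by apply: near_eq_cvg; apply: nearW => n; rewrite /cintegral.
Qed.

(** The measure of a set of half-planes is, by dominated convergence, a limit of integrals of
    trigonometric polynomials, which the characteristic function determines; these sets form a
    generating pi-system. *)
Lemma solenoid_measure_unique (mu nu : probability X R) :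
  (forall y, char_function mu y = char_function nu y) ->
  forall A, measurable A -> mu A = nu A.
Proof.
move=> mn A mA.
apply: (@measure_unique _ R X (@halfplane_sets R a a_gt1) (fun=> setT) _ _ _ _ mu nu) => //.
- exact: measurable_solenoidE.
- exact: halfplane_setI_closed.
- by move=> _; exact: halfplane_sets_setT.
- exact: bigcup_const.
- move=> _ [s _ <-].
  have mH : measurable (halfplanes s : set X) by apply: open_solenoid_measurable; exact: open_halfplanes.
  rewrite -[LHS]fineK ?fin_num_measure // -[RHS]fineK ?fin_num_measure //; congr EFin.
  have h2 := @Rintegral_halfplanes_cvg nu s.
  have E : (fun n => Re (cintegral mu (fun x => (halfplanes_poly s n x)%:C%C))) =
           (fun n => Re (cintegral nu (fun x => (halfplanes_poly s n x)%:C%C))).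
    by apply/funext => n; rewrite (cintegral_trig_poly mn (trig_poly_halfplanes_poly _ _)).
  rewrite -E in h2.
  have h1 := @Rintegral_halfplanes_cvg mu s.
  by rewrite -(cvg_lim _ h1) // (cvg_lim _ h2).
- by move=> _; rewrite [X in (X < _)%E](@probability_setT _ _ _ mu) ltry.
Qed.

End CharacteristicFunction.

Section Packing.
Context {d d'} {T : measurableType d} {T' : measurableType d'} {R : realType}.

Definition pack_mfun (F : T -> T') (mF : measurable_fun setT F) : {mfun T >-> T'} :=
  mfun_Sub (mem_set mF).

Lemma pack_mfunE (F : T -> T') (mF : measurable_fun setT F) x : pack_mfun mF x = F x.
Proof. by []. Qed.

Variables (mu : probability T R) (nu : probability T' R).

Definition product_prob : probability (T * T')%type R :=
  HB.pack (mu \x nu)%E (Measure_isProbability.Build _ _ _ (mu \x nu)%E (product_prob_setT mu nu)).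

End Packing.

(** * Convolution, positive definiteness and Krein's inequality *)

Section Convolution.
Variables (R : realType) (a : nat -> nat) (a_gt1 : forall j, (1 < a j)%N).
Local Notation X := (solenoid R a_gt1).
Local Notation Y := (character R X).

Lemma solenoid_add_measurable : measurable_fun setT (fun p : X * X => p.1 + p.2).
Proof.
apply: measurable_to_solenoid => y.
rewrite (_ : (fun t => _) = (fun p : X * X => y p.1 * y p.2)); last first.
  by apply/funext => p; rewrite charD.
apply: bounded_measurableM.
  exact: (bounded_measurable_comp (pack_mfun measurable_fst) (bounded_measurable_char y)).
exact: (bounded_measurable_comp (pack_mfun measurable_snd) (bounded_measurable_char y)).
Qed.

Definition convolution_prob (mu nu : probability X R) : probability X R :=
  distribution (product_prob mu nu) (pack_mfun solenoid_add_measurable).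

Lemma char_convolution mu nu y : char_function (convolution_prob mu nu) y =
  char_function mu y * char_function nu y.
Proof.
rewrite -[LHS]/(cintegral (convolution_prob mu nu) y) cintegral_distribution; last exact: bounded_measurable_char.
rewrite -[RHS]/(cintegral mu y * cintegral nu y) -cintegral_prod; try exact: bounded_measurable_char.
rewrite -[LHS]/(cintegral (mu \x nu)%E _); apply: eq_cintegral => p.
by rewrite pack_mfunE charD.
Qed.

(** [convolution] is a bare set function, convertible with that of [convolution_prob]; every
    factorization is proved through this form. *)
Lemma convolution_unique (rho mu nu : probability X R) :
  (forall y, char_function rho y = char_function mu y * char_function nu y) ->
  forall A, measurable A -> rho A = convolution mu nu A.
Proof.
move=> h A mA; rewrite -[RHS]/(convolution_prob mu nu A).
by apply: solenoid_measure_unique => // y; rewrite char_convolution.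
Qed.

(** The form is the integral of the squared modulus of the trigonometric polynomial [h]. *)
Lemma char_function_pd (mu : probability X R) n (c : 'I_n -> R[i]) (y : 'I_n -> Y) :
  0 <= \sum_i \sum_j c i * (c j)^* * char_function mu (y i - y j).
Proof.
pose h x := \sum_i c i * y i x.
have bh i : bounded_measurable (fun x => c i * y i x) by apply: bounded_measurableM; [exact: bounded_measurable_cst | exact: bounded_measurable_char].
have -> : \sum_i \sum_j c i * (c j)^* * char_function mu (y i - y j) =
    cintegral mu (fun x => h x * (h x)^*).
  rewrite (_ : (fun x => _) = fun x => \sum_i \sum_j (c i * (c j)^*) * (y i - y j) x); last first.
    apply/funext => x; rewrite /h rmorph_sum big_distrlr.
    apply: eq_bigr => i _; apply: eq_bigr => j _.
    by rewrite rmorphM charDE charNE char_conj mulrACA.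
  have bi i j : bounded_measurable (fun x => (c i * (c j)^*) * (y i - y j) x).
    by apply: bounded_measurableM; [exact: bounded_measurable_cst | exact: bounded_measurable_char].
  rewrite (cintegral_sum (probability_setT mu)); last by move=> i; exact: bounded_measurable_sum.
  apply: eq_bigr => i _; rewrite (cintegral_sum (probability_setT mu) _ (bi i)).
  by apply: eq_bigr => j _; rewrite (cintegralZ (probability_setT mu) _ (bounded_measurable_char _)).
by apply: cintegral_ge0 => x; rewrite mul_conjC_ge0.
Qed.

Lemma char_function0 (mu : probability X R) : char_function mu 0 = 1.
Proof. exact: (cintegral_cst (probability_setT mu) 1). Qed.

Lemma char_functionN (mu : probability X R) y :
  char_function mu (- y) = (char_function mu y)^*.
Proof.
rewrite -[RHS](cintegral_conj (probability_setT mu) (bounded_measurable_char y)).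
by apply: eq_cintegral => x; rewrite charNE char_conj.
Qed.

(** Krein's inequality is positive definiteness at the points u + h, u, 0 with coefficients 1, - f
    h, - B, where B = f (u + h) - f u f h: the form then equals 1 - |f h|^2 - |B|^2. *)
Lemma char_function_char_like (mu : probability X R) :
  (forall y, char_function mu y != 0) -> char_like (char_function mu).
Proof.
move=> n0; split; [exact: char_function0 | exact: char_functionN | exact: n0 |].
set f := char_function mu => u h.
set B := f (u + h) - f u * f h.
pose c (i : 'I_3) : R[i] := nth 0 [:: 1; - f h; - B] i.
pose y (i : 'I_3) : Y := nth 0 [:: u + h; u; 0] i.
have := char_function_pd mu c y; rewrite -/f.
rewrite !big_ord_recl !big_ord0 /c /y /= /bump /= !addr0 -/f.
rewrite !subrr sub0r sub0r subr0 subr0 [u + h - u]addrAC subrr add0r.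
have -> : u - (u + h) = - h by rewrite opprD addrA subrr add0r.
have f0 : f 0 = 1 by exact: char_function0.
have fN v : f (- v) = (f v)^* by exact: char_functionN.
rewrite !fN f0 !rmorphN rmorph1 !normCK => pd.
rewrite -subr_ge0; apply: le_trans pd _.
rewrite le_eqVlt; apply/orP; left; apply/eqP.
have -> : f (u + h) = B + f u * f h by rewrite /B subrK.
generalize B => b; rewrite !(rmorphD, rmorphM) /=; ring.
Qed.

End Convolution.

(** * The functional equation of the linear forms *)

Section Adjoint.
Variables (R : realType) (X : topologicalZmodType) (h : X -> X).
Hypotheses (mh : zmod_morphism h) (ch : continuous h).
Local Notation Y := (character R X).

Lemma zmod_morphism0 : h 0 = 0.
Proof. by rewrite -[X in h X](subrr 0) mh subrr. Qed.

Lemma zmod_morphismD x x' : h (x + x') = h x + h x'.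
Proof.
have hN z : h (- z) = - h z by rewrite -sub0r mh zmod_morphism0 sub0r.
by rewrite -[x' in LHS]opprK mh hN opprK.
Qed.

Fact adjoint_norm (y : Y) x : `|y (h x)| = 1. Proof. exact: char_norm. Qed.

Fact adjointD (y : Y) x x' : y (h (x + x')) = y (h x) * y (h x').
Proof. by rewrite zmod_morphismD charD. Qed.

Fact adjoint_continuous (y : Y) : continuous ((fun x => y (h x)) : X -> R[i]^o).
Proof.
move=> x; apply: (@continuous_comp X X R[i]^o h y x); first exact: ch.
exact: char_continuous.
Qed.

Definition adjoint (y : Y) : Y :=
  Character (adjoint_norm y) (adjointD y) (adjoint_continuous (y := y)).

Lemma adjointE y x : adjoint y x = y (h x). Proof. by []. Qed.

Fact adjoint_zmod_morphism : zmod_morphism adjoint.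
Proof. by move=> u v; apply: char_ext => x. Qed.

HB.instance Definition _ :=
  GRing.isZmodMorphism.Build Y Y adjoint adjoint_zmod_morphism.

End Adjoint.

Section HeydeOnSolenoid.
Variables (R : realType) (a : nat -> nat) (a_gt1 : forall j, (1 < a j)%N).
Local Notation X := (solenoid R a_gt1).
Local Notation Y := (character R X).
Local Notation psi := (@solenoid_char R a a_gt1).
Local Notation ratio := (@char_ratio R a a_gt1).

Lemma char_ratio_solenoid_char0 : ratio (psi 0%N) = 1.
Proof. by rewrite -[psi 0%N]mulr1z char_ratioE /radix big_ord0 divr1. Qed.

(** [psi 0] has ratio 1, so by commensurability an endomorphism of Y is multiplication by the ratio
    of the image of [psi 0]. *)
Lemma char_ratio_additive (T : {additive Y -> Y}) y :
  ratio (T y) = ratio (T (psi 0%N)) * ratio y.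
Proof.
pose phi y := ratr (ratio (T y)) : R.
have zm : zmod_morphism phi by move=> u v; rewrite /phi !raddfB.
pose phi' : {additive Y -> R} := HB.pack phi (GRing.isZmodMorphism.Build _ _ _ zm).
have E : ratr (ratio (psi 0%N)) * phi y = ratr (ratio y) * phi (psi 0%N).
  exact: (additive_proportional (@char_ratio_inj R a a_gt1) phi' (psi 0%N) y).
apply: (fmorph_inj (@ratr R)); rewrite rmorphM /= mulrC.
by rewrite -/(phi (psi 0%N)) -E char_ratio_solenoid_char0 rmorph1 mul1r.
Qed.

Section Symmetry.
Variables (d : measure_display) (Om : measurableType d) (P : probability Om R).
Variables (xi1 xi2 : {mfun Om >-> X}) (alpha : X -> X).
Hypotheses (malpha : zmod_morphism alpha) (calpha : continuous alpha).
Hypothesis xi_indep : independent_RV P xi1 xi2.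
Hypothesis L_sym : symmetric_conditional P (fun w => xi1 w + xi2 w)
                                     (fun w => xi1 w + alpha (xi2 w)).
Local Notation al := (adjoint (R := R) malpha calpha).

Lemma independent_expectation (u v : Y) :
  cintegral P (fun w => u (xi1 w) * v (xi2 w)) =
  char_function (distribution P xi1) u * char_function (distribution P xi2) v.
Proof.
pose Z := pack_mfun (measurable_fun_pair (measurable_funPT xi1) (measurable_funPT xi2)).
have bh : bounded_measurable (fun p : X * X => u p.1 * v p.2).
  apply: bounded_measurableM.
    exact: (bounded_measurable_comp (pack_mfun measurable_fst) (bounded_measurable_char u)).
  exact: (bounded_measurable_comp (pack_mfun measurable_snd) (bounded_measurable_char v)).
rewrite -[LHS](cintegral_distribution P Z bh).
rewrite -[RHS]/(cintegral (distribution P xi1) u * cintegral (distribution P xi2) v).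
rewrite -cintegral_prod; try exact: bounded_measurable_char.
apply: cintegral_eq_ae => A mA; apply/esym.
apply: (@product_measure_unique _ _ _ _ _ (distribution P xi1) (distribution P xi2)
  (distribution P Z)) => //.
Qed.

(** Symmetry equates the expectations of u (L1) v (L2) and u (L1) v (- L2). Regrouped by variables
    the first integrand is (u + v)(xi1) (u + al v)(xi2), and independence factors its expectation;
    the second is the same with - v. *)
Lemma heyde_char_function :
  heyde al (char_function (distribution P xi1))
           (char_function (distribution P xi2)).
Proof.
move=> u v.
have bL1 (y : Y) : bounded_measurable (fun w => y (xi1 w + xi2 w)).
  rewrite (_ : (fun w => _) = (fun w => y (xi1 w) * y (xi2 w))); last first.
    by apply/funext => w; rewrite charD.
  by apply: bounded_measurableM; apply: bounded_measurable_comp; exact: bounded_measurable_char.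
have bL2 (y : Y) : bounded_measurable (fun w => y (xi1 w + alpha (xi2 w))).
  rewrite (_ : (fun w => _) = (fun w => y (xi1 w) * (al y) (xi2 w))); last first.
    by apply/funext => w; rewrite charD.
  by apply: bounded_measurableM; apply: bounded_measurable_comp; exact: bounded_measurable_char.
have bL2N (y : Y) : bounded_measurable (fun w => y (- (xi1 w + alpha (xi2 w)))).
  rewrite (_ : (fun w => _) = (fun w => (- y) (xi1 w + alpha (xi2 w)))); first exact: bL2.
  by apply/funext => w; rewrite char_atN.
pose Z := pack_mfun (measurable_fun_pair (measurable_to_solenoid bL1) (measurable_to_solenoid bL2)).
pose W := pack_mfun (measurable_fun_pair (measurable_to_solenoid bL1) (measurable_to_solenoid bL2N)).
have bh : bounded_measurable (fun p : X * X => u p.1 * v p.2).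
  apply: bounded_measurableM.
    exact: (bounded_measurable_comp (pack_mfun measurable_fst) (bounded_measurable_char u)).
  exact: (bounded_measurable_comp (pack_mfun measurable_snd) (bounded_measurable_char v)).
have E : cintegral (distribution P Z) (fun p : X * X => u p.1 * v p.2) =
         cintegral (distribution P W) (fun p : X * X => u p.1 * v p.2).
  by apply: cintegral_eq_ae => A mA; exact: L_sym.
rewrite !cintegral_distribution // in E.
rewrite -!independent_expectation.
transitivity (cintegral P (fun x => u (Z x).1 * v (Z x).2)).
  apply: eq_cintegral => w; rewrite -[(Z w).1]/(xi1 w + xi2 w) -[(Z w).2]/(xi1 w + alpha (xi2 w)).
  by rewrite !charD !charDE; exact: mulrACA.
rewrite E; apply: eq_cintegral => w.
rewrite -[(W w).1]/(xi1 w + xi2 w) -[(W w).2]/(- (xi1 w + alpha (xi2 w))).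
by rewrite char_atN !charD !charDE !charNE invfM; exact: mulrACA.
Qed.

End Symmetry.

Lemma dirac_char (x : X) y : char_function (dirac x) y = y x.
Proof.
rewrite /char_function /Rintegral !integral_dirac ?diracT ?mul1e //=.
- by case: (y x).
- by apply/measurable_EFinP; have [] := bounded_measurable_char y.
- by apply/measurable_EFinP; have [] := bounded_measurable_char y.
Qed.

(* The image of omega under I + alpha has the characteristic function of the
   Dirac mass at 0. *)
Lemma kernel_concentrated (alpha : X -> X) (malpha : zmod_morphism alpha)
    (calpha : continuous alpha) (omega : probability X R) :
  (forall k, char_function omega (k + adjoint malpha calpha k) = 1) ->
  omega [set x | x + alpha x = 0] = 1%E.
Proof.
move=> o1.
have bT (y : Y) : bounded_measurable (fun x : X => y (x + alpha x)).
  rewrite (_ : (fun w => _) = (y + adjoint malpha calpha y : Y)); first exact: bounded_measurable_char.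
  by apply/funext => w; rewrite charD.
pose T := pack_mfun (measurable_to_solenoid bT).
have m0 : measurable [set (0 : X)].
  rewrite -[X in measurable X]setCK; apply: measurableC.
  apply: open_solenoid_measurable; apply: closed_openC.
  have -> : [set (0 : X)] = \bigcap_(n in setT) [set x | psi n x = 1].
    apply/seteqP; split=> [_ -> n _|x x1]; first exact: char_at0.
    by apply: solenoid_char_sep => n; exact: x1.
  by apply: closed_bigI => n _; exact: closed_char_eq.
have D : distribution omega T [set (0 : X)] = dirac (0 : X) [set (0 : X)].
  apply: (@solenoid_measure_unique R a a_gt1 _ (dirac (0 : X))) => // y.
  rewrite dirac_char char_at0 -(o1 y).
  rewrite -[LHS]/(cintegral (distribution omega T) y) cintegral_distribution; last exact: bounded_measurable_char.
  by apply: eq_cintegral => x; rewrite -[T x]/(x + alpha x) charD.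
by rewrite -[LHS]/(distribution omega T [set (0 : X)]) D diracE mem_set.
Qed.

End HeydeOnSolenoid.

(** * Existence of Gaussian distributions *)

Section GaussianFourier.
Variable R : realType.
Local Notation mu := (@lebesgue_measure R).
Implicit Types (t l th : R).

Definition gauss_kernel t := expR (- (t ^+ 2 / 2)).

Lemma gauss_kernel_normal_fun t : normal_fun 0 1 t = gauss_kernel t.
Proof. by rewrite /normal_fun subr0 expr1n mulNr. Qed.

Lemma integrable_gauss_kernel : mu.-integrable setT (EFin \o gauss_kernel).
Proof.
have p0 : normal_peak (1 : R) != 0 by rewrite gt_eqF // normal_peak_gt0 // oner_eq0.
rewrite (_ : EFin \o gauss_kernel = (fun x => (normal_peak (1 : R))^-1%:E * (normal_pdf 0 1 x)%:E)%E).
  by apply: integrableZl => //; exact: integrable_normal_pdf.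
apply/funext => t; rewrite /normal_pdf oner_eq0 -EFinM mulKf // gauss_kernel_normal_fun //.
Qed.

Lemma continuous_gauss_kernel : continuous gauss_kernel.
Proof.
move=> t; apply: (continuous_comp (f := fun t => - (t ^+ 2 / 2)) (g := expR)); last exact: continuous_expR.
by apply: cvgN; apply: cvgM; [exact: exprn_continuous | exact: cvg_cst].
Qed.

(** From |t| <= 1 + t^2 / 4 <= exp (t^2 / 4) the function is at most exp (- t^2 / 4), the
    unnormalized normal density of variance 2; hence s = sqrt 2. *)
Lemma integrable_abs_gauss_kernel : mu.-integrable setT (EFin \o (fun t => `|t| * gauss_kernel t)).
Proof.
pose s : R := Num.sqrt 2.
have s2 : s ^+ 2 = 2 by rewrite sqr_sqrtr.
have s0 : s != 0 by rewrite gt_eqF // sqrtr_gt0.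
have p0 : normal_peak s != 0 by rewrite gt_eqF // normal_peak_gt0.
have i4 : mu.-integrable setT (fun x => (normal_peak s)^-1%:E * (normal_pdf 0 s x)%:E)%E.
  by apply: integrableZl => //; exact: integrable_normal_pdf.
apply: (le_integrable _ _ _ i4) => //.
  apply/measurable_EFinP; apply: measurable_funM => //.
  by apply: continuous_measurable_fun; exact: continuous_gauss_kernel.
move=> t _ /=; rewrite lee_fin /normal_pdf (negbTE s0) mulKf //.
rewrite [leRHS]ger0_norm ?normal_fun_ge0 //.
rewrite [leLHS]ger0_norm ?mulr_ge0 ?expR_ge0 //.
rewrite /normal_fun subr0 s2 /gauss_kernel.
have -> : - (t ^+ 2 / 2) = - (t ^+ 2 / 4) - t ^+ 2 / 4 by field.
have -> : - t ^+ 2 / (2 *+ 2) = - (t ^+ 2 / 4) by field.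
rewrite expRD mulrCA ger_pMr ?expR_gt0 // expRN ler_pdivrMr ?expR_gt0 // mul1r.
apply: le_trans (expR_ge1Dx _).
have := sqr_ge0 (`|t| / 2 - 1); rewrite -(real_normK (num_real t)); lra.
Qed.

(** The phase [th] treats both parts of the Fourier transform at once: 0 gives the cosine, - pi / 2
    the sine. *)
Definition kernel_cos l th t := gauss_kernel t * cos (l * t + th).
Definition kernel_sin l th t := gauss_kernel t * sin (l * t + th).

Lemma is_derive_gauss_kernel t : is_derive t 1 gauss_kernel (- t * gauss_kernel t).
Proof.
rewrite /gauss_kernel; have H : is_derive t 1 (fun t => - (t ^+ 2 / 2)) (- t).
  apply: is_derive_eq; rewrite /GRing.scale /=; lra.
have := @is_derive1_comp R expR (fun t => - (t ^+ 2 / 2)) t _ _ (is_derive_expR _) H.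
by move=> h; apply: is_derive_eq; rewrite mulrC.
Qed.

Lemma is_derive_phase (f df : R -> R) l th t :
  (forall x : R, is_derive x (1 : R) f (df x)) ->
  is_derive t (1 : R) (fun t => f (l * t + th)) (l * df (l * t + th)).
Proof.
move=> fd; have H : is_derive t 1 (fun t => l * t + th) l.
  by apply: is_derive_eq; rewrite /GRing.scale /= addr0 mulr1.
have := @is_derive1_comp R f (fun t => l * t + th) t _ _ (fd _) H.
by move=> h; apply: is_derive_eq; rewrite mulrC.
Qed.

Lemma is_derive_kernel_sin l th t :
  is_derive t 1 (kernel_sin l th) (l * kernel_cos l th t - t * kernel_sin l th t).
Proof.
rewrite /kernel_sin /kernel_cos.
have h1 := is_derive_gauss_kernel t.
have h2 := @is_derive_phase sin cos l th t (fun x => is_derive_sin x).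
have := @is_deriveM R R gauss_kernel (fun t => sin (l * t + th)) t 1 _ _ h1 h2.
move=> h; apply: is_derive_eq; rewrite /GRing.scale /=; ring.
Qed.

Lemma is_derive_param l th t :
  is_derive l 1 (fun l => kernel_cos l th t) (- t * kernel_sin l th t).
Proof.
rewrite /kernel_sin /kernel_cos.
have h2 : is_derive l 1 (fun l => cos (l * t + th)) (t * - sin (l * t + th)).
  have := @is_derive_phase cos (fun x => - sin x) t th l (fun x => is_derive_cos x).
  by rewrite (_ : (fun t0 => cos (t * t0 + th)) = (fun l => cos (l * t + th))) ?[t * l]mulrC //; apply/funext => x; rewrite mulrC.
have := @is_deriveM R R (fun=> gauss_kernel t) (fun l => cos (l * t + th)) l 1 _ _ (is_derive_cst _ _ _) h2.
move=> h; apply: is_derive_eq; rewrite /GRing.scale /=; ring.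
Qed.

Lemma continuous_phase (f : R -> R) l th : continuous f -> continuous (fun t => f (l * t + th)).
Proof.
move=> cf t; apply: (@continuous_comp R R R (fun t => l * t + th) f); last exact: cf.
by apply: cvgD; [apply: cvgM; [exact: cvg_cst | exact: cvg_id] | exact: cvg_cst].
Qed.

Lemma continuous_kernel_cos l th : continuous (kernel_cos l th).
Proof.
by move=> t; apply: cvgM; [exact: continuous_gauss_kernel | exact: (@continuous_phase cos l th (@continuous_cos R) t)].
Qed.

Lemma continuous_kernel_sin l th : continuous (kernel_sin l th).
Proof.
by move=> t; apply: cvgM; [exact: continuous_gauss_kernel | exact: (@continuous_phase sin l th (@continuous_sin R) t)].
Qed.

Lemma kernel_cos_le l th t : `|kernel_cos l th t| <= gauss_kernel t.
Proof.
rewrite normrM ger0_norm ?expR_ge0 // ger_pMr ?expR_gt0 //.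
by rewrite ler_norml cos_geN1 cos_le1.
Qed.

Lemma kernel_sin_le l th t : `|kernel_sin l th t| <= gauss_kernel t.
Proof.
rewrite normrM ger0_norm ?expR_ge0 // ger_pMr ?expR_gt0 //.
by rewrite ler_norml sin_geN1 sin_le1.
Qed.

Lemma integrable_kernel_cos l th : mu.-integrable setT (EFin \o kernel_cos l th).
Proof.
apply: (le_integrable _ _ _ integrable_gauss_kernel) => //.
  by apply/measurable_EFinP; apply: continuous_measurable_fun; exact: continuous_kernel_cos.
move=> t _; rewrite /comp lee_fin [leRHS]ger0_norm ?expR_ge0 //; exact: kernel_cos_le.
Qed.

Lemma integrable_mul_kernel_sin l th : mu.-integrable setT (EFin \o (fun t => t * kernel_sin l th t)).
Proof.
apply: (le_integrable _ _ _ integrable_abs_gauss_kernel) => //.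
  apply/measurable_EFinP; apply: measurable_funM => //.
  by apply: continuous_measurable_fun; exact: continuous_kernel_sin.
move=> t _; rewrite /comp lee_fin [leRHS]ger0_norm ?mulr_ge0 ?expR_ge0 //.
by rewrite normrM ler_wpM2l // kernel_sin_le.
Qed.

(** The derivative of [kernel_sin l th] in t. Its vanishing integral over the line is the
    integration by parts behind the differential equation of the transform. *)
Definition kernel_flux l th t := l * kernel_cos l th t - t * kernel_sin l th t.

Lemma continuous_kernel_flux l th : continuous (kernel_flux l th).
Proof.
move=> t; apply: cvgB; apply: cvgM; [exact: cvg_cst|exact: continuous_kernel_cos|exact: cvg_id|exact: continuous_kernel_sin].
Qed.

Lemma integrable_kernel_flux l th : mu.-integrable setT (EFin \o kernel_flux l th).
Proof.
have i1 : mu.-integrable setT (fun t => l%:E * (kernel_cos l th t)%:E)%E.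
  by apply: integrableZl => //; exact: integrable_kernel_cos.
have := integrableB measurableT i1 (integrable_mul_kernel_sin l th).
by apply: eq_integrable => // t _; rewrite /comp /kernel_flux EFinB EFinM.
Qed.

Lemma integral_kernel_flux_bounded l th (n : R) : 0 < n ->
  (\int[mu]_(t in `[(- n)%R, n]) (kernel_flux l th t)%:E = (kernel_sin l th n - kernel_sin l th (- n))%:E)%E.
Proof.
move=> n0; apply: continuous_FTC2.
- by rewrite gtrN.
- by apply: continuous_subspaceT; exact: continuous_kernel_flux.
- split.
  + by move=> x _; case: (is_derive_kernel_sin l th x).
  + by apply: cvg_at_right_filter; exact: continuous_kernel_sin.
  + by apply: cvg_at_left_filter; exact: continuous_kernel_sin.
- by move=> x _; rewrite derive1E; exact: (@derive_val _ _ _ _ _ _ _ (is_derive_kernel_sin l th x)).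
Qed.

Lemma gauss_kernel_small n : gauss_kernel n <= (1 + n ^+ 2 / 2)^-1.
Proof.
rewrite /gauss_kernel expRN lef_pV2 ?posrE ?expR_gt0 //; first exact: expR_ge1Dx.
by rewrite ltr_pwDl // divr_ge0 // sqr_ge0.
Qed.

Lemma integral_kernel_flux l th : (\int[mu]_t (kernel_flux l th t)%:E = 0)%E.
Proof.
pose D (n : nat) : set R := `[- n.+1%:R, n.+1%:R]%classic.
pose fn (n : nat) := (EFin \o kernel_flux l th) \_ (D n).
have mg : measurable_fun setT (EFin \o kernel_flux l th).
  by apply/measurable_EFinP; apply: continuous_measurable_fun; exact: continuous_kernel_flux.
have mf n : measurable_fun setT (fn n).
  by apply/(measurable_restrictT _ _).1; [exact: measurable_itv | exact: (measurable_funTS mg)].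
have dom : {ae mu, forall t, forall n, setT t -> (`|fn n t| <= `|(kernel_flux l th t)%:E|)%E}.
  apply: aeW => t n _; rewrite /fn patchE; case: ifPn => // _.
  by rewrite abse0.
have cv : {ae mu, forall t, setT t -> fn n t @[n --> \oo] --> (EFin \o kernel_flux l th) t}.
  apply: aeW => t _; apply: cvg_near_cst.
  near=> n; rewrite /fn patchE mem_set // /D /= in_itv /= -ler_norml.
  have tn : `|t| <= n%:R by near: n; exact: nbhs_infty_ger.
  by apply: le_trans tn _; rewrite ler_nat.
have ig : mu.-integrable setT (fun t => `|(kernel_flux l th t)%:E|)%E.
  exact/integrable_abse/integrable_kernel_flux.
have [_ _ cvI] := @dominated_convergence _ _ R mu setT measurableT fn _ _ mf mg cv ig dom.
have e : forall n, (\int[mu]_t fn n t = (kernel_sin l th n.+1%:R - kernel_sin l th (- n.+1%:R))%:E)%E.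
  by move=> n; rewrite /fn -integral_mkcond integral_kernel_flux_bounded.
have c0 : (kernel_sin l th n.+1%:R - kernel_sin l th (- n.+1%:R)) @[n --> \oo] --> (0 : R).
  apply/norm_cvg0P.
  have h : (2 * (n.+1%:R : R)^-1) @[n --> \oo] --> (0 : R).
    rewrite -[X in _ --> X](mulr0 2); apply: cvgM; first exact: cvg_cst.
    exact: cvg_harmonic.
  apply: (@squeeze_cvgr _ _ _ _ (cst 0) _ _ _ _ _ h); last exact: cvg_cst.
  apply: nearW => n; rewrite normr_ge0 /=.
  apply: le_trans (ler_normB _ _) _.
  (* The bound rests on 1 + x^2 / 2 >= |x|. *)
  have b x : `|x| = n.+1%:R -> `|kernel_sin l th x| <= n.+1%:R^-1.
    move=> xn; apply: le_trans (kernel_sin_le _ _ _) _; apply: le_trans (gauss_kernel_small _) _.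
    rewrite lef_pV2 ?posrE ?ltr0n //; last by rewrite ltr_pwDl // divr_ge0 // sqr_ge0.
    have := sqr_ge0 (n.+1%:R - 1 : R); rewrite -(real_normK (num_real x)) xn; lra.
  have h1 := b n.+1%:R (ger0_norm (ler0n _ _)).
  have h2 : `|kernel_sin l th (- n.+1%:R)| <= n.+1%:R^-1 by apply: b; rewrite normrN ger0_norm.
  by apply: le_trans (lerD h1 h2) _; rewrite mulr2n mulrDl mul1r.
move: cvI; under eq_fun do rewrite e; move=> cvI.
rewrite -(cvg_lim (@ereal_hausdorff R) cvI).
apply: cvg_lim; first exact: ereal_hausdorff.
by apply: cvg_EFin => //; exact: nearW.
Unshelve. all: by end_near. Qed.

Definition kernel_transform th l := \int[mu]_t kernel_cos l th t.

Lemma Rintegral_kernel_flux l th : l * kernel_transform th l = \int[mu]_t (t * kernel_sin l th t).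
Proof.
apply/eqP; rewrite -subr_eq0 /kernel_transform -RintegralZl //; last exact: integrable_kernel_cos.
rewrite -RintegralB //; last exact: integrable_mul_kernel_sin.
  by rewrite /Rintegral integral_kernel_flux.
have i1 : mu.-integrable setT (fun t => l%:E * (kernel_cos l th t)%:E)%E.
  by apply: integrableZl => //; exact: integrable_kernel_cos.
by apply: eq_integrable i1.
Qed.

Lemma is_derive_kernel_transform th l :
  is_derive l 1 (kernel_transform th) (- (l * kernel_transform th l)).
Proof.
have I : `]l - 1, l + 1[%classic l by rewrite /= in_itv /=; lra.
have if' : forall x : R, `]l - 1, l + 1[%classic x -> mu.-integrable setT (EFin \o (fun t => kernel_cos x th t)).
  by move=> x _; exact: integrable_kernel_cos.
have df : forall (x y : R), `]l - 1, l + 1[%classic x -> [set: R] y -> derivable (fun x => kernel_cos x th y) x 1.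
  by move=> x y _ _; case: (is_derive_param x th y).
have dv x y : partial1of2 (fun l t => kernel_cos l th t) x y = - y * kernel_sin x th y.
  by rewrite partial1of2E; exact: (@derive_val _ _ _ _ _ _ _ (is_derive_param x th y)).
have G0 : forall t : R, 0 <= `|t| * gauss_kernel t by move=> t; rewrite mulr_ge0 // expR_ge0.
have ub : forall (x y : R), `]l - 1, l + 1[%classic x -> [set: R] y ->
    `|partial1of2 (fun l t => kernel_cos l th t) x y| <= `|y| * gauss_kernel y.
  by move=> x y _ _; rewrite dv normrM normrN ler_wpM2l // kernel_sin_le.
have h1 := derivable_under_integral measurableT I if' df G0 integrable_abs_gauss_kernel ub.
have h2 := differentiation_under_integral measurableT I if' df G0 integrable_abs_gauss_kernel ub.
apply: DeriveDef; first exact: h1.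
rewrite -derive1E h2 Rintegral_kernel_flux -mulN1r -RintegralZl //; last exact: integrable_mul_kernel_sin.
by apply: eq_Rintegral => t _; rewrite dv mulN1r mulNr.
Qed.

(** The transform satisfies F' = - l F, so exp (l^2 / 2) F has zero derivative. *)
Lemma kernel_transformE th l : kernel_transform th l = gauss_kernel l * kernel_transform th 0.
Proof.
pose h (x : R) := expR (x ^+ 2 / 2) * kernel_transform th x.
have dh : forall x : R, is_derive x (1 : R) h 0.
  move=> x.
  have h1 : is_derive x 1 (fun t => expR (t ^+ 2 / 2)) (x * expR (x ^+ 2 / 2)).
    have H : is_derive x 1 (fun t => t ^+ 2 / 2) x.
      apply: is_derive_eq; rewrite /GRing.scale /=; lra.
    have := @is_derive1_comp R expR (fun t => t ^+ 2 / 2) x _ _ (is_derive_expR _) H.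
    by move=> h1; apply: is_derive_eq; rewrite mulrC.
  have := is_deriveM h1 (is_derive_kernel_transform th x).
  move=> h2; apply: is_derive_eq; rewrite /GRing.scale /=; ring.
have := is_derive_0_is_cst l 0 dh; rewrite /h expr0n mul0r expR0 mul1r => <-.
by rewrite mulrA /gauss_kernel -expRD addNr expR0 mul1r.
Qed.

End GaussianFourier.

Section NormalTransform.
Variable R : realType.
Local Notation lam := (@lebesgue_measure R).

Lemma integral_normal_prob (f : R -> \bar R) : (normal_prob (0 : R) 1).-integrable setT f ->
  (\int[normal_prob 0 1]_x f x = \int[lam]_x (f x * (normal_pdf 0 1 x)%:E))%E.
Proof.
move=> fi; have dom := normal_prob_dominates (0 : R) 1.
have mf : measurable_fun setT f by exact: (measurable_int _ fi).
rewrite -(Radon_Nikodym_change_of_variables dom) //.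
have mpdf : measurable_fun setT (EFin \o normal_pdf (0 : R) 1).
  by apply/measurable_EFinP; exact: measurable_normal_pdf.
have irn : lam.-integrable setT (Radon_Nikodym (charge_of_finite_measure (normal_prob (0 : R) 1)) lam).
  exact: Radon_Nikodym_integrable.
apply: ae_eq_integral => //.
- by apply: emeasurable_funM => //; apply: measurable_int irn.
- exact: emeasurable_funM.
- apply: ae_eqe_mul2l => /=; apply: integral_ae_eq => //=.
  move=> E _ mE; rewrite -Radon_Nikodym_integral //.
Qed.

(** The value of the transform at 0 is never computed: read at l = 0, formula [E] identifies it, up
    to the normalization, with the integral of the constant cos th against a probability. *)
Lemma normal_prob_cos (l th : R) :
  \int[normal_prob 0 1]_t cos (l * t + th) = gauss_kernel l * cos th.
Proof.
have E k : \int[normal_prob 0 1]_t cos (k * t + th) = normal_peak 1 * kernel_transform th k.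
  rewrite /kernel_transform -RintegralZl //; last exact: integrable_kernel_cos.
  rewrite /Rintegral integral_normal_prob.
    congr fine; apply: eq_integral => t _; rewrite /normal_pdf oner_eq0 gauss_kernel_normal_fun.
    by rewrite -EFinM /kernel_cos; congr EFin; ring.
  apply: (@bounded_measurable_integrable _ _ R _ _ _ 1).
  - exact: probability_setT.
  - apply: continuous_measurable_fun; apply: continuous_phase; exact: continuous_cos.
  - by move=> t; rewrite ler_norml cos_geN1 cos_le1.
rewrite E kernel_transformE mulrCA -E.
under eq_Rintegral do rewrite mul0r add0r.
rewrite Rintegral_cst //; congr (_ * _); rewrite -[RHS]mulr1; congr (_ * _).
exact: (congr1 fine (probability_setT (normal_prob (0 : R) 1))).
Qed.

End NormalTransform.

Section GaussianExists.
Variables (R : realType) (a : nat -> nat) (a_gt1 : forall j, (1 < a j)%N).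
Local Notation X := (solenoid R a_gt1).
Local Notation Y := (character R X).
Local Notation proj := (@solenoid_proj R a a_gt1).
Local Notation ratio := (@char_ratio R a a_gt1).
Local Notation Re := (@complex.Re R).
Local Notation Im := (@complex.Im R).

Lemma bounded_measurable_continuous (f : measurableTypeR R -> R[i]) : continuous (fun t : R => Re (f t)) ->
  continuous (fun t : R => Im (f t)) -> (forall t, `|f t| <= 1) -> bounded_measurable f.
Proof.
move=> c1 c2 b; split; first exact: continuous_measurable_fun.
  exact: continuous_measurable_fun.
by exists 1.
Qed.

Lemma measurable_real_proj (c : R) : measurable_fun setT (fun t : measurableTypeR R => proj (c * t, 0)).
Proof.
apply: measurable_to_solenoid => y.
rewrite (_ : (fun t => _) = (fun t => circ (ratr (ratio y) * (c * t)))); last first.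
  by apply/funext => t; rewrite char_ratioP.
have cc : continuous (fun t : R => circ (ratr (ratio y) * (c * t)) : R[i]^o).
  move=> t; apply: (@continuous_comp R R (R[i]^o) (fun t => ratr (ratio y) * (c * t)) (@circ R)).
    by apply: cvgM; [exact: cvg_cst | apply: cvgM; [exact: cvg_cst | exact: cvg_id]].
  exact: continuous_circ.
apply: bounded_measurable_continuous.
- by move=> t; exact: (Re_cvg (cc t)).
- by move=> t; exact: (Im_cvg (cc t)).
- by move=> t; rewrite norm_circ.
Qed.

(** The measure is the image of the standard normal law under t |-> proj (c t, 0), translated by x.
    The scale c is chosen so that (2 pi c)^2 / 2 = s; the imaginary part vanishes because its phase
    is - pi / 2. *)
Lemma gaussian_exists (x : X) (s : R) : 0 <= s ->
  exists gam : probability X R,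
    gaussian gam /\
    forall y, char_function gam y = y x * cexpR (- (s * ratr (ratio y) ^+ 2)).
Proof.
move=> s0.
suff [gam Hg] : exists gam : probability X R, forall y,
    char_function gam y = y x * cexpR (- (s * ratr (ratio y) ^+ 2)).
  exists gam; split => //; exists x, (fun y => s * ratr (ratio y) ^+ 2); split => //.
  - by apply: character_continuous; exact: solenoid_compact.
  - by move=> y; rewrite mulr_ge0 // sqr_ge0.
  - by move=> u v; rewrite !(raddfD, raddfB, rmorphD, rmorphB, rmorphN) /=; ring.
have : (pi *+ 2 : R) != 0 by rewrite mulrn_eq0 /= gt_eqF // pi_gt0.
move E2 : (pi *+ 2 : R) => p2 p20.
pose c := Num.sqrt (2 * s) / p2.
have cs : (c * p2) ^+ 2 / 2 = s.
  by rewrite /c divfK // sqr_sqrtr ?mulr_ge0 //; field.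
pose g0 := distribution (normal_prob (0 : R) 1) (pack_mfun (measurable_real_proj c)).
pose dx : probability X R := dirac x.
pose G := @convolution_prob R a a_gt1 dx g0.
exists G => y; rewrite /G.
rewrite char_convolution dirac_char; congr (_ * _).
rewrite -[LHS]/(cintegral g0 y) cintegral_distribution; last exact: bounded_measurable_char.
set q := ratr (ratio y).
have E t : y (pack_mfun (measurable_real_proj c) t) = circ (q * (c * t)).
  by rewrite pack_mfunE char_ratioP.
rewrite (eq_cintegral _ E) /cintegral.
pose l := q * (c * p2).
have Re1 t : Re (circ (q * (c * t))) = cos (l * t + 0).
  by rewrite /circ addr0 /l; congr cos; rewrite -E2 -mulrnAl; ring.
have Im1 t : Im (circ (q * (c * t))) = cos (l * t + - (pi / 2)).
  by rewrite cosBpihalf /circ /l; congr sin; rewrite -E2 -mulrnAl; ring.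
under eq_Rintegral do rewrite Re1.
rewrite normal_prob_cos.
under eq_Rintegral do rewrite Im1.
rewrite normal_prob_cos cos0 cosN cos_pihalf mulr0 mulr1 /cexpR /gauss_kernel.
suff -> : l ^+ 2 / 2 = s * q ^+ 2 by [].
by rewrite -cs /l; field.
Qed.

End GaussianExists.

(** * Distributions with a periodic characteristic function *)

Section FiniteLaw.
Context {d} {T : measurableType d} {R : realType}.
Local Notation Re := (@complex.Re R).
Local Notation Im := (@complex.Im R).
Variables (n : nat) (c : nat -> R) (x : nat -> T).
Hypothesis c0 : forall r, 0 <= c r.
Hypothesis c1 : \sum_(r < n) c r = 1.

Definition atom_measure (r : nat) : {measure set T -> \bar R} :=
  mscale (NngNum (c0 r)) (dirac (x r)).

Lemma msum_atom_setT : msum atom_measure n setT = 1%E.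
Proof.
rewrite /msum -[1%E]/(1%:E) -c1 -sumEFin; apply: eq_bigr => r _.
by rewrite /= /mscale /= diracT mule1.
Qed.

Definition finite_law : probability T R :=
  HB.pack (msum atom_measure n) (Measure_isProbability.Build _ _ _ (msum atom_measure n) msum_atom_setT).

Lemma Rintegral_finite_law (f : T -> R) (M : R) : measurable_fun setT f ->
  (forall t, `|f t| <= M) -> Rintegral finite_law setT f = \sum_(r < n) c r * f (x r).
Proof.
(* Adding the bound makes the integrand nonnegative, as splitting the integral over a sum of
   measures requires. *)
move=> mf fM; pose g t := f t + M.
have g0 t : 0 <= g t by have := fM t; rewrite ler_norml /g; lra.
have mg : measurable_fun setT g by apply: measurable_funD.
have Eg : Rintegral finite_law setT g = \sum_(r < n) c r * g (x r).
  rewrite /Rintegral [X in fine X](_ : _ = \int[msum atom_measure n]_t (g t)%:E)%E //.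
  rewrite ge0_integral_measure_sum //; last first.
  - exact/measurable_EFinP.
  - by move=> t _; rewrite lee_fin.
  rewrite (eq_bigr (fun r : 'I_n => (c r * g (x r))%:E)); first by rewrite sumEFin.
  move=> r _; rewrite ge0_integral_mscale //=; last first.
  - by move=> t _; rewrite lee_fin.
  - exact/measurable_EFinP.
  by rewrite integral_dirac ?diracT ?mul1e ?EFinM //; exact/measurable_EFinP.
have ig : finite_law.-integrable setT (EFin \o g).
  apply: (@bounded_measurable_integrable _ _ R _ _ _ (M + M)) => //.
  - exact: probability_setT.
  - by move=> t; rewrite ger0_norm // /g; have := fM t; rewrite ler_norml; lra.
rewrite (_ : f = (fun t => g t - M)); last by apply/funext => t; rewrite /g addrK.
rewrite RintegralB //; last first.
  apply: (@bounded_measurable_integrable _ _ R _ _ _ `|M|) => //; exact: probability_setT.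
rewrite Rintegral_cst // [X in _ * fine X](_ : _ = 1%E); last exact: probability_setT.
rewrite Eg mulr1 -[X in _ - X]mul1r -c1 mulr_suml -sumrB.
by apply: eq_bigr => r _; rewrite mulrBr.
Qed.

Lemma cintegral_finite_law (h : T -> R[i]) : bounded_measurable h ->
  cintegral finite_law h = \sum_(r < n) (c r)%:C%C * h (x r).
Proof.
move=> [mr mi [M hM]]; have hR t := le_trans (Re_le_norm (h t)) (hM t).
have hI t := le_trans (Im_le_norm (h t)) (hM t).
rewrite /cintegral (@Rintegral_finite_law _ M) //; last by move=> t; move: (hR t); rewrite lecR.
rewrite (@Rintegral_finite_law _ M) //; last by move=> t; move: (hI t); rewrite lecR.
apply/eqP; rewrite eq_complex /=; apply/andP; split; apply/eqP.
  rewrite raddf_sum; apply: eq_bigr => r _; case: (h (x r)) => u v /=; ring.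
rewrite raddf_sum; apply: eq_bigr => r _; case: (h (x r)) => u v /=; ring.
Qed.

End FiniteLaw.

(** * Fourier inversion on a finite cyclic group *)

Section FiniteFourier.
Variables (R : realType) (d : nat).
Hypothesis d_gt0 : (0 < d)%N.
Local Notation C := R[i].

(** The r-th character of Z / d, read on the integers. *)
Definition wave (r : nat) (j : int) : C := circ (r%:R * j%:~R / d%:R).

Let d0 : (d%:R : R) != 0. Proof. by rewrite pnatr_eq0 -lt0n. Qed.

Lemma waveD r i j : wave r (i + j) = wave r i * wave r j.
Proof. by rewrite /wave -circD; congr circ; rewrite rmorphD /=; ring. Qed.

Lemma norm_wave r j : `|wave r j| = 1. Proof. exact: norm_circ. Qed.

Lemma waveN r j : wave r (- j) = (wave r j)^*.
Proof.
have -> : (wave r j)^* = (wave r j)^-1 by rewrite invC_norm norm_wave expr1n invr1 mul1r.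
rewrite /wave -circN; congr circ.
by rewrite rmorphN /=; ring.
Qed.

Lemma wave_period r : wave r d%:Z = 1.
Proof. by rewrite /wave mulfK //; exact: (circ_int R r%:Z). Qed.

Lemma waveX r j : wave r j = wave 1 j ^+ r.
Proof. by rewrite /wave -circMn; congr circ; rewrite -mulr_natl; ring. Qed.

Lemma wave1_eq1 j : wave 1 j = 1 -> (d%:Z %| j)%Z.
Proof.
move=> /circ_eq1[k] /(congr1 ( *%R^~ d%:R)); rewrite mul1r divfK // => jk.
apply/dvdzP; exists k; apply: (@mulrIz R _); first exact: oner_neq0.
by rewrite jk rmorphM.
Qed.

Lemma wave_sum j : \sum_(r < d) wave r j = if (d%:Z %| j)%Z then d%:R else 0.
Proof.
have wd : wave 1 j ^+ d = 1.
  by rewrite -waveX /wave mulrAC divff // mul1r circ_int.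
case: ifPn => dj.
  case/dvdzP: dj => k ->; rewrite (eq_bigr (fun=> 1)) ?sumr_const ?card_ord //.
  move=> r _; rewrite /wave rmorphM /= mulrA mulfK //.
  by rewrite -[r%:R]/(r%:Z%:~R) -intrM circ_int.
have w1 : wave 1 j - 1 != 0.
  by rewrite subr_eq0; apply: contra dj => /eqP /wave1_eq1.
apply: (mulfI w1); rewrite mulr0; transitivity (wave 1 j ^+ d - 1); last by rewrite wd subrr.
rewrite subrX1; congr (_ * _); apply: eq_bigr => r _; exact: waveX.
Qed.

Variable h : int -> C.
Hypothesis h_period : forall j, h (j + d%:Z) = h j.

Definition fourier_coef r : C := d%:R^-1 * \sum_(i < d) h i%:Z * wave r (- i%:Z).

Lemma period_mul j k : h (j + k * d%:Z) = h j.
Proof.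
elim/int_rec: k => [|k IH|k IH]; first by rewrite mul0r addr0.
  by rewrite -addn1 PoszD mulrDl mul1r addrA h_period.
rewrite -IH -[LHS]h_period; congr h; rewrite -addn1 PoszD; ring.
Qed.

Lemma fourier_inversion j : \sum_(r < d) fourier_coef r * wave r j = h j.
Proof.
have E (r : 'I_d) : fourier_coef r * wave r j =
    \sum_(i < d) d%:R^-1 * (h i%:Z * wave r (j - i%:Z)).
  rewrite /fourier_coef -mulrA mulr_suml mulr_sumr; apply: eq_bigr => i _.
  by rewrite waveD; ring.
rewrite (eq_bigr _ (fun r _ => E r)) exchange_big /=.
have E2 (i : 'I_d) : \sum_(r < d) d%:R^-1 * (h i%:Z * wave r (j - i%:Z)) =
    if (d%:Z %| j - i%:Z)%Z then h i%:Z else 0.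
  rewrite -mulr_sumr -mulr_sumr wave_sum; case: ifP => _; last by rewrite !mulr0.
  by rewrite mulrC mulfK // pnatr_eq0 -lt0n.
rewrite (eq_bigr _ (fun i _ => E2 i)).
have jm : (`|(j %% d%:Z)%Z| < d)%N by lia.
rewrite (bigD1 (Ordinal jm)) //= big1 => [|i ni].
  have -> : `|(j %% d%:Z)%Z|%N%:Z = (j %% d%:Z)%Z by lia.
  rewrite addr0 ifT; last by apply/dvdzP; exists (j %/ d%:Z)%Z; lia.
  by rewrite [in RHS](divz_eq j d%:Z) addrC period_mul.
case: ifP => // /dvdzP[k jk]; case/eqP: ni; apply: val_inj => /=.
have -> : j = k * d%:Z + i%:Z by lia.
by rewrite modzMDl modz_small //=; have := ltn_ord i; lia.
Qed.

Lemma period_sum_shift (k : int -> C) : (forall j, k (j + d%:Z) = k j) ->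
  forall j : nat, \sum_(i < d) k (i%:Z - j%:Z) = \sum_(i < d) k i%:Z.
Proof.
move=> kp; elim=> [|j <-]; first by apply: eq_bigr => i _; rewrite subr0.
case: d kp d_gt0 => // n kp _.
rewrite big_ord_recl big_ord_recr /= addrC; congr (_ + _).
  by rewrite -kp; congr k; lia.
apply: eq_bigr => i _; congr k; rewrite /bump /=; lia.
Qed.

(** By periodicity, summing over i for fixed j always gives the same S, so the quadratic form is d S
    while the coefficient is S / d. *)
Lemma fourier_coef_ge0 r :
  0 <= \sum_(i < d) \sum_(j < d) h (i%:Z - j%:Z) * wave r (- (i%:Z - j%:Z)) ->
  0 <= fourier_coef r.
Proof.
rewrite exchange_big /=; set S := \sum_(i < d) h i%:Z * wave r (- i%:Z).
rewrite (eq_bigr (fun=> S)) => [|j _]; last first.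
  apply: (@period_sum_shift (fun i => h i * wave r (- i))) => i.
  by rewrite h_period opprD waveD (waveN r d%:Z) wave_period conjC1 mulr1.
rewrite sumr_const card_ord pmulrn_lge0 // /fourier_coef -/S => S0.
by rewrite mulr_ge0 // invr_ge0 ler0n.
Qed.

End FiniteFourier.

(** * The cokernel of a nonzero endomorphism of the dual *)

Section Cokernel.
Variables (R : realType) (a : nat -> nat) (a_gt1 : forall j, (1 < a j)%N).
Local Notation X := (solenoid R a_gt1).
Local Notation Y := (character R X).
Local Notation ratio := (@char_ratio R a a_gt1).
Local Notation psi := (@solenoid_char R a a_gt1).
Variable T : {additive Y -> Y}.
Hypothesis T0 : ratio (T (psi 0%N)) != 0.

Let inL (y : Y) := exists k, y = T k.

Let inLB u v : inL u -> inL v -> inL (u - v).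
Proof. by move=> [k ->] [l ->]; exists (k - l); rewrite raddfB. Qed.

Let inLM u (j : int) : inL u -> inL (u *~ j).
Proof. by move=> [k ->]; exists (k *~ j); rewrite raddfMz. Qed.

(** T is multiplication by a rational, so its numerator times y is T of its denominator times y. *)
Lemma cokernel_torsion : exists2 n, (0 < n)%N & forall y, exists k, y *+ n = T k.
Proof.
pose q := ratio (T (psi 0%N)).
exists `|numq q|%N; first by rewrite absz_gt0 numq_eq0 T0.
move=> y; have [k kE] : inL (y *~ numq q).
  exists (y *~ denq q); apply: (@char_ratio_inj R a a_gt1).
  have E k j : ratio (k *~ j) = j%:~R * ratio k by rewrite (raddfMz ratio) mulrzl.
  by rewrite (@char_ratio_additive R a a_gt1 T) !E numqE -mulrA.
rewrite -/q; move: (numq q) kE => z kE.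
case: z kE => n kE; first by exists k.
by exists (- k); rewrite raddfN -kE NegzE mulrNz opprK.
Qed.

(* The cokernel of T is locally cyclic, being a quotient of H_a, and has finite
   exponent; a character psi m of maximal order d generates it. *)
Lemma cokernel_cyclic : exists (y0 : Y) (d : nat), [/\ (0 < d)%N,
  forall y, exists (j : int) k, y = y0 *~ j + T k,
  forall j : int, (exists k, y0 *~ j = T k) -> (d%:Z %| j)%Z &
  exists k, y0 *+ d = T k].
Proof.
have [n n0 nL] := cokernel_torsion.
pose Q m d := [/\ (0 < d)%N, inL (psi m *+ d) & forall j : int, inL (psi m *~ j) -> (d%:Z %| j)%Z].
have ordP m : exists d, Q m d.
  pose P d := (0 < d)%N && `[< inL (psi m *+ d) >].
  have exP : exists d, P d by exists n; rewrite /P n0; apply/asboolP; exact: nL.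
  case: (ex_minnP exP) => d /andP[d0 /asboolP dL] dmin.
  exists d; split=> // j jL; rewrite dvdzE /= -[`|j|%N]/(`|j|%N).
  have rL : inL (psi m *~ (j %% d%:Z)%Z).
    have -> : (j %% d%:Z)%Z = j - d%:Z * (j %/ d%:Z)%Z by lia.
    rewrite mulrzBr mulrzA; apply: inLB => //; apply: inLM.
    by rewrite -pmulrn.
  have rd : (`|(j %% d%:Z)%Z| < d)%N by lia.
  case: (posnP `|(j %% d%:Z)%Z|) => r0.
    by apply/dvdnP; exists `|(j %/ d%:Z)%Z|%N; lia.
  have : P `|(j %% d%:Z)%Z|%N.
    rewrite /P r0; apply/asboolP; rewrite pmulrn gez0_abs //; lia.
  by move/dmin; rewrite leqNgt rd.
pose QQ d := `[< exists m, Q m d >].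
have exQ : exists d, QQ d by have [d dQ] := ordP 0%N; exists d; apply/asboolP; exists 0%N.
have bQ d : QQ d -> (d <= n)%N.
  move=> /asboolP[m [d0 _ dv]]; have := dv n%:Z.
  by rewrite -pmulrn => /(_ (nL _)); rewrite dvdzE /= => /dvdn_leq; apply.
case: (ex_maxnP exQ bQ) => d /asboolP[m [d0 dL dv]] dmax.
exists (psi m), d; split => // y.
have [n' [k yE]] := solenoid_dual y.
pose M := maxn m n'.
have [C CE] := @solenoid_char_mul_le R a a_gt1 _ _ (leq_maxl m n').
have [C' C'E] := @solenoid_char_mul_le R a a_gt1 _ _ (leq_maxr m n').
rewrite -/M in CE C'E.
have [D [D0 DL Dv]] := ordP M.
have Dd : (D <= d)%N by apply: dmax; apply/asboolP; exists M.
(* D / gcd (C, D) times [psi m] = C [psi M] lies in the range, so d divides it; as D <= d by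
   maximality, the gcd is 1. *)
have CD : coprime C D.
  have g0 : (0 < gcdn C D)%N by rewrite gcdn_gt0 D0 orbT.
  have : inL (psi m *~ (D %/ gcdn C D)%N%:Z).
    rewrite -pmulrn CE -mulrnA muln_divCA_gcd.
    by rewrite mulrnA pmulrn; apply: inLM.
  move=> /dv; rewrite dvdzE /= => /dvdn_leq.
  rewrite divn_gt0 // dvdn_leq ?dvdn_gcdr // => /(_ isT) dD.
  have := leq_trans Dd dD; rewrite /coprime.
  have := divn_eq D (gcdn C D); rewrite (eqP (dvdn_gcdr C D)); nia.
(* Hence [psi M] = u C [psi M] + v D [psi M] is u [psi m] modulo the range, and [y] is a multiple of
   [psi M]. *)
have [u [v uv]] := Bezoutz C%:Z D%:Z.
have uv1 : u * C%:Z + v * D%:Z = 1 by rewrite uv /gcdz /=; move: CD => /eqP ->.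
have [k1 k1E] := inLM v DL.
exists (u * (C'%:Z * k)), (k1 *~ (C'%:Z * k)).
rewrite raddfMz -k1E CE yE C'E !pmulrn -!mulrzA -mulrzDr.
by congr (_ *~ _); rewrite -[C'%:Z * k in LHS]mul1r -uv1; ring.
Qed.

End Cokernel.

Lemma complex_closed_ge0 (R : realType) (z : R[i]) :
  (forall e : R, 0 < e -> exists2 w, 0 <= w & `|z - w| <= e%:C%C) -> 0 <= z.
Proof.
move=> zw; rewrite lecE /=; apply/andP; split.
  rewrite -normr_le0; apply/ler_addgt0Pr => e e0; rewrite add0r.
  have [w w0 zwe] := zw e e0; move: w0; rewrite lecE => /andP[/eqP w0 _].
  have := le_trans (Im_le_norm _) zwe; rewrite lecR.
  by case: z w w0 {zw zwe} => [u v] [u' v'] /= ->; rewrite subr0.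
rewrite -oppr_le0; apply/ler_addgt0Pr => e e0; rewrite add0r.
have [w w0 zwe] := zw e e0; move: w0; rewrite lecE => /andP[_ w0].
have := le_trans (Re_le_norm _) zwe; rewrite lecR ler_norml.
case: z w w0 {zw zwe} => [u v] [u' v'] /=; lra.
Qed.

Section PeriodicFactor.
Variables (R : realType) (a : nat -> nat) (a_gt1 : forall j, (1 < a j)%N).
Local Notation X := (solenoid R a_gt1).
Local Notation Y := (character R X).
Local Notation ratio := (@char_ratio R a a_gt1).
Local Notation psi := (@solenoid_char R a a_gt1).
Local Notation rr y := (ratr (ratio y) : R).
Hypothesis no_order2 : ~ exists x : X, x <> 0 /\ x *+ 2 = 0.
Variable T : {additive Y -> Y}.
Hypothesis T0 : ratio (T (psi 0%N)) != 0.
Variables (mu : probability X R) (x : X) (s : R) (l : Y -> R[i]).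
Hypothesis mu_neq0 : forall y, char_function mu y != 0.
Hypothesis s0 : 0 <= s.
Hypothesis muE : forall y, char_function mu y = y x * cexpR (- (s * rr y ^+ 2)) * l y.
Hypothesis lT : forall y k, l (y + T k) = l y.

Let l0 : l 0 = 1.
Proof.
by have := muE 0; rewrite char_function0 raddf0 rmorph0 expr0n mulr0 oppr0 cexpR0 mulr1 char0E mul1r.
Qed.

Let small e : 0 < e -> forall y, exists k, `|rr (y + T k)| < e.
Proof.
exact: (@dense_image R Y ratio (character_half no_order2) T (psi 0%N) e T0).
Qed.

(** Modulo the range of T, [y] has a representative of ratio below 1 in modulus; there the Gaussian
    factor is at least exp (- s), while |char_function mu| <= 1. *)
Let l_bound y : `|l y| <= cexpR s.
Proof.
have [k ky] := small ltr01 y; rewrite -(lT y k).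
have := char_like_le1 (char_function_char_like mu_neq0) (y + T k).
rewrite muE normrM (normrM ((y + T k) x)) char_norm mul1r norm_cexpR => H.
have sG := ltW (cexpR_gt0 s); apply: le_trans (_ : cexpR s * 1 <= _); last by rewrite mulr1.
apply: le_trans (ler_wpM2l sG H).
rewrite [leRHS]mulrA.
rewrite -cexpRD ler_peMl //.
rewrite -cexpR0 /cexpR lecR ler_expR subr_ge0 -[leRHS]mulr1 ler_wpM2l //.
by rewrite -real_normK ?num_real // expr_le1 // ltW.
Qed.

(** By duality the basic character of the cyclic cokernel is evaluation at a point [x1], which
    annihilates the range of T; the multiples of [x1] become the atoms of omega. *)
Lemma cokernel_character (y0 : Y) d : (0 < d)%N ->
  (forall y, exists (j : int) k, y = y0 *~ j + T k) ->
  (forall j : int, (exists k, y0 *~ j = T k) -> (d%:Z %| j)%Z) ->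
  exists x1 : X, forall (j : int) k, (y0 *~ j + T k) x1 = wave R d 1 j.
Proof.
move=> d0 gen dv.
pose j_of y := projT1 (cid (gen y)).
have j_ofP (j : int) k : wave R d 1 (j_of (y0 *~ j + T k)) = wave R d 1 j.
  rewrite /j_of; case: (cid _) => j' [k' E] /=.
  have /dv/dvdzP[q jq] : exists k0, y0 *~ (j - j') = T k0.
    exists (k' - k); rewrite mulrzBr raddfB; apply/eqP.
    by rewrite subr_eq addrAC -subr_eq opprK E addrC.
  have -> : j = j' + d%:Z * q by lia.
  rewrite waveD [X in _ = _ * X](_ : _ = 1) ?mulr1 //.
  by rewrite /wave mul1r rmorphM /= mulrAC divff ?mul1r ?circ_int // pnatr_eq0 -lt0n.
have [||||x1 x1E] := @character_extension R a a_gt1 (fun=> True) (fun y => wave R d 1 (j_of y)) => //.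
- by move=> u _; exact: norm_wave.
- move=> u v _ _; have [j [k ->]] := gen u; have [j' [k' ->]] := gen v.
  have -> : y0 *~ j + T k + (y0 *~ j' + T k') = y0 *~ (j + j') + T (k + k').
    by rewrite (raddfD T) mulrzDr addrACA.
  by rewrite !j_ofP waveD.
by exists x1 => j k; rewrite x1E // j_ofP.
Qed.

(* Modulo the range of T, the characters y0 *~ i have representatives with
   arbitrarily small ratio, where the Gaussian factor of mu is close to 1; hence
   the positive definiteness of char_function mu passes to l. *)
Lemma periodic_pd (y0 : Y) d r :
  0 <= \sum_(i < d) \sum_(j < d) l (y0 *~ (i%:Z - j%:Z)) * wave R d r (- (i%:Z - j%:Z)).
Proof.
apply: complex_closed_ge0 => e e0.
pose B := expR s; have B0 : 0 < B by exact: expR_gt0.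
(* There are d^2 terms, each with |l| <= B = exp s, and the Gaussian factor is off by at most s (2
   e1)^2, as ratios of differences are below 2 e1 and 1 - exp (- t) <= t. *)
pose M := (d * d)%:R * (B * (s * 4)).
have M0 : 0 <= M by rewrite !mulr_ge0 // ltW.
pose e1 := Num.min 1 (e / (M + 1)).
have e10 : 0 < e1 by rewrite lt_min ltr01 divr_gt0 // ltr_pwDr.
have Me : M * e1 ^+ 2 <= e.
  have e11 : e1 <= 1 by rewrite ge_min lexx.
  have e1e : e1 * (M + 1) <= e by rewrite -ler_pdivlMr ?ge_min ?lexx ?orbT // ltr_pwDr.
  nra.
have [w wP] : exists w : 'I_d -> Y, forall i : 'I_d, `|rr (y0 *~ i%:Z + T (w i))| < e1.
  by exists (fun i : 'I_d => projT1 (cid (small e10 (y0 *~ i%:Z)))) => i; case: (cid _).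
pose V (i : 'I_d) := y0 *~ i%:Z + T (w i).
pose b (i : 'I_d) := wave R d r (- i%:Z).
(* The conjugate of [V i x] cancels the translation factor of [mu] by [x] in the quadratic form. *)
pose c (i : 'I_d) := b i * (V i x)^*.
pose E (i j : 'I_d) : R[i] := cexpR (- (s * rr (V i - V j) ^+ 2)).
have lV i j : l (V i - V j) = l (y0 *~ (i%:Z - j%:Z)).
  rewrite -(lT (y0 *~ _) (w i - w j)); congr l.
  by rewrite /V (raddfB T) mulrzBr opprD addrACA.
have bb i j : b i * (b j)^* = wave R d r (- (i%:Z - j%:Z)).
  by rewrite /b -waveN -waveD opprK; congr wave; lia.
exists (\sum_i \sum_j c i * (c j)^* * char_function mu (V i - V j)).
  exact: char_function_pd.
have wE i j : c i * (c j)^* * char_function mu (V i - V j) =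
    l (y0 *~ (i%:Z - j%:Z)) * wave R d r (- (i%:Z - j%:Z)) * E i j.
  have vx : (V i - V j) x = V i x * (V j x)^* by rewrite charDE charNE char_conj.
  have vi : (V i x)^* * V i x = 1 by rewrite -char_conj mulVf // char_neq0.
  have vj : V j x * (V j x)^* = 1 by rewrite -char_conj mulfV // char_neq0.
  have conjM (u v : R[i]) : (u * v^*)^* = u^* * v by rewrite rmorphM /= conjCK.
  rewrite muE lV vx -bb /c conjM -/(E i j).
  move: (E i j) (b i) (b j)^* (V i x) (V j x) (l _) vi vj => E0 b1 b2 u v l1 vi vj.
  have -> : b1 * u^* * (b2 * v) * (u * v^* * E0 * l1) = (u^* * u) * (v * v^*) * (l1 * (b1 * b2) * E0).
    by ring.
  by rewrite vi vj !mul1r.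
rewrite -sumrB; apply: le_trans (ler_norm_sum _ _ _) _.
apply: le_trans (_ : \sum_(i < d) \sum_(j < d) (B * (s * 4 * e1 ^+ 2))%:C%C <= _); last first.
  rewrite sumr_const card_ord sumr_const card_ord -mulrnA -[X in X <= _]mulr_natl.
  rewrite -(rmorph_nat (real_complex R)) -rmorphM /= lecR; apply: le_trans Me.
  by rewrite /M !mulrA.
apply: ler_sum => i _; rewrite -sumrB; apply: le_trans (ler_norm_sum _ _ _) _.
apply: ler_sum => j _; rewrite wE -[X in `|X - _|]mulr1 -mulrBr !normrM norm_wave mulr1.
rewrite rmorphM; apply: ler_pM; rewrite ?normr_ge0 ?l_bound //.
have E1 : E i j <= 1 by rewrite cexpR_le1 oppr_le0 mulr_ge0 // sqr_ge0.
rewrite ger0_norm ?subr_ge0 //.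
have -> : 1 - E i j = (1 - expR (- (s * rr (V i - V j) ^+ 2)))%:C%C by rewrite /E rmorphB.
rewrite lecR.
have := expR_ge1Dx (- (s * rr (V i - V j) ^+ 2)).
have : s * rr (V i - V j) ^+ 2 <= s * 4 * e1 ^+ 2.
  rewrite -mulrA ler_wpM2l //.
  have := wP i; have := wP j; rewrite -/(V i) -/(V j) !raddfB /= !ltr_norml.
  move=> /andP[? ?] /andP[? ?]; nra.
lra.
Qed.

(** The law puts on r [x1] the r-th Fourier coefficient of l along the generator [y0]. Positive
    definiteness makes the weights nonnegative, inversion at 0 makes their sum l 0 = 1, and
    inversion at j recovers l. *)
Lemma periodic_factor_exists : exists omega : probability X R,
  forall y, char_function omega y = l y.
Proof.
have [y0 [d [d0 gen dv [kd kdE]]]] := cokernel_cyclic T0.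
have [x1 x1E] := cokernel_character d0 gen dv.
pose h j := l (y0 *~ j).
have h_period j : h (j + d%:Z) = h j by rewrite /h mulrzDr -pmulrn kdE lT.
pose fc := fourier_coef d h.
have fc0 r : 0 <= fc r by apply: fourier_coef_ge0 => //; exact: periodic_pd.
pose c r := complex.Re (fc r).
have cE r : (c r)%:C%C = fc r.
  by rewrite /c; have := fc0 r; rewrite lecE; case: (fc r) => u v /= /andP[/eqP -> _].
have c0 r : 0 <= c r by rewrite -lecR cE.
have c1 : \sum_(r < d) c r = 1.
  apply: (@complexI R); rewrite rmorph_sum /= -[RHS]l0 -[l 0]/(l (y0 *~ 0)) -/(h 0).
  rewrite -(fourier_inversion d0 h_period 0); apply: eq_bigr => r _.
  by rewrite cE /wave mulr0 mul0r circ0 mulr1.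
exists (finite_law (fun r => x1 *+ r) c0 c1) => y.
rewrite -[LHS]/(cintegral _ y) cintegral_finite_law; last exact: bounded_measurable_char.
have [j [k ->]] := gen y.
rewrite lT -/(h j) -(fourier_inversion d0 h_period j); apply: eq_bigr => r _.
by rewrite cE char_atMn x1E -waveX.
Qed.

End PeriodicFactor.

(** * Factorization of the distributions *)

Section Factorization.
Variables (R : realType) (a : nat -> nat) (a_gt1 : forall j, (1 < a j)%N).
Local Notation X := (solenoid R a_gt1).
Local Notation Y := (character R X).
Local Notation ratio := (@char_ratio R a a_gt1).
Local Notation psi := (@solenoid_char R a a_gt1).
Local Notation rr y := (ratr (ratio y) : R).

Section IdPlus.
Variable al : {additive Y -> Y}.

Definition id_plus (y : Y) : Y := y + al y.

Fact id_plus_zmod_morphism : zmod_morphism id_plus.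
Proof. by move=> u v; rewrite /id_plus (raddfB al) opprD addrACA. Qed.

HB.instance Definition _ := GRing.isZmodMorphism.Build Y Y id_plus id_plus_zmod_morphism.
End IdPlus.

Lemma inverse_zmod_morphism (U V : zmodType) (f : U -> V) (g : V -> U) :
  zmod_morphism f -> cancel f g -> cancel g f -> zmod_morphism g.
Proof. by move=> fB fK gK x y; rewrite -{1}[x]gK -{1}[y]gK -fB fK. Qed.

Lemma char_atMz (y : Y) x (k : int) : y (x *~ k) = y x ^ k.
Proof.
case: k => n; first exact: char_atMn.
by rewrite NegzE mulrNz char_atN -pmulrn char_atMn exprnN.
Qed.

(** Composing with [f_q] shows that q times the adjoint of [psi 0] is p times [psi 0], so the ratio
    is p / q. *)
Lemma automorphism_gt0_ratio (alpha : X -> X) (malpha : zmod_morphism alpha)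
    (calpha : continuous alpha) :
  automorphism_gt0 alpha -> 0 < ratio (adjoint malpha calpha (psi 0%N)).
Proof.
move=> [p [q [[_ _ _ apq] pq0]]]; set y := adjoint malpha calpha (psi 0%N).
have rM (u : Y) (k : int) : ratio (u *~ k) = k%:~R * ratio u by rewrite (raddfMz ratio) mulrzl.
have yq : y *~ q = psi 0%N *~ p.
  apply: char_ext => x; rewrite !charMzE -!char_atMz.
  by rewrite /y adjointE; congr (psi 0%N _); exact: apq.
have := congr1 ratio yq; rewrite !rM char_ratio_solenoid_char0 mulr1 => E.
(* For q = 0 the quotient would be 0, since the inverse of 0 is 0 by convention. *)
have q0 : (q%:~R : rat) != 0 by apply: contraTneq pq0 => ->; rewrite invr0 mulr0 ltxx.
by move: pq0; rewrite -E mulrAC divff // mul1r.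
Qed.

Hypothesis no_order2 : ~ exists x : X, x <> 0 /\ x *+ 2 = 0.
Variables (alpha : X -> X).
Hypothesis alpha_aut : topological_automorphism alpha.
Variables (malpha : zmod_morphism alpha) (calpha : continuous alpha).
Local Notation al := (adjoint malpha calpha).
Local Notation a0 := (ratio (al (psi 0%N))).
Variables mu1 mu2 : probability X R.
Hypotheses (mu1_neq0 : forall y, char_function mu1 y != 0)
  (mu2_neq0 : forall y, char_function mu2 y != 0)
  (mu_heyde : heyde al (char_function mu1) (char_function mu2)).

Lemma heyde_factorization : exists (x1 x2 : X) (s1 s2 : R) (omega : probability X R),
  [/\ [/\ 0 <= s1, 0 <= s2 & s1 + ratr a0 * s2 = 0],
    forall y, char_function mu1 y = y x1 * cexpR (- (s1 * rr y ^+ 2)) * char_function omega y,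
    forall y, char_function mu2 y = y x2 * cexpR (- (s2 * rr y ^+ 2)) * char_function omega y &
    forall k, char_function omega (k + al k) = 1].
Proof.
set f := char_function mu1; set g := char_function mu2.
have r_inj := @char_ratio_inj R a a_gt1.
have half := character_half no_order2.
have r_al y : ratio (al y) = a0 * ratio y by exact: char_ratio_additive.
have fc := char_function_char_like mu1_neq0; have gc := char_function_char_like mu2_neq0.
(* For a0 = -1 the relation between s1 and s2 only says s1 = s2, and the range of id + al is 0; the
   pair (0, 0) is therefore imposed. A nonzero s2 then guarantees that id + al is nonzero. *)
have [s1 [s2 [[s10 s20 s12 [G1 GD GF]] aN1]]] : exists s1 s2,
    heyde_solution ratio al a0 f g s1 s2 /\ (a0 = -1 -> s2 = 0).
  have [aN1|aN1] := eqVneq a0 (-1).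
    by exists 0, 0; split => //; exact: (heyde_solution_opp1 r_inj half r_al fc gc mu_heyde aN1).
  have [minv [inv [fK gK _ cinv]]] := alpha_aut.
  have inv_morph := inverse_zmod_morphism malpha fK gK.
  have alK : cancel (@adjoint R X inv inv_morph cinv) al.
    move=> y; apply: (@char_ext R X) => x; exact: (congr1 y (fK x)).
  have ry0 : ratio (psi 0%N) != 0 by rewrite char_ratio_solenoid_char0.
  have [s1 [s2 S]] := heyde_equation r_inj half r_al alK ry0 fc gc mu_heyde.
  by exists s1, s2; split => // e; rewrite e eqxx in aN1.
pose G := gauss_twist ratio s2 g.
have [x2 x2E] : exists x2 : X, forall k, (k + al k) x2 = G (k + al k).
  have [||||x2 H] := @character_extension R a a_gt1 (fun u => exists k, u = k + al k) G.
  - by exists 0; rewrite raddf0 addr0.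
  - by move=> _ _ [k ->] [j ->]; exists (k - j); rewrite raddfB opprD addrACA.
  - by move=> _ [k ->]; exact: G1.
  - by move=> u _ _ [k ->]; exact: GD.
  by exists x2 => k; apply: H; exists k.
pose l y := G y / y x2.
have gE y : g y = y x2 * cexpR (- (s2 * rr y ^+ 2)) * l y.
  rewrite /l /G /gauss_twist.
  have e : cexpR (s2 * rr y ^+ 2) * cexpR (- (s2 * rr y ^+ 2)) = 1.
    by rewrite -cexpRD subrr cexpR0.
  have n0 := char_neq0 y x2; move: (g y) (cexpR _) (cexpR _) (y x2) e n0.
  move=> w e1 e2 v e n0; rewrite -[LHS]mulr1 -e; field.
  exact: n0.
have lp y k : l (y + id_plus al k) = l y.
  have Gn0 : G (k + al k) != 0 by rewrite -normr_eq0 G1 oner_eq0.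
  rewrite /l /id_plus charDE x2E /G GD -/G; rewrite -/(G (k + al k)) in Gn0 *.
  by rewrite -mulf_div divff // mulr1.
have fE y : f y = y (- alpha x2) * cexpR (- (s1 * rr y ^+ 2)) * l y.
  (* Where the first translation point comes from: the factor of [x2] at - (y + al y) cancels y x2
     and leaves the value of y at - alpha x2. *)
  have pN : G (- (y + al y)) = (y x2)^-1 * y (- alpha x2).
    rewrite opprD -(raddfN al) -x2E charDE charNE adjointE charNE char_atN.
    by [].
  have e : cexpR (s1 * rr y ^+ 2) * cexpR (- (s1 * rr y ^+ 2)) = 1.
    by rewrite -cexpRD subrr cexpR0.
  have := GF y; rewrite -!/(G _) pN /gauss_twist => E.
  rewrite -[LHS]mulr1 -e mulrA E /l; ring.
have [omega omegaE] : exists omega : probability X R, forall y, char_function omega y = l y.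
  have [s2_0|s2_0] := eqVneq s2 0.
    exists (convolution_prob mu2 (dirac (- x2))) => y.
    rewrite char_convolution dirac_char char_atN -/g gE s2_0 mul0r oppr0 cexpR0 mulr1.
    by rewrite mulrAC divff ?mul1r // char_neq0.
  apply: (periodic_factor_exists no_order2 _ mu2_neq0 s20 gE lp).
  have -> : ratio (id_plus al (psi 0%N)) = 1 + a0.
    by rewrite [LHS](raddfD ratio); congr (_ + _); exact: char_ratio_solenoid_char0.
  apply: contra s2_0 => /eqP e.
  by apply/eqP/aN1/eqP; rewrite -addr_eq0 addrC e.
exists (- alpha x2), x2, s1, s2, omega; split => //.
- by move=> y; rewrite omegaE -fE.
- by move=> y; rewrite omegaE -gE.
- move=> k; rewrite -(char_function0 omega) !omegaE -[RHS](lp 0 k); congr l.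
  by rewrite add0r.
Qed.

End Factorization.

Theorem theorem1 (R : realType) (a : nat -> nat) (a_gt1 : forall j, (1 < a j)%N)
    (no_order2 : ~ exists x : solenoid R a_gt1, x <> 0 /\ x *+ 2 = 0)
    (alpha : solenoid R a_gt1 -> solenoid R a_gt1)
    (alpha_aut : topological_automorphism alpha)
    (d : measure_display) (Om : measurableType d) (P : probability Om R)
    (xi1 xi2 : {RV P >-> solenoid R a_gt1})
    (xi_indep : independent_RV P xi1 xi2)
    (mu1_neq0 : forall y, char_function (distribution P xi1) y != 0)
    (mu2_neq0 : forall y, char_function (distribution P xi2) y != 0)
    (L_sym : symmetric_conditional P (fun w => xi1 w + xi2 w)
                                     (fun w => xi1 w + alpha (xi2 w))) :
  exists gamma1 gamma2 omega : probability (solenoid R a_gt1) R,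
    [/\ gaussian gamma1,
        gaussian gamma2,
        omega [set x | x + alpha x = 0] = 1%E,
        (forall A, measurable A ->
          distribution P xi1 A = convolution gamma1 omega A /\
          distribution P xi2 A = convolution gamma2 omega A) &
        automorphism_gt0 alpha ->
          exists x1 x2 : solenoid R a_gt1, forall A, measurable A ->
            distribution P xi1 A = convolution (dirac x1) omega A /\
            distribution P xi2 A = convolution (dirac x2) omega A].
Proof.
have [malpha [inv [_ _ calpha _]]] := alpha_aut.
have H := heyde_char_function malpha calpha xi_indep L_sym.
have [x1 [x2 [s1 [s2 [omega [[s10 s20 s12] mu1E mu2E omega1]]]]]] :=
  heyde_factorization no_order2 alpha_aut mu1_neq0 mu2_neq0 H.
have [g1 [G1 g1E]] := gaussian_exists x1 s10.
have [g2 [G2 g2E]] := gaussian_exists x2 s20.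
exists g1, g2, omega; split => //.
- exact: kernel_concentrated omega1.
- by move=> A mA; split; apply: convolution_unique => // y; rewrite ?mu1E ?mu2E ?g1E ?g2E.
move=> /(automorphism_gt0_ratio malpha calpha) a00.
have {}a00 : (0 : R) < ratr (char_ratio (adjoint malpha calpha (solenoid_char R a_gt1 0))).
  by rewrite ltr0q.
have s2_0 : s2 = 0 by apply/eqP; rewrite eq_le s20 andbT; nra.
have s1_0 : s1 = 0 by rewrite -s12 s2_0 mulr0 addr0.
exists x1, x2 => A mA; split.
  by apply: convolution_unique => // y; rewrite dirac_char mu1E s1_0 mul0r oppr0 cexpR0 mulr1.
by apply: convolution_unique => // y; rewrite dirac_char mu2E s2_0 mul0r oppr0 cexpR0 mulr1.
Qed.
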